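(* Let $\alpha_1>0$ and $\alpha>0$, let $m\in L^2(\Omega)$, and let $\mathcal{A}$ be a linear operator satisfying one of the following assumptions: (A) $\Omega\subset\mathbb{R}^2$ is some open and bounded set, $\mathcal{A}:L^2(D)\to L^2(\Omega)$ is compact and $\mathcal{A}:L^1(D)\to\mathcal{D}'(\Omega)$ is continuous; or (B) $\mathcal{A}:L^1(D)\to\mathbb{R}^M$ is bounded, where $\Omega=\{1,\dots,M\}$ is equipped with the counting measure so that $L^2(\Omega)=\mathbb{R}^M$. Define $S_\infty:BV(D)\to\mathbb{R}$ by $$S_\infty(u)=\|\mathcal{A}u-m\|_{L^2(\Omega)}^2+\alpha_1\|u\|_{L^1(D)}+\alpha V(u),$$ and, for $j=1,2,3,\dots$, define $S_j:BV(D)\to\mathbb{R}\cup\{\infty\}$ by $S_j(u)=S_\infty(u)$ if $u\in\mathrm{Range}(T_j)$ and $S_j(u)=\infty$ if $u\notin\mathrm{Range}(T_j)$. Set $s_\infty=\inf_{u\in BV(D)}S_\infty(u)$, $s_j=\inf_{u\in BV(D)}S_j(u)$, $\arg\min(S_j)=\{u\in BV(D): S_j(u)=s_j\}$ and $\arg\min(S_\infty)=\{u\in BV(D): S_\infty(u)=s_\infty\}$. Then: (i) $\lim_{j\to\infty}s_j=s_\infty$. (ii) For all $j=1,2,3,\dots$ there exists a minimizer $\widetilde u_j\in\arg\min(S_j)$. (iii) There exists a minimizer $\widetilde u_\infty\in\arg\min(S_\infty)$. (iv) Any sequence $\widetilde u_j\in\arg\min(S_j)$ of minimizers has a subsequence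 $\widetilde u_{j(\ell)}$ that converges weakly in $BV(D)$ to some limit $w\in BV(D)$ as $\ell\to\infty$. Furthermore, $\lim_{\ell\to\infty}V(\widetilde u_{j(\ell)})=V(w)$, that is, the subsequence $\widetilde u_{j(\ell)}$ converges to $w$ in the intermediate topology of $BV(D)$. (v) The limit $w$ in (iv) is a minimizer: $w\in\arg\min(S_\infty)$.
   Context: $D=[0,1]^2\subset\mathbb{R}^2$. The anisotropic space $BV(D)$ consists of functions $u\in L^1(D)$ with $V(u)<\infty$, where for smooth $u$ $$V(u)=V(u;D)=\int_D\left(\left|\frac{\partial u(x)}{\partial x_1}\right|+\left|\frac{\partial u(x)}{\partial x_2}\right|\right)dx,$$ and for general $u$ each term $\int_D|\partial u/\partial x_k|\,dx$ is understood as the total variation of the distributional derivative $\partial u/\partial x_k$ interpreted as a (signed Borel) measure. The norm is $\|u\|_{BV(D)}=\|u\|_{L^1(D)}+V(u;D)$. In two dimensions $BV(D)\subset L^2(D)$, so $\mathcal{A}u$ is defined for $u\in BV(D)$ in both cases (A) and (B). Weak convergence in $BV(D)$: $u_j\to u$ weakly in $BV(D)$ if $\lim_{j\to\infty}\|u_j-u\|_{L^1(D)}=0$ and $\nabla u_j\to\nabla u$ weakly in $\mathbf{M}(D,\mathbb{R}^2)$, where $\mathbf{M}(D,\mathbb{R}^2)$ is the space of $\mathbb{R}^2$-valued Borel measures on $D$, viewed as the dual of $C(D;\mathbb{R}^2)$ (weak convergence means convergence tested against $C(D;\mathbb{R}^2)$). Intermediate convergence in $BV(D)$: $u_j\to u$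 intermediately if $\lim_{j\to\infty}\|u_j-u\|_{L^1(D)}=0$ and $\lim_{j\to\infty}V(u_j)=V(u)$. Dyadic projections: for $j\ge 1$ and $0\le k_1,k_2\le 2^j-1$ let $S_{j,\vec k}=[k_12^{-j},(k_1+1)2^{-j}]\times[k_22^{-j},(k_2+1)2^{-j}]$. $T_j:L^2(D)\to L^2(D)$ is the orthogonal projection given by averaging over squares: $(T_ju)|_{\mathrm{int}(S_{j,\vec k})}=\frac{1}{|S_{j,\vec k}|}\int_{S_{j,\vec k}}u(x)\,dx$. Thus $\mathrm{Range}(T_j)$ is the set of $L^2(D)$ functions that are constant on each open square of the $2^j\times2^j$ dyadic grid. *)

(* Defs.v *)
From HB Require Import structures.
From mathcomp Require Import all_boot all_order all_algebra.
From mathcomp Require Import all_classical all_reals all_analysis.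

Set Implicit Arguments.
Unset Strict Implicit.
Unset Printing Implicit Defensive.
Import Order.TTheory GRing.Theory Num.Theory.
Import numFieldNormedType.Exports.

Local Open Scope classical_set_scope.
Local Open Scope ring_scope.

(* [plane R] is convertible to [R * R]: the former carries the product
   sigma-algebra (the Borel sets of R^2), the latter the normed structure. *)
Notation plane R := (measurableTypeR R * measurableTypeR R)%type.

Definition leb2 (R : realType) : {measure set (plane R) -> \bar R} :=
  (@lebesgue_measure R \x @lebesgue_measure R)%E.

Definition unit_square (R : realType) : set (R * R) :=
  `[0, 1]%classic `*` `[0, 1]%classic.

Lemma measurable_unit_square (R : realType) :
  measurable (@unit_square R : set (plane R)).
Proof. by apply: measurableX; exact: measurable_itv. Qed.

Lemma open_measurable_plane (R : realType) (U : set (R * R)) :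
  open U -> measurable (U : set (plane R)).
Proof.
move=> oU.
pose box (q : (rat * rat) * (rat * rat)) : set (plane R) :=
  `]ratr q.1.1, ratr q.1.2[%classic `*` `]ratr q.2.1, ratr q.2.2[%classic.
pose I := [set q | box q `<=` U].
have -> : (U : set (plane R)) = \bigcup_(q in I) box q.
  apply/seteqP; split => [[x y] Uxy|z [q + qz]]; last by apply.
  move: oU; rewrite openE => /(_ _ Uxy) [[A B] /= [Ax By] AB].
  have ratbox (t : R) (C : set R) : nbhs t C -> exists q : rat * rat,
      `]ratr q.1, ratr q.2[%classic t /\ `]ratr q.1, ratr q.2[ `<=` C.
    move=> /nbhs_ballP[e /= e0 teC].
    have te : t - e < t by rewrite ltrBlDr ltrDl.
    have [p1] := rat_in_itvoo te.
    rewrite in_itv/= => /andP[p1l p1r].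
    have te' : t < t + e by rewrite ltrDl.
    have [p2] := rat_in_itvoo te'.
    rewrite in_itv/= => /andP[p2l p2r].
    exists (p1, p2); split => [/=|s /=]; rewrite in_itv/= ?p1r ?p2l//.
    move=> /andP[s1 s2]; apply: teC.
    by rewrite /ball/= ltr_distlC (lt_trans p1l s1) (lt_trans s2 p2r).
  have [p [px pA]] := ratbox _ _ Ax; have [q [qy qB]] := ratbox _ _ By.
  exists (p, q); last by split.
  by move=> [s t] [/= /pA As /qB Bt]; exact: AB.
rewrite bigcup_mkcond; apply: countable_bigcupT_measurable => // q.
case: ifP => _; last exact: measurable0.
by apply: measurableX; exact: measurable_itv.
Qed.

Definition lebD (R : realType) : {measure set (plane R) -> \bar R} :=
  mrestr (leb2 R) (@measurable_unit_square R).

(* Elements of [L1D] (and of [L2_on] below) are functions on the whole plane, to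
   be thought of up to equality a.e. on D (resp. Omega); everything below is
   invariant under this equality. *)
Definition L1D (R : realType) := LfunType (lebD R) (lexx 1%E).

Definition L1norm (R : realType) (u : L1D R) : \bar R :=
  'N[lebD R]_1[EFin \o u]%E.

Definition L2norm (R : realType) (u : L1D R) : \bar R :=
  'N[lebD R]_2%:E[EFin \o u]%E.

Definition leb_on (R : realType) (Omega : set (R * R)) (oO : open Omega) :
  {measure set (plane R) -> \bar R} :=
  mrestr (leb2 R) (open_measurable_plane oO).

Definition L2_on (R : realType) (Omega : set (R * R)) (oO : open Omega) :=
  LfunType (leb_on oO) (lee1n 2).

Definition basis2 (R : realType) (k : 'I_2) : R * R :=
  if k == 0 then (1, 0) else (0, 1).

Definition partial (R : realType) (k : 'I_2) (phi : R * R -> R) : R * R -> R :=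
  fun x => 'D_(basis2 R k) phi x.

Definition partials (R : realType) (s : seq 'I_2) (phi : R * R -> R) :
  R * R -> R := foldr (@partial R) phi s.

Definition smooth (R : realType) (phi : R * R -> R) : Prop :=
  forall s, continuous (partials s phi) /\
    forall k x, derivable (partials s phi) x (basis2 R k).

Definition vanishes_off (R : realType) (K : set (R * R)) (phi : R * R -> R) :=
  forall x, ~ K x -> phi x = 0.

(* C_c^oo(Omega) *)
Definition test_function (R : realType) (Omega : set (R * R))
    (phi : R * R -> R) : Prop :=
  smooth phi /\
  exists K, [/\ compact K, K `<=` Omega & vanishes_off K phi].

(* D'(Omega). Only the values on test functions are meaningful. The last field
   is continuity for the topology of C_c^oo(Omega), with the seminorm
   sup_(|s| <= N) |partials s phi| replaced by an arbitrary upper bound c. *)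
Record schwartz_distribution (R : realType) (Omega : set (R * R)) :=
    Distribution {
  distribution_fun :> (R * R -> R) -> R ;
  distribution_linear : forall a phi psi,
    test_function Omega phi -> test_function Omega psi ->
    distribution_fun (fun x => a * phi x + psi x) =
      a * distribution_fun phi + distribution_fun psi ;
  distribution_continuous : forall K, compact K -> K `<=` Omega ->
    exists (C : R) (N : nat), forall phi c,
      test_function Omega phi -> vanishes_off K phi ->
      (forall s x, (size s <= N)%N -> `|partials s phi x| <= c) ->
      `|distribution_fun phi| <= C * c }.

Definition represents (R : realType) (Omega : set (R * R)) (oO : open Omega)
    (g : L2_on oO) (T : schwartz_distribution Omega) : Prop :=
  forall phi, test_function Omega phi ->
    T phi = \int[leb_on oO]_x (g x * phi x).

Definition hahn_pos (R : realType) (nu : {charge set (plane R) -> \bar R}) :=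
  sval (cid (Hahn_decomposition nu)).

Definition hahn_neg (R : realType) (nu : {charge set (plane R) -> \bar R}) :=
  sval (cid (svalP (cid (Hahn_decomposition nu)))).

Lemma hahnP (R : realType) (nu : {charge set (plane R) -> \bar R}) :
  hahn_decomposition nu (hahn_pos nu) (hahn_neg nu).
Proof. exact: svalP (cid (svalP (cid (Hahn_decomposition nu)))). Qed.

Definition charge_integral (R : realType)
    (nu : {charge set (plane R) -> \bar R}) (A : set (plane R))
    (f : plane R -> R) : R :=
  \int[jordan_pos (hahnP nu)]_(x in A) f x
  - \int[jordan_neg (hahnP nu)]_(x in A) f x.

(* [nu] is the distributional derivative of [u] in direction [k]: distributions
   live on the interior of D, so as a measure on D it does not charge the
   boundary. Such a [nu] is unique on measurable sets when it exists. *)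
Definition is_derivative_charge (R : realType) (k : 'I_2) (u : L1D R)
    (nu : {charge set (plane R) -> \bar R}) : Prop :=
  (forall A : set (plane R), measurable A ->
     nu A = nu (A `&` (@unit_square R)°)) /\
  (forall phi, test_function (@unit_square R)° phi ->
     \int[lebD R]_x (u x * partial k phi x) =
       - charge_integral nu (@unit_square R) phi).

(* The infimum is over a single value, or over the empty set (giving +oo) when
   the distributional derivative is not a measure. *)
Definition partial_variation (R : realType) (k : 'I_2) (u : L1D R) : \bar R :=
  ereal_inf [set charge_variation (hahnP nu) (@unit_square R) | nu in
    [set nu : {charge set (plane R) -> \bar R} | is_derivative_charge k u nu]].

Definition aniso_variation (R : realType) (u : L1D R) : \bar R :=
  (\sum_(k < 2) partial_variation k u)%E.

Definition BV (R : realType) : set (L1D R) :=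
  [set u | (aniso_variation u < +oo)%E].

Definition L1_cvg (R : realType) (u_ : nat -> L1D R) (u : L1D R) : Prop :=
  L1norm (u_ n - u) @[n --> \oo] --> 0%E.

Definition weak_BV_cvg (R : realType) (u_ : nat -> L1D R) (u : L1D R) : Prop :=
  L1_cvg u_ u /\
  exists (nu_ : nat -> 'I_2 -> {charge set (plane R) -> \bar R})
         (nu : 'I_2 -> {charge set (plane R) -> \bar R}),
    [/\ forall n k, is_derivative_charge k (u_ n) (nu_ n k),
        forall k, is_derivative_charge k u (nu k)
      & forall f : 'I_2 -> R * R -> R,
          (forall k, {within @unit_square R, continuous (f k)}) ->
          \sum_(k < 2) charge_integral (nu_ n k) (@unit_square R) (f k)
            @[n --> \oo] -->
          \sum_(k < 2) charge_integral (nu k) (@unit_square R) (f k)].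

Definition intermediate_BV_cvg (R : realType) (u_ : nat -> L1D R) (u : L1D R) :
    Prop :=
  L1_cvg u_ u /\ aniso_variation (u_ n) @[n --> \oo] --> aniso_variation u.

Definition dyadic_square (R : realType) (j k1 k2 : nat) : set (R * R) :=
  `[k1%:R / 2 ^+ j, k1.+1%:R / 2 ^+ j]%classic `*`
  `[k2%:R / 2 ^+ j, k2.+1%:R / 2 ^+ j]%classic.

(* T_j; the sum is 0 on the grid lines, a null set. *)
Definition dyadic_proj (R : realType) (j : nat) (v : plane R -> R) :
    plane R -> R :=
  fun x => \sum_(k1 < 2 ^ j) \sum_(k2 < 2 ^ j)
    (fine (leb2 R (@dyadic_square R j k1 k2)))^-1
    * \int[leb2 R]_(y in @dyadic_square R j k1 k2) v y
    * \1_((dyadic_square j k1 k2)°) x.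

Definition range_dyadic_proj (R : realType) (j : nat) : set (L1D R) :=
  [set u | exists2 v, v \in Lfun (lebD R) 2%:E &
                      (u : plane R -> R) = dyadic_proj j v %[ae lebD R]].

Variant measurement (R : realType) :=
| FunctionData (Omega : set (R * R)) (oO : open Omega)
    (A : L1D R -> schwartz_distribution Omega) (m : L2_on oO)
| VectorData (M : nat) (A : L1D R -> 'rV[R]_M) (m : 'rV[R]_M).

(* A is defined on L^1(D); "A : L^2(D) -> L^2(Omega)" means that A maps the
   subspace L^2(D) into the subspace L^2(Omega) of D'(Omega). As L^1(D) is
   (semi)metrizable, continuity into D'(Omega) is sequential continuity, and
   weak and strong sequential convergence coincide in D'(Omega). *)
Definition assumption_A (R : realType) (Omega : set (R * R)) (oO : open Omega)
    (A : L1D R -> schwartz_distribution Omega) : Prop :=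
  [/\ bounded_set Omega,
      forall (a : R) (u v : L1D R) phi, test_function Omega phi ->
        A (a *: u + v) phi = a * A u phi + A v phi,
      forall u, (L2norm u < +oo)%E -> exists g : L2_on oO, represents g (A u),
      forall (u_ : nat -> L1D R) (g_ : nat -> L2_on oO),
        (exists C : R, forall n, (L2norm (u_ n) <= C%:E)%E) ->
        (forall n, represents (g_ n) (A (u_ n))) ->
        exists (psi : nat -> nat) (g : L2_on oO),
          {homo psi : p q / (p < q)%N} /\
          'N[leb_on oO]_2%:E[EFin \o (g_ (psi n) - g)%R]%E @[n --> \oo] --> 0%E
    & forall (u_ : nat -> L1D R) (u : L1D R), L1_cvg u_ u ->
        forall phi, test_function Omega phi ->
          A (u_ n) phi @[n --> \oo] --> A u phi].

Definition euclid_norm (R : realType) (M : nat) (y : 'rV[R]_M) : R :=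
  Num.sqrt (\sum_i y 0 i ^+ 2).

Definition assumption_B (R : realType) (M : nat) (A : L1D R -> 'rV[R]_M) :
    Prop :=
  (forall (a : R) (u v : L1D R), A (a *: u + v) = a *: A u + A v) /\
  exists C : R, forall u, ((euclid_norm (A u))%:E <= C%:E * L1norm u)%E.

Definition admissible (R : realType) (d : measurement R) : Prop :=
  match d with
  | FunctionData _ oO A _ => assumption_A oO A
  | VectorData _ A _ => assumption_B A
  end.

(* || A u - m ||^2 in L^2(Omega); in the first case the representative g of A u
   is unique a.e., and the value is +oo if A u is not in L^2(Omega). *)
Definition misfit (R : realType) (d : measurement R) (u : L1D R) : \bar R :=
  match d with
  | FunctionData _ oO A m =>
      ereal_inf [set ('N[leb_on oO]_2%:E[EFin \o (g - m)%R] ^+ 2)%E | g in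
        [set g : L2_on oO | represents g (A u)]]
  | VectorData _ A m => (euclid_norm (A u - m) ^+ 2)%:E
  end.

Definition S_inf (R : realType) (d : measurement R) (alpha1 alpha : R)
    (u : L1D R) : \bar R :=
  (misfit d u + alpha1%:E * L1norm u + alpha%:E * aniso_variation u)%E.

Definition S_ (R : realType) (d : measurement R) (alpha1 alpha : R) (j : nat)
    (u : L1D R) : \bar R :=
  if `[< range_dyadic_proj j u >] then S_inf d alpha1 alpha u else +oo%E.

Definition infBV (R : realType) (F : L1D R -> \bar R) : \bar R :=
  ereal_inf (F @` @BV R).

Definition argminBV (R : realType) (F : L1D R -> \bar R) : set (L1D R) :=
  [set u | BV u /\ F u = infBV F].

(* Main.v *)
Require Import Defs.
From mathcomp Require Import all_boot all_order all_algebra.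
From mathcomp Require Import all_classical all_reals all_analysis.
From mathcomp Require Import measurable_realfun.
From mathcomp Require Import ring lra zify.

(** The theorem is an instance of the direct method of the calculus of variations,
    together with the density in energy of dyadic step functions. On BV the functional
    is a sum of four terms: the misfit, the [L^1] norm, and the variations in the two
    coordinate directions.

    Everything rests on the discrete variation [dvar] of the integrals [coef j u] of [u]
    over the cells of level [j]. Testing a derivative with smooth tents adapted to the
    grid gives [dvar_le_mass]: the discrete variation, weighted by the length of the
    edges, is at most the variation of the derivative. Conversely the derivative of a
    step function is carried by the edges, so that its variation is at most its weighted
    discrete variation ([has_variation_step]). The anisotropic variation is what makes
    the two fit: projecting onto step functions does not increase the variation in
    either direction. As the projections converge to [u] in [L^1] ([step_coef_cvg]),
    they form a recovery sequence ([projection_recovery]).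

    Bounds on the discrete variation also give the two embeddings of BV: into [L^2]
    ([sobolev_L2]), because every coefficient is bounded by a function of its row and by
    a function of its column, and compactly into [L^1] ([dvar_compactness]), because
    functions are uniformly close to their projections and these depend on finitely many
    coefficients.

    Along a sequence that converges in [L^1] with bounded energies, each term is lower
    semicontinuous. For the variations, the Jordan parts of the derivatives have weak
    limits ([weak_compactness]): a measure with given masses on all dyadic cells is
    obtained as an image of Lebesgue measure on an interval. Their difference represents
    the derivative of the limit. If the variation does not drop in the limit, then no mass
    is lost and none goes to the boundary, so that the derivatives themselves converge
    weakly ([charge_compactness]). For the misfit, the bound in [L^2] allows the
    compactness of the operator to be used, and continuity identifies the limit; the same
    argument gives upper semicontinuity along recovery sequences.

    Minimizers therefore exist in BV and in the range of each projection, which is closed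
    in [L^1]. The recovery sequence of a minimizer shows that the minimal energies on the
    ranges tend to the minimal energy on BV. A sequence of minimizers on the ranges has
    an [L^1] limit along a subsequence, whose energy is at most the limit of the minimal
    energies; so the limit is a minimizer, and no term drops ([energy_lsc]), which is
    intermediate and weak convergence. *)

Set Implicit Arguments.
Unset Strict Implicit.
Unset Printing Implicit Defensive.
Import Order.TTheory GRing.Theory Num.Theory.
Import numFieldNormedType.Exports.

Local Open Scope classical_set_scope.
Local Open Scope ring_scope.

(** * Extraction of subsequences *)

Lemma homo_ltn_geq (psi : nat -> nat) :
  {homo psi : p q / (p < q)%N} -> forall n, (n <= psi n)%N.
Proof.
move=> hpsi; elim=> [|n IHn]//.
exact: leq_ltn_trans IHn (hpsi _ _ (ltnSn n)).
Qed.

Lemma cvg_geq_oo (psi : nat -> nat) :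
  (forall n, (n <= psi n)%N) -> psi n @[n --> \oo] --> \oo.
Proof.
move=> hpsi A [N _ NA]; exists N => // n /= Nn.
by apply: NA => /=; apply: leq_trans Nn (hpsi n).
Qed.

Lemma cvg_subseq (T : topologicalType) (u : nat -> T) (l : T) (psi : nat -> nat) :
  {homo psi : p q / (p < q)%N} -> u n @[n --> \oo] --> l ->
  u (psi n) @[n --> \oo] --> l.
Proof.
move=> /homo_ltn_geq/cvg_geq_oo hpsi ul.
exact: (cvg_comp psi u hpsi ul).
Qed.

Lemma homo_ltn_comp (f g : nat -> nat) :
  {homo f : p q / (p < q)%N} -> {homo g : p q / (p < q)%N} ->
  {homo f \o g : p q / (p < q)%N}.
Proof. by move=> hf hg p q pq /=; apply/hf/hg. Qed.

(** Cantor's diagonal: the n-th term of the extraction is taken from the n-th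
    of a chain of nested subsequences, so from rank [i] on it is a subsequence
    of the one that makes the [i]-th coordinate converge. *)
Lemma diagonal_extraction (R : realType) (I : countType) (a : nat -> I -> R) :
  (forall i, exists C, forall n, `|a n i| <= C) ->
  exists2 psi : nat -> nat, {homo psi : p q / (p < q)%N} &
    forall i, cvgn (fun n => a (psi n) i).
Proof.
move=> aC.
have step (i : nat) (g : nat -> nat) : exists f : nat -> nat,
    {homo f : p q / (p < q)%N} /\
    forall x, unpickle i = Some x -> cvgn (fun n => a (g (f n)) x).
  case ix : (@unpickle I i) => [x|]; last by exists id; split.
  have [C hC] := aC x.
  have [|f fi cf] := @bolzano_weierstrass R (fun n => a (g n) x).
    exists C; split; first exact: num_real.
    by move=> y Cy n _; apply: le_trans (hC _) (ltW Cy).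
  exists f; split; last by move=> _ [<-].
  move=> p q pq; rewrite ltnNge; apply/negP => fqp.
  by have : (q <= p)%N; [rewrite -[(q <= p)%N](fi q p)|rewrite leqNgt pq].
pose F i g := sval (cid (step i g)).
have Fincr i g : {homo F i g : p q / (p < q)%N}.
  by rewrite /F; case: cid => f /= [].
have Fcvg i g x : unpickle i = Some x -> cvgn (fun n => a (g (F i g n)) x).
  by rewrite /F; case: cid => f /= [_ h]; exact: h.
pose G := fix G i := if i is i'.+1 then G i' \o F i' (G i') else id.
have GS i : G i.+1 = G i \o F i (G i) by [].
have Gincr i : {homo G i : p q / (p < q)%N}.
  elim: i => [p q//|i IH]; rewrite GS; exact: homo_ltn_comp.
have Gk i k : forall m, exists2 m', (m <= m')%N & G (i + k)%N m = G i m'.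
  elim: k => [|k IH] m; first by exists m; rewrite ?addn0.
  rewrite addnS GS /=.
  have [m' mm' ->] := IH (F (i + k)%N (G (i + k)%N) m).
  by exists m' => //; apply: leq_trans mm'; exact: homo_ltn_geq.
exists (fun n => G n.+1 n).
  apply: homo_ltn => [y x z|n]; first exact: ltn_trans.
  rewrite (GS n.+1); apply: Gincr.
  exact: (homo_ltn_geq (Fincr _ _)).
move=> x; set i := pickle x.
pose b n := a (G i.+1 n) x.
have /cvg_ex[l bl] : cvgn b := Fcvg i (G i) x (pickleK x).
apply/cvg_ex; exists l.
have hG n : exists2 m, (n <= m)%N & (i <= n)%N -> G n.+1 n = G i.+1 m.
  case: (leqP i n) => [le_in|]; last by exists n.
  have [m nm e] := Gk i.+1 (n - i)%N n; exists m => // _.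
  by rewrite -e; congr (G _ _); rewrite addSn subnKC.
pose h n := s2val (cid2 (hG n)).
have hn n : (n <= h n)%N by rewrite /h; case: cid2.
have hE n : (i <= n)%N -> G n.+1 n = G i.+1 (h n) by rewrite /h; case: cid2.
apply: cvg_trans (cvg_comp h b (cvg_geq_oo hn) bl).
apply: near_eq_cvg; exists i => // n le_in.
exact: (congr1 (a^~ x) (esym (hE n le_in))).
Qed.

(** * Smooth cut-offs *)

Lemma is_derive_cvg (R : realType) (V : normedModType R) (f : V -> R) (a v : V)
    (df : R) :
  h^-1 * (f (h *: v + a) - f a) @[h --> 0^'] --> df -> is_derive a v f df.
Proof.
move=> H; have e : (fun h : R => h^-1 *: (f (h *: v + a) - f a)) =
  (fun h => h^-1 * (f (h *: v + a) - f a)) by [].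
apply: DeriveDef; first by apply/cvg_ex; exists df.
exact/cvg_lim.
Qed.

Section smooth1.
Context {R : realType}.

(** The profiles [p(1/t) exp(-1/t)] on the positive half-line. They are closed under
    differentiation, and vanish to second order at 0 because the exponential beats
    every power of [1/t]. *)
Definition expinv (p : {poly R}) (t : R) : R :=
  if 0 < t then p.[t^-1] * expR (- t^-1) else 0.

(** An inductive class rather than smoothness itself: derivatives stay in the class by
    structural induction, which gives all orders at once. *)
Inductive smooth1 : (R -> R) -> Prop :=
| smooth1_cst c : smooth1 (cst c)
| smooth1_expinv p a b : smooth1 (fun t => expinv p (a * t + b))
| smooth1_D f g : smooth1 f -> smooth1 g -> smooth1 (fun t => f t + g t)
| smooth1_M f g : smooth1 f -> smooth1 g -> smooth1 (fun t => f t * g t)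
| smooth1_aff f a b : smooth1 f -> smooth1 (fun t => f (a * t + b))
| smooth1_prim f g : (forall t : R, is_derive t (1 : R) f (g t)) -> smooth1 g ->
    smooth1 f.

Lemma pow_le_expR (n : nat) (s : R) : 0 <= s -> s ^+ n <= n`!%:R * expR s.
Proof.
move=> s0; have fn0 : 0 < (n`!)%:R :> R by rewrite ltr0n fact_gt0.
rewrite -ler_pdivrMl// mulrC.
case: n fn0 => [|n] fn0; last first.
  by apply: le_trans (expR_ge1Dxn n s0); rewrite lerDr.
by rewrite expr0 fact0 divr1 -expR0 ler_expR.
Qed.

Lemma expinv_le (p : {poly R}) :
  exists C, forall t, `|expinv p t| <= C * t ^+ 2.
Proof.
exists (\sum_(i < size p) `|p`_i| * (i.+2)`!%:R) => t.
rewrite /expinv; case: ifPn => [t0|_]; last first.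
  rewrite normr0; apply: mulr_ge0; last exact: sqr_ge0.
  by apply: sumr_ge0 => i _; apply: mulr_ge0.
rewrite horner_coef mulr_suml mulr_suml.
apply: le_trans (ler_norm_sum _ _ _) _; apply: ler_sum => i _.
rewrite !normrM -!mulrA ler_wpM2l// (ger0_norm (expR_ge0 _)).
rewrite ger0_norm ?exprn_ge0 ?invr_ge0 ?(ltW t0)//.
rewrite expRN ler_pdivrMr ?expR_gt0// mulrAC.
have := @pow_le_expR i.+2 t^-1; rewrite invr_ge0 (ltW t0) => /(_ isT).
have -> : t^-1 ^+ i = t^-1 ^+ i.+2 * t ^+ 2.
  by rewrite -addn2 exprD -mulrA -exprMn mulVf ?gt_eqF// expr1n mulr1.
by move=> h; rewrite ler_wpM2r// sqr_ge0.
Qed.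

Lemma is_derive_expinv (p : {poly R}) (t : R) :
  is_derive t (1 : R) (expinv p) (expinv ((p - p^`()) * 'X^2) t).
Proof.
have [t0|t0|->] := ltgtP t 0.
- rewrite {2}/expinv ltNge (ltW t0)/=.
  apply: (near_eq_is_derive (f := cst 0)).
  near=> s; rewrite /expinv ifF//; apply/negbTE; rewrite -leNgt ltW//.
  by near: s; exact: lt_nbhsl.
- apply: (@near_eq_is_derive R R R (fun s : R => p.[s^-1] * expR (- s^-1))).
    near=> s; rewrite /expinv ifT//.
    by near: s; exact: lt_nbhsr.
  have tn0 : t != 0 by rewrite gt_eqF.
  have dV : is_derive t (1 : R) (fun s : R => s^-1) (- t ^- 2).
    have := is_deriveV tn0 (is_derive_id t (1:R)).
    by rewrite /GRing.scale/= mulr1.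
  have d1 := is_derive1_comp (is_derive_poly p t^-1) dV.
  have dN : is_derive t (1 : R) (fun s : R => - s^-1) (- - t ^- 2) := is_deriveN dV.
  have d2 := @is_derive1_comp R expR (fun s : R => - s^-1) t _ _ (is_derive_expR (- t^-1)) dN.
  have := is_deriveM d1 d2.
  rewrite {1}/expinv t0 !hornerE /GRing.scale/= => D; apply: is_derive_eq D _.
  by rewrite -exprVn /= opprK; ring.
- apply: is_derive_cvg.
  have [C hC] := expinv_le p.
  have C0 : 0 <= C by have := hC 1; rewrite expr1n mulr1; exact: le_trans.
  rewrite {3}/expinv ltxx.
  apply/cvgrPdist_lt => e e0; near=> h.
  rewrite addr0 [h *: 1]mulr1 sub0r normrN normrM normfV.
  rewrite {2}/expinv ltxx subr0.
  have hn0 : h != 0 by near: h; exact: nbhs_dnbhs_neq.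
  apply: (@le_lt_trans _ _ (C * `|h|)).
    rewrite ler_pdivrMl ?normr_gt0// mulrCA -expr2 real_normK ?num_real//.
  apply: (@le_lt_trans _ _ ((C + 1) * `|h|)).
    by rewrite ler_wpM2r// lerDl.
  rewrite -ltr_pdivlMl ?ltr_wpDl// mulrC.
  near: h; apply: dnbhs0_lt.
  by rewrite divr_gt0// ltr_wpDl.
Unshelve. all: by end_near.
Qed.

Lemma is_derive_aff (a b t : R) : is_derive t (1 : R) (fun t => a * t + b) a.
Proof.
have := is_deriveD (is_deriveZ a (is_derive_id t (1 : R))) (is_derive_cst b t (1 : R)).
by move=> D; apply: is_derive_eq D _; rewrite addr0 /GRing.scale/= mulr1.
Qed.

Lemma smooth1_ex (f : R -> R) : smooth1 f ->
  exists2 g, smooth1 g & forall t : R, is_derive t (1 : R) f (g t).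
Proof.
elim=> {f} [c|p a b|f g sf [f' sf' df] sg [g' sg' dg]|
    f g sf [f' sf' df] sg [g' sg' dg]|f a b sf [f' sf' df]|f g dfg sg _].
- by exists (cst 0) => [|t]; [exact: smooth1_cst|exact: is_derive_cst].
- exists (fun t => cst a t * expinv ((p - p^`()) * 'X^2) (a * t + b)).
    by apply: smooth1_M; [exact: smooth1_cst|exact: smooth1_expinv].
  move=> t; rewrite mulrC.
  apply: (is_derive1_comp (f := expinv p) (g := fun t => a * t + b)).
    exact: is_derive_expinv.
  exact: is_derive_aff.
- exists (fun t => f' t + g' t); first exact: smooth1_D.
  by move=> t; apply: is_deriveD.
- exists (fun t => f t * g' t + g t * f' t).
    by apply: smooth1_D; apply: smooth1_M.
  by move=> t; apply: is_deriveM.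
- exists (fun t => cst a t * f' (a * t + b)).
    by apply: smooth1_M; [exact: smooth1_cst|exact: smooth1_aff].
  move=> t; rewrite mulrC.
  apply: (is_derive1_comp (f := f) (g := fun t => a * t + b)) => //.
  exact: is_derive_aff.
- by exists g.
Qed.

Lemma is_derive_continuous (f : R -> R) (t df : R) :
  is_derive t (1 : R) f df -> {for t, continuous f}.
Proof.
move=> [d _].
exact/differentiable_continuous/derivable1_diffP.
Qed.

Lemma smooth1_continuous (f : R -> R) : smooth1 f -> continuous f.
Proof. by move=> /smooth1_ex[g _ d] t; exact: is_derive_continuous (d t). Qed.

Local Notation mu := (@lebesgue_measure R).

Lemma lebesgue_measure_oc (y z : R) : y <= z ->
  lebesgue_measure `]y, z]%classic = (z - y)%:E.
Proof.
move=> yz; rewrite lebesgue_measure_itv/= lte_fin.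
move: yz; rewrite le_eqVlt => /predU1P[->|->]; last by rewrite EFinN.
by rewrite ltxx subrr.
Qed.

(** The bumps are products of two profiles [exp(-1/s)], with [s] equal to
    [(n+1) y - 1] and to [(n+1) (1 - y) - 1]; both tend to infinity when [0 < y < 1].
    A primitive of a function with values in [0, 1] increases by at most 1 over a
    unit interval, whence the bound on [theta]. *)
Lemma cutoff_exists : exists (chi H : nat -> R -> R) (delta theta : nat -> R),
  [/\ forall n, smooth1 (chi n) /\ smooth1 (H n),
      forall n y, 0 <= chi n y <= 1,
      forall n, 0 < delta n /\ (forall y, ~~ (delta n < y < 1 - delta n) -> chi n y = 0),
      forall y, chi n y @[n --> \oo] --> (if 0 < y < 1 then 1 else 0 : R)
    & forall n, [/\ forall y : R, is_derive y (1 : R) (H n) (chi n y),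
        forall y, y <= delta n -> H n y = 0,
        forall y, 1 - delta n <= y -> H n y = theta n,
        forall y, 0 <= H n y <= theta n & theta n <= 1]].
Proof.
pose d n : R := n.+1%:R^-1.
pose chi n y := expinv 1 (n.+1%:R * y + -1) * expinv 1 (- n.+1%:R * y + n%:R).
have d0 n : 0 < d n by rewrite invr_gt0 ltr0n.
have e1 t : expinv 1 t = if 0 < t then expR (- t^-1) else 0.
  by rewrite /expinv -[1]/(1%:P) hornerC mul1r.
have e01 t : 0 <= expinv 1 t <= 1.
  rewrite e1; case: ifPn => [t0|_]; last by rewrite lexx ler01.
  by rewrite expR_ge0/= -expR0 ler_expR oppr_le0 invr_ge0 ltW.
have chi01 n y : 0 <= chi n y <= 1.
  have /andP[a0 a1] := e01 (n.+1%:R * y + -1).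
  have /andP[b0 b1] := e01 (- n.+1%:R * y + n%:R).
  by rewrite mulr_ge0//= mulr_ile1.
have chi0 n y : ~~ (d n < y < 1 - d n) -> chi n y = 0.
  move=> h; rewrite /chi /expinv.
  case: ifPn => [a0|]; last by rewrite mul0r.
  case: ifPn => [b0|]; last by rewrite mulr0.
  exfalso; move/negP : h; apply; apply/andP; split.
    by rewrite -[X in X < _]mulr1 ltr_pdivrMl ?ltr0n//; lra.
  rewrite ltrBrDr -ltrBrDl -[X in X < _]mulr1 ltr_pdivrMl ?ltr0n//.
  by move: b0; rewrite -natr1; lra.
have schi n : smooth1 (chi n) by apply: smooth1_M; exact: smooth1_expinv.
have chi_cvg y : chi n y @[n --> \oo] --> (if 0 < y < 1 then 1 else 0 : R).
  case: ifPn => [/andP[y0 y1]|y01]; last first.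
    apply: cvg_near_cst; apply: nearW => n; apply: chi0; apply: contra y01.
    move=> /andP[dy yd]; rewrite (lt_trans (d0 n) dy)/=.
    by rewrite (lt_trans yd)// gtrBl.
  have lim1 a b : 0 < a -> expinv 1 (n.+1%:R * a + b) @[n --> \oo] --> (1 : R).
    move=> a0; apply/cvgrPdist_lt => e e0; near=> n.
    have nab : e^-1 < n.+1%:R * a + b.
      rewrite -ltrBlDr -ltr_pdivrMr//.
      have : (e^-1 - b) / a < n%:R by near: n; exact: nbhs_infty_gtr.
      by move/lt_trans; apply; rewrite ltr_nat.
    have ei0 : 0 < e^-1 by rewrite invr_gt0.
    rewrite e1 (lt_trans ei0 nab).
    set s := n.+1%:R * a + b in nab *.
    have s0 : 0 < s by exact: lt_trans nab.
    have := expR_ge1Dx (- s^-1).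
    have : expR (- s^-1) <= 1 by rewrite -expR0 ler_expR oppr_le0 invr_ge0 ltW.
    have : s^-1 < e by rewrite -[ltRHS]invrK ltf_pV2// posrE.
    by move=> h1 h2 h3; rewrite ger0_norm; lra.
  rewrite -[X in _ --> X](mulr1 (1 : R)); apply: cvgM; first exact: lim1.
  have -> : (fun n => expinv 1 (- n.+1%:R * y + n%:R)) =
     (fun n => expinv 1 (n.+1%:R * (1 - y) + -1)).
    by apply/funext => n; congr (expinv _ _); rewrite -natr1; ring.
  by apply: lim1; rewrite subr_gt0.
have mchi n : @measurable_fun _ _ (measurableTypeR R) (measurableTypeR R) setT (chi n).
  by apply: continuous_measurable_fun; exact: smooth1_continuous.
have ichi n z : mu.-integrable `]-oo, z] (EFin \o chi n).
  apply: (@integrableS _ _ _ _ setT) => //.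
  apply: le_integrable (integrable_indic_itv 0 1 true false) => //.
    by apply/measurable_EFinP; exact: mchi.
  move=> x _ /=; rewrite lee_fin indicE mem_setE in_itv/=.
  case: (boolP (0 <= x <= 1)) => [_|x01].
    by rewrite normr1; have /andP[c0 c1] := chi01 n x; rewrite ger0_norm.
  rewrite chi0 ?normr0//; apply: contra x01 => /andP[x0 x1].
  have := d0 n; lra.
pose H n y := \int[mu]_(x in `]-oo, y]) chi n x.
have HB n y z : y <= z -> H n z - H n y = \int[mu]_(x in `]y, z]) chi n x.
  by move=> yz; rewrite /H Rintegral_itvB.
have iyz n y z : mu.-integrable `]y, z] (EFin \o chi n).
  by apply: integrableS (ichi n z) => //; apply: subset_itvr.
have Hnd n y z : y <= z -> 0 <= H n z - H n y <= z - y.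
  move=> yz; rewrite HB// Rintegral_ge0/=; last by move=> x _; case/andP : (chi01 n x).
  have -> : z - y = \int[mu]_(x in `]y, z]) 1.
    by rewrite Rintegral_cst// mul1r [X in fine X](lebesgue_measure_oc yz).
  apply: le_Rintegral => //.
    apply: measurable_bounded_integrable => //.
      by rewrite [X in (X < _)%E](lebesgue_measure_oc yz) ltry.
    exact: bounded_cst.
  by move=> x _; case/andP : (chi01 n x).
have I0 n (A : set R) : (forall x, A x -> ~~ (d n < x < 1 - d n)) ->
    \int[mu]_(x in A) chi n x = 0.
  move=> hA; rewrite (@eq_Rintegral _ _ _ _ _ (cst 0)).
    by rewrite /Rintegral integral0.
  by move=> x /set_mem/hA/chi0.
have H0 n y : y <= d n -> H n y = 0.
  move=> yd; apply: I0 => x/=; rewrite in_itv/= => xy.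
  by rewrite negb_and -leNgt (le_trans xy).
have H1' n y z : y <= z -> 1 - d n <= y -> H n z = H n y.
  move=> yz dy; apply/eqP; rewrite -subr_eq0 HB//; apply/eqP; apply: I0.
  move=> x/=; rewrite in_itv/= => /andP[yx _].
  by rewrite negb_and -!leNgt (ltW (le_lt_trans dy yx)) orbT.
have H1 n y : 1 - d n <= y -> H n y = H n 1.
  move=> dy; have [y1|/ltW y1] := leP y 1; last first.
    by rewrite (H1' n 1)// gerBl ltW.
  by rewrite (H1' n y).
have dH n (y : R) : is_derive y (1 : R) (H n) (chi n y).
  have [|//||dy yE] := @continuous_FTC1 R (chi n) -oo%O y (y + 1) _ (ichi n _).
  - by rewrite ltrDl.
  - by rewrite ltNyr.
  - exact: smooth1_continuous.
  have e : 'D_1 (H n) y = chi n y by rewrite -derive1E.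
  exact: (DeriveDef dy e).
exists chi, H, d, (fun n => H n 1); split => // n.
- split => //; exact: smooth1_prim (dH n) (schi n).
- by split => //; exact: chi0.
have H00 : H n 0 = 0 by apply: H0; exact: ltW.
split => //.
- exact: H0.
- exact: H1.
- move=> y; apply/andP; split.
    have [y0|/ltW y0] := leP 0 y; last by rewrite H0// (le_trans y0)// ltW.
    by have /andP[] := Hnd n _ _ y0; rewrite H00 subr0.
  have [y1|/ltW y1] := leP y 1; first by have /andP[] := Hnd n _ _ y1; rewrite subr_ge0.
  by rewrite H1// (le_trans _ y1)// gerBl ltW.
- by have /andP[_] := Hnd n _ _ ler01; rewrite H00 !subr0.
Unshelve. all: by end_near.
Qed.

End smooth1.

(** * Tensor-product test functions *)

Lemma interior_setX (T U : topologicalType) (A : set T) (B : set U) :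
  (A `*` B)° = A° `*` B°.
Proof.
apply/seteqP; split => [[x y] /= [[P Q] /= [Px Qy] PQ]|[x y] /= [Ax By]].
  split.
    apply: filterS Px => s Ps.
    by have [] : (A `*` B) (s, y) by apply: PQ; split => //; exact: nbhs_singleton.
  apply: filterS Qy => s Qs.
  by have [] : (A `*` B) (x, s) by apply: PQ; split => //; exact: nbhs_singleton.
by exists (A, B).
Qed.

Lemma interior_unit_square (R : realType) :
  (@unit_square R)° = `]0, 1[%classic `*` `]0, 1[%classic.
Proof. by rewrite interior_setX !interior_itv. Qed.

Section smooth2.
Context {R : realType}.

(** Sums of products of functions of one variable are all the test functions
    that are needed, and their partial derivatives are computed factor by factor. *)
Inductive smooth2 : (R * R -> R) -> Prop :=
| smooth2_tens f g : smooth1 f -> smooth1 g -> smooth2 (fun x => f x.1 * g x.2)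
| smooth2_D f g : smooth2 f -> smooth2 g -> smooth2 (fun x => f x + g x).

Lemma is_derive_tens0 (f g : R -> R) (df : R) (x : R * R) :
  is_derive x.1 (1 : R) f df ->
  is_derive x (basis2 R 0) (fun x => f x.1 * g x.2) (df * g x.2).
Proof.
move=> [/cvg_ex[l fl] fE].
have fd : h^-1 * (f (h * 1 + x.1) - f x.1) @[h --> 0^'] --> df.
  by rewrite -fE /derive; rewrite (cvg_lim _ fl).
apply: is_derive_cvg; rewrite /basis2 eqxx /=.
under eq_fun do rewrite [_ *: 0]mulr0 add0r -mulrBl mulrA.
exact: cvgMr_tmp.
Qed.

Lemma is_derive_tens1 (f g : R -> R) (dg : R) (x : R * R) :
  is_derive x.2 (1 : R) g dg ->
  is_derive x (basis2 R 1) (fun x => f x.1 * g x.2) (f x.1 * dg).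
Proof.
move=> [/cvg_ex[l gl] gE].
have gd : h^-1 * (g (h * 1 + x.2) - g x.2) @[h --> 0^'] --> dg.
  by rewrite -gE /derive; rewrite (cvg_lim _ gl).
apply: is_derive_cvg; rewrite /basis2 /=.
under eq_fun do rewrite [_ *: 0]mulr0 add0r -mulrBr mulrCA.
exact: cvgMl_tmp.
Qed.

Lemma ord2P (k : 'I_2) : k = 0 \/ k = 1.
Proof. by case: k => -[|[|//]] i; [left|right]; exact: val_inj. Qed.

Lemma smooth2_ex (phi : R * R -> R) (k : 'I_2) : smooth2 phi ->
  exists2 psi, smooth2 psi & forall x, is_derive x (basis2 R k) phi (psi x).
Proof.
elim=> {phi} [f g sf sg|f g _ [f' sf' df] _ [g' sg' dg]]; last first.
  exists (fun x => f' x + g' x); first exact: smooth2_D.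
  by move=> x; exact: is_deriveD.
have [f' sf' df] := smooth1_ex sf; have [g' sg' dg] := smooth1_ex sg.
have [->|->] := ord2P k.
  exists (fun x => f' x.1 * g x.2); first exact: smooth2_tens.
  by move=> x; apply: is_derive_tens0.
exists (fun x => f x.1 * g' x.2); first exact: smooth2_tens.
by move=> x; apply: is_derive_tens1.
Qed.

Lemma smooth2_continuous (phi : R * R -> R) : smooth2 phi -> continuous phi.
Proof.
elim=> {phi} [f g sf sg|f g _ cf _ cg] x.
  apply: cvgM.
    by apply: (@cvg_comp _ _ _ fst f); [exact: cvg_fst|exact: smooth1_continuous].
  by apply: (@cvg_comp _ _ _ snd g); [exact: cvg_snd|exact: smooth1_continuous].
by apply: cvgD; [exact: cf|exact: cg].
Qed.

Lemma smooth2_smooth (phi : R * R -> R) : smooth2 phi -> smooth phi.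
Proof.
move=> sphi s; have sp : smooth2 (partials s phi).
  elim: s => [//|k s IH] /=.
  have [psi spsi dpsi] := smooth2_ex k IH.
  suff -> : partial k (partials s phi) = psi by [].
  by apply/funext => x; exact: derive_val.
split; first exact: smooth2_continuous.
by move=> k x; have [psi _ /(_ x)[]] := smooth2_ex k sp.
Qed.

Lemma smooth2_sum (n : nat) (F : 'I_n -> R * R -> R) :
  (forall i, smooth2 (F i)) -> smooth2 (fun x => \sum_i F i x).
Proof.
elim: n F => [|n IH] F sF.
  rewrite (_ : (fun _ => _) = fun x : R * R => cst 0 x.1 * cst 0 x.2).
    by apply: smooth2_tens; exact: smooth1_cst.
  by apply/funext => x; rewrite big_ord0 mul0r.
under eq_fun do rewrite big_ord_recl.
by apply: smooth2_D; [exact: sF|apply: IH => i; exact: sF].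
Qed.

Lemma is_derive_bigsum (V : normedModType R) (n : nat) (F : 'I_n -> V -> R)
    (dF : 'I_n -> R) (x v : V) :
  (forall i, is_derive x v (F i) (dF i)) ->
  is_derive x v (fun x => \sum_i F i x) (\sum_i dF i).
Proof.
elim: n F dF => [|n IH] F dF hF.
  under eq_fun do rewrite big_ord0.
  by rewrite big_ord0; exact: is_derive_cst.
under eq_fun do rewrite big_ord_recl.
rewrite big_ord_recl.
exact: (is_deriveD (hF ord0) (IH _ _ (fun i => hF (lift ord0 i)))).
Qed.

End smooth2.

(** * Translates of a cut-off and of its primitive *)

Section translates.
Context {R : realType} (chi H : R -> R) (delta theta : R).
Hypotheses (chi01 : forall y, 0 <= chi y <= 1) (delta0 : 0 < delta)
  (chi0 : forall y, ~~ (delta < y < 1 - delta) -> chi y = 0)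
  (H0 : forall y, y <= delta -> H y = 0)
  (H1 : forall y, 1 - delta <= y -> H y = theta)
  (Hb : forall y, 0 <= H y <= theta) (theta1 : theta <= 1).

(** At most one of the translates is nonzero at a given point. *)
Lemma sum_chi_le (N : nat) (e : nat -> R) (y : R) : (forall i, (i < N)%N -> `|e i| <= 1) ->
  `|\sum_(i < N) e i * chi (y - i%:R)| <= 1.
Proof.
elim: N => [|N IH] he; first by rewrite big_ord0 normr0.
rewrite big_ord_recr/=; have [yN|Ny] := leP y N%:R.
  rewrite [X in _ + _ * X]chi0; last by rewrite negb_and -!leNgt; apply/orP; left; have := delta0; lra.
  by rewrite mulr0 addr0 IH// => i iN; apply: he; rewrite ltnS ltnW.
rewrite big1 ?add0r => [|i _].
  by rewrite normrM mulr_ile1 ?he//; have /andP[c0 c1] := chi01 (y - N%:R); rewrite ger0_norm.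
rewrite chi0 ?mulr0// negb_and -!leNgt; apply/orP; right.
have : i.+1%:R <= N%:R :> R by rewrite ler_nat.
by rewrite -natr1; have := delta0; lra.
Qed.

Lemma sum_chi_eq0 (N : nat) (e : nat -> R) (y : R) : ~~ (delta <= y <= N%:R - delta) ->
  \sum_(i < N) e i * chi (y - i%:R) = 0.
Proof.
move=> hy; rewrite big1// => i _; rewrite chi0 ?mulr0//.
apply: contra hy => /andP[a b].
have : i.+1%:R <= N%:R :> R by rewrite ler_nat.
have : 0 <= i%:R :> R by rewrite ler0n.
by rewrite -natr1; have := delta0; lra.
Qed.

(** Between two consecutive nodes the sum interpolates monotonically between two
    partial sums of the coefficients, scaled by [theta]. *)
Lemma sum_primitive_le (N : nat) (c : nat -> R) (y : R) :
  (forall m, (m <= N)%N -> `|\sum_(i < m) c i| <= 1) ->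
  `|\sum_(i < N) c i * H (y - i%:R)| <= 1.
Proof.
have sumH M : M%:R <= y -> \sum_(i < M) c i * H (y - i%:R) = (\sum_(i < M) c i) * theta.
  move=> My; rewrite mulr_suml; apply: eq_bigr => i _; rewrite H1//.
  have : i.+1%:R <= M%:R :> R by rewrite ler_nat.
  by rewrite -natr1; have := delta0; lra.
have /andP[_ theta0] := Hb 0.
elim: N => [|N IH] hc; first by rewrite big_ord0 normr0.
rewrite big_ord_recr/=; have [yN|Ny] := ltP y N%:R.
  rewrite [X in _ + _ * X]H0 ?mulr0 ?addr0; last by have := delta0; lra.
  by apply: IH => m mN; apply: hc; exact: leqW.
rewrite sumH//; set h := H _; have /andP[h0 ht] : 0 <= h <= theta := Hb _.
have := hc _ (leqnSn N); have := hc _ (leqnn N.+1); rewrite big_ord_recr/=.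
set P := \sum_(i < N) _; set d := c N => P1 P0.
have -> : P * theta + d * h = P * (theta - h) + (P + d) * h by ring.
have th0 : 0 <= theta - h by rewrite subr_ge0.
apply: le_trans (ler_normD _ _) _; rewrite !normrM (ger0_norm h0) (ger0_norm th0).
apply: (@le_trans _ _ (1 * (theta - h) + 1 * h)); last by rewrite !mul1r subrK.
by apply: lerD; apply: ler_wpM2r.
Qed.

(** To the right of the last node every primitive has reached its final value
    [theta], and the coefficients sum to 0. *)
Lemma sum_primitive_eq0 (N : nat) (c : nat -> R) (y : R) :
  \sum_(i < N) c i = 0 -> ~~ (delta <= y <= N%:R - delta) ->
  \sum_(i < N) c i * H (y - i%:R) = 0.
Proof.
move=> c0; rewrite negb_and -!ltNge => /orP[yd|yN].
  rewrite big1// => i _; rewrite H0 ?mulr0//.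
  have : 0 <= i%:R :> R by rewrite ler0n.
  have := delta0; lra.
under eq_bigr => i _.
  rewrite H1; first over.
  have : i.+1%:R <= N%:R :> R by rewrite ler_nat.
  by rewrite -natr1; have := delta0; lra.
by rewrite -mulr_suml c0 mul0r.
Qed.

End translates.

(** * Real-valued integrals *)

Section real_integrals.
Context d (T : measurableType d) (R : realType) (mu : {measure set T -> \bar R}).
Implicit Types (u v h : T -> R).

Local Notation L1 u := (mu.-integrable [set: T] (EFin \o u)).

Lemma L1_measurable u : L1 u -> measurable_fun setT u.
Proof. by move=> /measurable_int/measurable_EFinP. Qed.

Lemma L1_mulr u h (C : R) : L1 u -> measurable_fun setT h ->
  (forall x, `|h x| <= C) -> L1 (fun x => u x * h x).
Proof.
move=> iu mh hC.
have -> : EFin \o (fun x => u x * h x) = ((EFin \o u) \* (EFin \o h))%E.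
  by apply/funext => x /=; rewrite EFinM.
apply: integrableMl => //.
exists C; split; first exact: num_real.
by move=> y Cy x _; apply: le_trans (hC x) (ltW Cy).
Qed.

Lemma L1_D u v : L1 u -> L1 v -> L1 (fun x => u x + v x).
Proof.
move=> iu iv.
rewrite (_ : EFin \o _ = ((EFin \o u) \+ (EFin \o v))%E); first exact: integrableD.
by apply/funext => x /=; rewrite EFinD.
Qed.

Lemma L1_B u v : L1 u -> L1 v -> L1 (fun x => u x - v x).
Proof.
move=> iu iv.
rewrite (_ : EFin \o _ = ((EFin \o u) \- (EFin \o v))%E); first exact: integrableB.
by apply/funext => x /=; rewrite EFinB.
Qed.

Lemma L1_Z (c : R) u : L1 u -> L1 (fun x => c * u x).
Proof.
move=> iu.
rewrite (_ : EFin \o _ = (fun x => c%:E * (EFin \o u) x)%E); first exact: integrableZl.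
by apply/funext => x /=; rewrite EFinM.
Qed.

Lemma L1_norm u : L1 u -> L1 (fun x => `|u x|).
Proof. exact: integrable_norm. Qed.

Lemma L1_0 : L1 (fun=> 0).
Proof. exact: integrable0. Qed.

Lemma L1_sum (n : nat) (F : 'I_n -> T -> R) : (forall i, L1 (F i)) ->
  L1 (fun x => \sum_i F i x).
Proof.
elim: n F => [|n IH] F hF.
  by under [X in EFin \o X]eq_fun do rewrite big_ord0; exact: L1_0.
under [X in EFin \o X]eq_fun do rewrite big_ord_recl.
by apply: L1_D => //; apply: IH.
Qed.

Lemma Rint_sum (n : nat) (F : 'I_n -> T -> R) : (forall i, L1 (F i)) ->
  \int[mu]_x (\sum_i F i x) = \sum_i \int[mu]_x F i x.
Proof.
elim: n F => [|n IH] F hF.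
  under [LHS]eq_Rintegral do rewrite big_ord0.
  by rewrite big_ord0 /Rintegral integral0.
under [LHS]eq_Rintegral do rewrite big_ord_recl.
by rewrite big_ord_recl RintegralD//; [rewrite IH|exact: L1_sum].
Qed.

Lemma Rint_fin u : L1 u -> (\int[mu]_x u x)%:E = (\int[mu]_x (u x)%:E)%E.
Proof. by move=> iu; rewrite /Rintegral fineK//; exact: integrable_fin_num. Qed.

Lemma Rint_le_norm u : L1 u -> `|\int[mu]_x u x| <= \int[mu]_x `|u x|.
Proof. by move=> iu; apply: le_normr_Rintegral. Qed.

Lemma ae_Rint_eq u v : L1 u -> measurable_fun setT v ->
  {ae mu, forall x, u x = v x} -> \int[mu]_x u x = \int[mu]_x v x.
Proof.
move=> iu mv uv; congr fine; apply: ae_eq_integral => //.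
- exact/measurable_EFinP/L1_measurable.
- exact/measurable_EFinP.
- by apply: filterS uv => x /= -> _.
Qed.

Lemma Rint_dominated_ae (u : T -> R) (h_ : nat -> T -> R) h (C : R) :
  L1 u -> (forall n, measurable_fun setT (h_ n)) -> measurable_fun setT h ->
  (forall n x, `|h_ n x| <= C) ->
  {ae mu, forall x, h_ n x @[n --> \oo] --> h x} ->
  \int[mu]_x (u x * h_ n x) @[n --> \oo] --> \int[mu]_x (u x * h x).
Proof.
move=> iu mh mh' hC hh.
have mu_ := L1_measurable iu.
have [] := @dominated_convergence _ _ _ mu setT measurableT
  (fun n x => (u x * h_ n x)%:E) (fun x => (u x * h x)%:E) (fun x => (C * `|u x|)%:E).
- by move=> n; apply/measurable_EFinP; exact: measurable_funM.
- by apply/measurable_EFinP; exact: measurable_funM.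
- apply: filterS hh => x hx _.
  by apply: cvg_EFin; [exact: nearW|apply: cvgMl_tmp; exact: hx].
- exact: L1_Z (L1_norm iu).
- by apply/aeW => x n _; rewrite lee_fin normrM mulrC ler_wpM2r.
move=> ih _ cv; rewrite /Rintegral.
by apply: fine_cvg; rewrite fineK//; exact: integrable_fin_num.
Qed.

Lemma Rint_dominated (u : T -> R) (h_ : nat -> T -> R) h (C : R) :
  L1 u -> (forall n, measurable_fun setT (h_ n)) -> (forall n x, `|h_ n x| <= C) ->
  (forall x, h_ n x @[n --> \oo] --> h x) ->
  \int[mu]_x (u x * h_ n x) @[n --> \oo] --> \int[mu]_x (u x * h x).
Proof.
move=> iu mh hC hh; apply: (Rint_dominated_ae (C := C)) => //; last exact: aeW.
by apply: (measurable_fun_cvg mh) => x _; exact: hh.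
Qed.

End real_integrals.

Section lines.
Context {R : realType}.

Lemma leb2X (A B : set (measurableTypeR R)) : measurable A -> measurable B ->
  leb2 R (A `*` B) = (lebesgue_measure A * lebesgue_measure B)%E.
Proof. by move=> mA mB; exact: product_measure1E. Qed.

Lemma lebDE (A : set (plane R)) : lebD R A = leb2 R (A `&` @unit_square R).
Proof. by []. Qed.

Lemma lebD_le (A : set (plane R)) : measurable A -> (lebD R A <= leb2 R A)%E.
Proof.
move=> mA; rewrite lebDE; apply: le_measure; rewrite ?inE//.
by apply: measurableI => //; exact: measurable_unit_square.
Qed.

Lemma lebD_setX0 (A B : set (measurableTypeR R)) : measurable A -> measurable B ->
  (lebesgue_measure A = 0 \/ lebesgue_measure B = 0)%E -> lebD R (A `*` B) = 0%E.
Proof.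
move=> mA mB AB; apply/eqP; rewrite eq_le measure_ge0 andbT.
apply: le_trans (lebD_le (measurableX mA mB)) _.
rewrite leb2X//.
by case: AB => [A0|B0]; [rewrite [X in (X * _)%E]A0 mul0e|rewrite [X in (_ * X)%E]B0 mule0].
Qed.

Lemma lebD_setT : lebD R setT = 1%E.
Proof.
rewrite lebDE setTI leb2X//.
by rewrite [X in (X * _)%E]lebesgue_measure_itv [X in (_ * X)%E]lebesgue_measure_itv/= lte01 oppr0 addr0 mul1e.
Qed.

Lemma ae_filter_lebD : Filter (nbhs (almost_everywhere (lebD R))).
Proof. exact: (ae_filter_ringOfSetsType (lebD R)). Qed.

Lemma ae_off_grid (j : nat) :
  {ae lebD R, forall x, @unit_square R x /\ forall i : nat, 2 ^+ j * x.1 != i%:R /\ 2 ^+ j * x.2 != i%:R}.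
Proof.
have h1 : {ae lebD R, forall x, @unit_square R x}.
  exists (~` @unit_square R); split => //.
    by apply: measurableC; exact: measurable_unit_square.
  by rewrite lebDE setICl measure0.
suff h2 (i : nat) : {ae lebD R, forall x, 2 ^+ j * x.1 != i%:R /\ 2 ^+ j * x.2 != i%:R}.
  have : {ae lebD R, forall x, forall i : nat, 2 ^+ j * x.1 != i%:R /\ 2 ^+ j * x.2 != i%:R}.
    exact/ae_foralln.
  move=> h3; apply: (@filterS2 _ _ (ae_filter_ringOfSetsType (lebD R)) _ _ _ _ h1 h3) => x.
  by split.
pose t : R := i%:R / 2 ^+ j.
have z1 : lebD R ([set t] `*` setT) = 0%E.
  by apply: lebD_setX0 => //; left; exact: lebesgue_measure_set1.
have z2 : lebD R (setT `*` [set t]) = 0%E.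
  by apply: lebD_setX0 => //; right; exact: lebesgue_measure_set1.
have n1 : (lebD R).-negligible ([set t] `*` setT : set (plane R)).
  by exists ([set t] `*` setT); split => //; exact: measurableX.
have n2 : (lebD R).-negligible (setT `*` [set t] : set (plane R)).
  by exists (setT `*` [set t]); split => //; exact: measurableX.
apply: negligibleS (negligibleU n1 n2) => x /=.
have p0 : 2 ^+ j != 0 :> R by rewrite expf_eq0 pnatr_eq0 andbF.
have key (s : R) : 2 ^+ j * s = i%:R -> s = t by rewrite /t => <-; rewrite mulrAC divff// mul1r.
move=> /not_andP[] /negP; rewrite negbK => /eqP/key e; [by left; split|by right; split].
Qed.

End lines.

#[global] Existing Instance ae_filter_lebD.

(** * Step functions on the dyadic grid *)

Section cells.
Context {R : realType}.

(** The open interval, as the projections are supported by the interiors of the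
    dyadic squares. *)
Definition unit_ind (t : R) : R := if 0 < t < 1 then 1 else 0.

Definition cell (j i l : nat) (x : plane R) : R :=
  unit_ind (2 ^+ j * x.1 - i%:R) * unit_ind (2 ^+ j * x.2 - l%:R).

(** Cell integrals rather than cell averages: then passing to a coarser grid is plain
    addition, and the density is recovered by the factor [4 ^+ j] in [step]. *)
Definition coef (j : nat) (u : plane R -> R) (i l : nat) : R :=
  \int[lebD R]_x (u x * cell j i l x).

Definition step (j : nat) (b : nat -> nat -> R) (x : plane R) : R :=
  \sum_(i < (2 ^ j)%N) \sum_(l < (2 ^ j)%N) (4 ^+ j * b i l) * cell j i l x.

Lemma unit_ind_ge0 t : 0 <= unit_ind t. Proof. by rewrite /unit_ind; case: ifP. Qed.

Lemma unit_ind_le1 t : unit_ind t <= 1. Proof. by rewrite /unit_ind; case: ifP. Qed.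

Lemma unit_ind_shift (y : R) (N : nat) :
  (forall i : 'I_N, unit_ind (y - i%:R) = 0) \/
  exists i0 : 'I_N, forall i : 'I_N, unit_ind (y - i%:R) = (i == i0)%:R.
Proof.
case: (pselect (exists i0 : 'I_N, 0 < y - i0%:R < 1)) => [[i0 h0]|h]; last first.
  left => i; rewrite /unit_ind; case: ifP => // hi.
  by exfalso; apply: h; exists i.
right; exists i0 => i; rewrite /unit_ind; have [->|ii0] := eqVneq; first by rewrite h0.
case: ifP => // hi; exfalso; move/negP : ii0; apply; apply/eqP/val_inj/eqP => /=.
move: h0 hi => /andP[a b] /andP[c d]; rewrite eqn_leq; apply/andP; split; rewrite -ltnS -(ltr_nat R) -addn1 natrD; lra.
Qed.

Lemma cell_ge0 j i l x : 0 <= cell j i l x.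
Proof. by rewrite mulr_ge0// unit_ind_ge0. Qed.

Lemma cell_le1 j i l x : cell j i l x <= 1.
Proof. by rewrite mulr_ile1// ?unit_ind_ge0// unit_ind_le1. Qed.

Lemma cell_norm j i l x : `|cell j i l x| <= 1.
Proof. by rewrite ger0_norm ?cell_ge0// cell_le1. Qed.

Lemma measurable_unit_ind : measurable_fun setT unit_ind.
Proof.
rewrite (_ : unit_ind = \1_`]0, 1[%classic); first exact: measurable_indic.
by apply/funext => t; rewrite /unit_ind indicE mem_setE in_itv/=; case: ifP.
Qed.

Lemma measurable_fst_aff (a b : R) :
  measurable_fun setT (fun x : plane R => a * x.1 - b).
Proof. by apply: measurable_funB => //; apply: measurable_funM. Qed.

Lemma measurable_snd_aff (a b : R) :
  measurable_fun setT (fun x : plane R => a * x.2 - b).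
Proof. by apply: measurable_funB => //; apply: measurable_funM. Qed.

Lemma measurable_cell j i l : measurable_fun setT (cell j i l).
Proof.
apply: measurable_funM.
  exact: measurableT_comp measurable_unit_ind (measurable_fst_aff _ _).
exact: measurableT_comp measurable_unit_ind (measurable_snd_aff _ _).
Qed.

Lemma cellM j (i l : 'I_(2 ^ j)) (i' l' : 'I_(2 ^ j)) x :
  cell j i l x * cell j i' l' x = ((i == i') && (l == l'))%:R * cell j i l x.
Proof.
rewrite /cell; case: (unit_ind_shift (2 ^+ j * x.1) (2 ^ j)) => [h|[a ha]].
  by rewrite !h !mul0r mulr0.
case: (unit_ind_shift (2 ^+ j * x.2) (2 ^ j)) => [h|[c hc]].
  by rewrite !h !mulr0.
rewrite !ha !hc.
have [->|ne] := eqVneq i i'; have [->|ne'] := eqVneq l l' => /=;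
  rewrite ?mul0r ?mul1r ?mulr1 -?natrM //.
- by case: (l' == c); case: (i' == a).
- case: (eqVneq l c) => [e1|_]; case: (eqVneq l' c) => [e2|_];
    rewrite ?muln0 ?mul0n//.
  by move: ne'; rewrite e1 e2 eqxx.
- case: (eqVneq i a) => [e1|_]; case: (eqVneq i' a) => [e2|_];
    rewrite ?muln0 ?mul0n ?muln0//.
  by move: ne; rewrite e1 e2 eqxx.
- case: (eqVneq i a) => [e1|_]; case: (eqVneq i' a) => [e2|_];
    rewrite ?muln0 ?mul0n ?muln0//.
  by move: ne; rewrite e1 e2 eqxx.
Qed.

(** Distinct cells are disjoint, so functions fixing 0 act coefficientwise. *)
Lemma sum_cell_map (F : R -> R) (j : nat) (c : nat -> nat -> R) x : F 0 = 0 ->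
  F (\sum_(i < (2 ^ j)%N) \sum_(l < (2 ^ j)%N) c i l * cell j i l x) =
  \sum_(i < (2 ^ j)%N) \sum_(l < (2 ^ j)%N) F (c i l) * cell j i l x.
Proof.
move=> F0.
case: (unit_ind_shift (2 ^+ j * x.1) (2 ^ j)) => [h|[a ha]].
  by rewrite !big1// => i _; rewrite big1// => l _; rewrite /cell h mul0r mulr0.
case: (unit_ind_shift (2 ^+ j * x.2) (2 ^ j)) => [h|[b hb]].
  by rewrite !big1// => i _; rewrite big1// => l _; rewrite /cell h !mulr0.
have key (e : nat -> nat -> R) :
    \sum_(i < (2 ^ j)%N) \sum_(l < (2 ^ j)%N) e i l * cell j i l x = e a b.
  rewrite (bigD1 a)//= (bigD1 b)//= /cell ha hb !eqxx !mulr1.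
  rewrite big1 ?addr0 => [|l /negPf lb]; last by rewrite hb lb !mulr0.
  rewrite big1 ?addr0// => i /negPf ia.
  by rewrite big1// => l _; rewrite ha ia mul0r mulr0.
by rewrite key (key (fun i l => F (c i l))).
Qed.

Lemma step_map (F : R -> R) (j : nat) (b : nat -> nat -> R) x : F 0 = 0 ->
  F (step j b x) =
  \sum_(i < (2 ^ j)%N) \sum_(l < (2 ^ j)%N) F (4 ^+ j * b i l) * cell j i l x.
Proof. by move=> F0; exact: (sum_cell_map j (fun i l => 4 ^+ j * b i l) x F0). Qed.

Lemma stepB j b b' x : step j b x - step j b' x = step j (fun i l => b i l - b' i l) x.
Proof.
rewrite /step -sumrB; apply: eq_bigr => i _; rewrite -sumrB; apply: eq_bigr => l _.
by rewrite mulrBr mulrBl.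
Qed.

Lemma eq_step j b b' x : (forall i l, (i < 2 ^ j)%N -> (l < 2 ^ j)%N -> b i l = b' i l) ->
  step j b x = step j b' x.
Proof. by move=> h; apply: eq_bigr => i _; apply: eq_bigr => l _; rewrite h. Qed.

Lemma sum_unit_ind (N : nat) (y : R) : 0 < y < N%:R ->
  (forall i : nat, y != i%:R) -> \sum_(i < N) unit_ind (y - i%:R) = 1.
Proof.
elim: N => [|N IH]; first by lra.
rewrite big_ord_recr/= => /andP[y0 yN] yn.
have [yltN|Nlty|yN'] := ltgtP y N%:R.
- rewrite IH ?y0// [X in _ + X]/unit_ind ifF ?addr0//; lra.
- rewrite big1 => [|i _].
    by rewrite add0r /unit_ind ifT//; move: yN; rewrite -natr1; lra.
  rewrite /unit_ind ifF//.
  have : i.+1%:R <= N%:R :> R by rewrite ler_nat.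
  by rewrite -natr1; lra.
- by have := yn N; rewrite yN' eqxx.
Qed.

Lemma pow2_gt0 j : 0 < 2 ^+ j :> R. Proof. by rewrite exprn_gt0. Qed.

Lemma pow4 j : 4 ^+ j = 2 ^+ j * 2 ^+ j :> R.
Proof. by rewrite -exprMn; congr (_ ^+ _); rewrite -natrM. Qed.

Lemma pow4_gt0 j : 0 < 4 ^+ j :> R. Proof. by rewrite exprn_gt0. Qed.

Lemma square_range (j : nat) (x : R * R) : @unit_square R x ->
  (forall i : nat, 2 ^+ j * x.1 != i%:R /\ 2 ^+ j * x.2 != i%:R) ->
  0 < 2 ^+ j * x.1 < (2 ^ j)%:R /\ 0 < 2 ^+ j * x.2 < (2 ^ j)%:R.
Proof.
have key (t : R) : 0 <= t <= 1 -> (forall i : nat, 2 ^+ j * t != i%:R) ->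
    0 < 2 ^+ j * t < (2 ^ j)%:R.
  move=> /andP[t0 t1] ht; rewrite !lt_neqAle; apply/andP; split.
    by rewrite eq_sym (ht 0%N)/= mulr_ge0// ltW// pow2_gt0.
  by rewrite ht/= natrX ler_piMr// ltW// pow2_gt0.
move=> [/= + +] hx; rewrite !in_itv/= => x1 x2.
by split; apply: key => // i; have [] := hx i.
Qed.

Lemma ae_sum_cell j :
  {ae lebD R, forall x, \sum_(i < (2 ^ j)%N) \sum_(l < (2 ^ j)%N) cell j i l x = 1}.
Proof.
apply: filterS (ae_off_grid j) => x [Dx hx].
have [r1 r2] := square_range Dx hx.
rewrite /cell; under eq_bigr do rewrite -mulr_sumr.
rewrite -mulr_suml !sum_unit_ind ?mulr1// => i; by have [] := hx i.
Qed.

Lemma unit_ind_split (y : R) : 2 * y != 1 ->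
  unit_ind y = unit_ind (2 * y) + unit_ind (2 * y - 1).
Proof.
move=> y1; rewrite /unit_ind.
by case: ifP; case: ifP; case: ifP; rewrite ?addr0 ?add0r//; try lra.
Qed.

Lemma ae_cell_refine j :
  {ae lebD R, forall x, forall i l, cell j i l x =
    (cell j.+1 i.*2 l.*2 x + cell j.+1 i.*2.+1 l.*2 x) +
    (cell j.+1 i.*2 l.*2.+1 x + cell j.+1 i.*2.+1 l.*2.+1 x)}.
Proof.
apply: filterS (ae_off_grid j.+1) => x [Dx hx] i l.
have key (t : R) (n : nat) : (forall i : nat, 2 ^+ j.+1 * t != i%:R) ->
    unit_ind (2 ^+ j * t - n%:R) = unit_ind (2 ^+ j.+1 * t - n.*2%:R) +
    unit_ind (2 ^+ j.+1 * t - n.*2.+1%:R).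
  have n2 : n.*2%:R = 2 * n%:R :> R by rewrite -mul2n natrM.
  have n21 : n.*2.+1%:R = 2 * n%:R + 1 :> R by rewrite -n2 natr1.
  move=> ht; rewrite unit_ind_split.
    by congr (unit_ind _ + unit_ind _); rewrite exprS ?n21 ?n2; ring.
  by have := ht n.*2.+1; apply: contra => /eqP e; rewrite exprS n21; apply/eqP; lra.
rewrite /cell !key; [ring| |] => n; by have [] := hx n.
Qed.

End cells.

Section step_integrals.
Context {R : realType}.
Local Notation L1 u := ((lebD R).-integrable setT (EFin \o u)).

Lemma L1_cell (u : plane R -> R) j i l : L1 u -> L1 (fun x => u x * cell j i l x).
Proof.
by move=> iu; apply: (L1_mulr (C := 1)) => // [|x]; [exact: measurable_cell|exact: cell_norm].
Qed.

Lemma L1_cst (c : R) : L1 (fun=> c).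
Proof.
apply: (@measurable_bounded_integrable _ _ _ (lebD R) (fun=> c) setT) => //.
- by rewrite [X in (X < _)%E]lebD_setT ltry.
- by exists `|c|; split; [exact: num_real|move=> y cy z _; exact: ltW].
Qed.

Lemma L1_cell1 j i l : L1 (cell j i l).
Proof.
have := L1_cell j i l (L1_cst 1).
by rewrite (_ : (fun x => 1 * _) = cell j i l)//; apply/funext => x; rewrite mul1r.
Qed.

Lemma L1_step j (b : nat -> nat -> R) : L1 (step j b).
Proof.
by do 2 apply: L1_sum => ?; apply: L1_Z; exact: L1_cell1.
Qed.

Lemma measurable_step j (b : nat -> nat -> R) : measurable_fun setT (step j b : plane R -> R).
Proof. exact: L1_measurable (L1_step j b). Qed.

Lemma Rint_coef (u : plane R -> R) j : L1 u ->
  \int[lebD R]_x u x = \sum_(i < (2 ^ j)%N) \sum_(l < (2 ^ j)%N) coef j u i l.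
Proof.
move=> iu; under [RHS]eq_bigr => i _.
  rewrite -Rint_sum; last by move=> l; exact: L1_cell.
  over.
rewrite -Rint_sum; last by move=> i; apply: L1_sum => l; exact: L1_cell.
apply: ae_Rint_eq => //.
  by apply: L1_measurable; do 2 apply: L1_sum => ?; exact: L1_cell.
apply: filterS (ae_sum_cell j) => x h.
by under eq_bigr do rewrite -mulr_sumr; rewrite -mulr_sumr h mulr1.
Qed.

Lemma lebesgue_measure_oo (a b : R) : a <= b ->
  lebesgue_measure `]a, b[%classic = (b - a)%:E.
Proof.
move=> ab; rewrite lebesgue_measure_itv/= lte_fin.
move: ab; rewrite le_eqVlt => /predU1P[->|->]; last by rewrite EFinN.
by rewrite ltxx subrr.
Qed.

Lemma Rint_cell j (i l : 'I_(2 ^ j)) : \int[lebD R]_x cell j i l x = (4 ^+ j)^-1.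
Proof.
pose I (n : nat) : set (measurableTypeR R) := `]n%:R / 2 ^+ j, (n%:R + 1) / 2 ^+ j[%classic.
have p0 := pow2_gt0 (R := R) j.
have uI (n : nat) (t : R) : unit_ind (2 ^+ j * t - n%:R) = \1_(I n) t.
  rewrite /unit_ind indicE mem_setE in_itv/= ltr_pdivrMr// ltr_pdivlMr//.
  by rewrite [t * _]mulrC subr_gt0 ltrBlDl addrC; case: ifP.
have -> : cell j i l = \1_(I i `*` I l).
  by apply/funext => x; rewrite /cell !uI indicE [RHS]indicE indicE in_setX -natrM mulnb.
have mI n : measurable (I n) by exact: measurable_itv.
rewrite /Rintegral integral_indic//; last exact: measurableX.
rewrite setIT lebDE setIidl.
  rewrite leb2X//.
  have lI n : lebesgue_measure (I n) = (2 ^+ j)^-1%:E.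
    rewrite lebesgue_measure_oo; last by rewrite ler_pM2r ?invr_gt0// lerDl.
    by rewrite -mulrBl [_ + 1]addrC addrK mul1r.
  by rewrite [X in fine (X * _)%E]lI [X in fine (_ * X)%E]lI /= pow4 invfM.
have sub (n : 'I_(2 ^ j)) t : I n t -> 0 <= t <= 1.
  rewrite /I/= in_itv/= => /andP[a b]; apply/andP; split.
    by apply: ltW; apply: le_lt_trans a; rewrite divr_ge0// ltW.
  apply: ltW; apply: lt_le_trans b _; rewrite ler_pdivrMr// mul1r -natrX natr1 ler_nat.
  exact: ltn_ord.
by move=> x [/= /sub a /sub b]; split; rewrite /= in_itv/=.
Qed.

Lemma stepM j (b : nat -> nat -> R) (i l : 'I_(2 ^ j)) x :
  step j b x * cell j i l x = 4 ^+ j * b i l * cell j i l x.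
Proof.
rewrite /step mulr_suml (bigD1 i)//= [X in _ + X]big1 => [|i' ii']; last first.
  rewrite mulr_suml big1// => l' _.
  by rewrite -mulrA cellM (negPf ii') /= mul0r mulr0.
rewrite addr0 mulr_suml (bigD1 l)//= [X in _ + X]big1 => [|l' ll']; last first.
  by rewrite -mulrA cellM (negPf ll') andbF mul0r mulr0.
by rewrite addr0 -mulrA cellM !eqxx mul1r.
Qed.

Lemma coef_step j (b : nat -> nat -> R) (i l : 'I_(2 ^ j)) : coef j (step j b) i l = b i l.
Proof.
rewrite /coef; under eq_Rintegral do rewrite stepM.
rewrite RintegralZl//; last exact: L1_cell1.
by rewrite Rint_cell mulrAC divff ?mul1r// gt_eqF// pow4_gt0.
Qed.

Lemma Rint_step_map (F : R -> R) j (b : nat -> nat -> R) : F 0 = 0 ->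
  \int[lebD R]_x F (step j b x) =
  \sum_(i < (2 ^ j)%N) \sum_(l < (2 ^ j)%N) F (4 ^+ j * b i l) / 4 ^+ j.
Proof.
move=> F0; under eq_Rintegral do rewrite step_map//.
rewrite Rint_sum; last by move=> i; apply: L1_sum => l; apply: L1_Z; exact: L1_cell1.
apply: eq_bigr => i _; rewrite Rint_sum; last by move=> l; apply: L1_Z; exact: L1_cell1.
apply: eq_bigr => l _; rewrite RintegralZl ?Rint_cell//; exact: L1_cell1.
Qed.

Lemma Rint_norm_step j (b : nat -> nat -> R) : \int[lebD R]_x `|step j b x| =
  \sum_(i < (2 ^ j)%N) \sum_(l < (2 ^ j)%N) `|b i l|.
Proof.
rewrite (Rint_step_map (F := Num.norm)) ?normr0//.
apply: eq_bigr => i _; apply: eq_bigr => l _; rewrite normrM mulrAC.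
by rewrite ger0_norm ?exprn_ge0// divff ?mul1r// gt_eqF// pow4_gt0.
Qed.

Lemma Rint_sqr_step j (b : nat -> nat -> R) : \int[lebD R]_x (step j b x) ^+ 2 =
  4 ^+ j * \sum_(i < (2 ^ j)%N) \sum_(l < (2 ^ j)%N) (b i l) ^+ 2.
Proof.
rewrite (Rint_step_map (F := fun t => t ^+ 2)) ?expr0n//.
rewrite mulr_sumr; apply: eq_bigr => i _; rewrite mulr_sumr; apply: eq_bigr => l _.
have : (4 ^+ j : R) != 0 by rewrite gt_eqF// pow4_gt0.
by move=> h; field.
Qed.

Lemma sum_norm_coef_le (u : plane R -> R) j : L1 u ->
  \sum_(i < (2 ^ j)%N) \sum_(l < (2 ^ j)%N) `|coef j u i l| <= \int[lebD R]_x `|u x|.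
Proof.
move=> iu; rewrite (Rint_coef j (L1_norm iu)).
apply: ler_sum => i _; apply: ler_sum => l _.
apply: le_trans (Rint_le_norm (L1_cell j i l iu)) _.
by under eq_Rintegral do rewrite normrM (ger0_norm (cell_ge0 _ _ _ _)).
Qed.

Lemma coef_refine (u : plane R -> R) j i l : L1 u -> coef j u i l =
  (coef j.+1 u i.*2 l.*2 + coef j.+1 u i.*2.+1 l.*2) +
  (coef j.+1 u i.*2 l.*2.+1 + coef j.+1 u i.*2.+1 l.*2.+1).
Proof.
move=> iu; rewrite /coef -!RintegralD//; do ?[exact: L1_cell|apply: L1_D; exact: L1_cell].
apply: ae_Rint_eq; first exact: L1_cell.
  by apply: L1_measurable; do 2 apply: L1_D; exact: L1_cell.
by apply: filterS (ae_cell_refine j) => x ->; rewrite !mulrDr.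
Qed.

Lemma coef_funB (u v : plane R -> R) j i l : L1 u -> L1 v ->
  coef j (fun x => u x - v x) i l = coef j u i l - coef j v i l.
Proof.
move=> iu iv; rewrite /coef -RintegralB//; [|exact: L1_cell|exact: L1_cell].
by apply: eq_Rintegral => x _; rewrite mulrBl.
Qed.

Lemma eq_coef_ae (u v : plane R -> R) j i l : L1 u -> L1 v ->
  {ae lebD R, forall x, u x = v x} -> coef j u i l = coef j v i l.
Proof.
move=> iu iv uv; apply: ae_Rint_eq; first exact: L1_cell.
  exact: L1_measurable (L1_cell _ _ _ iv).
by apply: filterS uv => x ->.
Qed.

(** By linearity one function is enough, and the modulus of an integral over a cell is
    at most the integral of the modulus. *)
Lemma step_coef_contract (u v : plane R -> R) j : L1 u -> L1 v ->
  \int[lebD R]_x `|step j (coef j u) x - step j (coef j v) x| <=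
  \int[lebD R]_x `|u x - v x|.
Proof.
move=> iu iv; under [leLHS]eq_Rintegral do rewrite stepB.
rewrite Rint_norm_step; apply: le_trans (sum_norm_coef_le j (L1_B iu iv)).
apply: ler_sum => i _; apply: ler_sum => l _; rewrite coef_funB//.
Qed.

End step_integrals.

Lemma Rint_eq_measure d (T : measurableType d) (R : realType)
    (m1 m2 : {measure set T -> \bar R}) (D : set T) (f : T -> R) :
  (forall A, measurable A -> A `<=` D -> m1 A = m2 A) ->
  \int[m1]_(x in D) f x = \int[m2]_(x in D) f x.
Proof. by move=> h; rewrite /Rintegral (eq_measure_integral m2). Qed.

Lemma lebD_sub (R : realType) (A : set (plane R)) : A `<=` @unit_square R ->
  lebD R A = leb2 R A.
Proof. by move=> AD; rewrite lebDE setIidl. Qed.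

Section dyadic_projection.
Context {R : realType}.
Local Notation L1 u := ((lebD R).-integrable setT (EFin \o u)).

Lemma cell_openE j (i l : nat) (x : plane R) :
  cell j i l x = \1_((dyadic_square j i l)°) x.
Proof.
have p0 := pow2_gt0 (R := R) j.
have uI (n : nat) (t : R) : unit_ind (2 ^+ j * t - n%:R) =
    \1_(`]n%:R / 2 ^+ j, n.+1%:R / 2 ^+ j[%classic) t.
  rewrite /unit_ind indicE mem_setE in_itv/= ltr_pdivrMr// ltr_pdivlMr//.
  by rewrite [t * _]mulrC subr_gt0 ltrBlDl natr1; case: ifP.
rewrite /dyadic_square interior_setX !interior_itv /cell !uI !indicE.
by rewrite in_setX -natrM mulnb.
Qed.

Lemma ae_cell_closedE j (i l : nat) :
  {ae lebD R, forall x, cell j i l x = \1_(dyadic_square j i l) x}.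
Proof.
have p0 := pow2_gt0 (R := R) j.
apply: filterS (ae_off_grid j) => y [_ hy].
have uE (n : nat) (t : R) : (forall i : nat, 2 ^+ j * t != i%:R) ->
    unit_ind (2 ^+ j * t - n%:R) = \1_(`[n%:R / 2 ^+ j, n.+1%:R / 2 ^+ j]%classic) t.
  move=> ht.
  have a1 : (n%:R < 2 ^+ j * t) = (n%:R <= 2 ^+ j * t).
    by rewrite lt_neqAle eq_sym (ht n).
  have a2 : (2 ^+ j * t < n.+1%:R) = (2 ^+ j * t <= n.+1%:R).
    by rewrite lt_neqAle (ht n.+1).
  rewrite indicE mem_setE in_itv/= (ler_pdivrMr _ _ p0) (ler_pdivlMr _ _ p0) (mulrC t) -a1 -a2.
  by rewrite /unit_ind subr_gt0 ltrBlDl natr1; case: ifP.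
rewrite /cell (uE i) ?(uE l); try by move=> n; have [] := hy n.
by rewrite /dyadic_square !indicE -natrM mulnb -in_setX.
Qed.

Lemma leb2_dyadic_square j (i l : nat) :
  leb2 R (dyadic_square j i l) = (4 ^+ j)^-1%:E.
Proof.
have lI (n : nat) : lebesgue_measure `[n%:R / 2 ^+ j, n.+1%:R / 2 ^+ j]%classic =
    (2 ^+ j)^-1%:E :> \bar R.
  rewrite lebesgue_measure_itv/= lte_fin ltr_pM2r ?invr_gt0 ?pow2_gt0// ltr_nat ltnSn -EFinB.
  by rewrite -mulrBl -natr1 [_ + 1]addrC addrK mul1r.
rewrite /dyadic_square leb2X; [|exact: measurable_itv|exact: measurable_itv].
by rewrite [X in (X * _)%E]lI [X in (_ * X)%E]lI -EFinM -invfM -pow4.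
Qed.

Lemma dyadic_square_sub j (i l : 'I_(2 ^ j)) :
  dyadic_square j i l `<=` @unit_square R.
Proof.
have p0 := pow2_gt0 (R := R) j.
have sub (n : 'I_(2 ^ j)) (t : R) : n%:R / 2 ^+ j <= t <= n.+1%:R / 2 ^+ j -> 0 <= t <= 1.
  move=> /andP[a b]; apply/andP; split.
    by apply: le_trans a; rewrite divr_ge0// ltW.
  apply: le_trans b _; rewrite ler_pdivrMr// mul1r -natrX ler_nat; exact: ltn_ord.
move=> [s t] [/=]; rewrite !in_itv/= => /sub a /sub b.
by split; rewrite /= in_itv/=.
Qed.

Lemma Rint_dyadic_square j (i l : 'I_(2 ^ j)) (v : plane R -> R) : L1 v ->
  \int[leb2 R]_(y in dyadic_square j i l) v y = coef j v i l.
Proof.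
move=> iv.
have mQ : measurable (dyadic_square j i l : set (plane R)).
  by apply: measurableX; exact: measurable_itv.
rewrite (@Rint_eq_measure _ _ _ (leb2 R) (lebD R)); last first.
  by move=> A mA AQ; rewrite lebD_sub//; exact: subset_trans AQ (@dyadic_square_sub j i l).
rewrite Rintegral_mkcond /coef.
rewrite (_ : v \_ _ = fun x => v x * \1_(dyadic_square j i l) x); last first.
  by apply/funext => y; rewrite patchE indicE; case: ifP; rewrite ?mulr1 ?mulr0.
apply: ae_Rint_eq.
- apply: (L1_mulr (C := 1)) => // y.
  by rewrite indicE; case: (_ \in _); rewrite ?normr1 ?normr0.
- exact: L1_measurable (L1_cell _ _ _ iv).
by apply: filterS (ae_cell_closedE j i l) => y ->.
Qed.

Lemma dyadic_projE j (v : plane R -> R) : L1 v ->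
  dyadic_proj j v = step j (coef j v).
Proof.
move=> iv; apply/funext => x.
apply: eq_bigr => i _; apply: eq_bigr => l _.
by rewrite leb2_dyadic_square Rint_dyadic_square// cell_openE /= invrK.
Qed.

End dyadic_projection.

(** * Discrete variation *)

Section discrete.
Context {R : realType}.
Implicit Types (b : nat -> nat -> R) (c : nat -> R).

(** The guard keeps the differences across inner edges only, while both indices
    range over the whole grid. *)
Definition dvar (k : 'I_2) (j : nat) b : R :=
  if k == 0 then
    \sum_(i < (2 ^ j)%N) \sum_(l < (2 ^ j)%N) (i.+1 < 2 ^ j)%N%:R * `|b i.+1 l - b i l|
  else
    \sum_(i < (2 ^ j)%N) \sum_(l < (2 ^ j)%N) (l.+1 < 2 ^ j)%N%:R * `|b i l.+1 - b i l|.

Lemma dvar_ge0 k j b : 0 <= dvar k j b.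
Proof.
rewrite /dvar; case: ifP => _; apply: sumr_ge0 => i _; apply: sumr_ge0 => l _;
  by rewrite mulr_ge0.
Qed.

Lemma sum_double (N : nat) (F : nat -> R) :
  \sum_(i < N.*2) F i = \sum_(i < N) (F i.*2 + F i.*2.+1).
Proof.
elim: N => [|N IH]; first by rewrite !big_ord0.
by rewrite doubleS !big_ord_recr/= IH addrA.
Qed.

Lemma sum_double2 (N : nat) (F : nat -> nat -> R) :
  \sum_(i < N.*2) \sum_(l < N.*2) F i l =
  \sum_(i < N) \sum_(l < N) ((F i.*2 l.*2 + F i.*2.+1 l.*2) +
                             (F i.*2 l.*2.+1 + F i.*2.+1 l.*2.+1)).
Proof.
rewrite (sum_double N (fun i => \sum_(l < N.*2) F i l)); apply: eq_bigr => i _.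
rewrite !sum_double -big_split/=; apply: eq_bigr => l _; ring.
Qed.

Lemma mean4_dev (p q r s m : R) : m = ((p + q) + (r + s)) / 4 ->
  `|p - m| + `|q - m| + (`|r - m| + `|s - m|) <=
  2 * ((`|q - p| + `|s - r|) + (`|r - p| + `|s - q|)).
Proof.
move=> mE.
have tri (x y z w : R) : `|x - ((x + y) + (z + w)) / 4| <= (`|y - x| + `|z - x| + `|w - x|) / 4.
  have -> : x - ((x + y) + (z + w)) / 4 = - ((y - x) + (z - x) + (w - x)) / 4 by field.
  rewrite normrM normrN [X in _ * X]ger0_norm ?invr_ge0// ler_wpM2r ?invr_ge0//.
  by apply: le_trans (ler_normD _ _) _; rewrite lerD2r ler_normD.
have h1 := tri p q r s.
have h2 : `|q - m| <= (`|p - q| + `|s - q| + `|r - q|) / 4.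
  by rewrite (_ : m = ((q + p) + (s + r)) / 4) ?tri// mE; field.
have h3 : `|r - m| <= (`|s - r| + `|p - r| + `|q - r|) / 4.
  by rewrite (_ : m = ((r + s) + (p + q)) / 4) ?tri// mE; field.
have h4 : `|s - m| <= (`|r - s| + `|q - s| + `|p - s|) / 4.
  by rewrite (_ : m = ((s + r) + (q + p)) / 4) ?tri// mE; field.
have h5 : `|s - p| <= `|s - q| + `|q - p|.
  by rewrite (_ : s - p = (s - q) + (q - p)) ?ler_normD//; ring.
have h6 : `|r - q| <= `|r - p| + `|q - p|.
  by rewrite (distrC q p) (_ : r - q = (r - p) + (p - q)) ?ler_normD//; ring.
move: h1 h2 h3 h4; rewrite -mE (distrC p q) (distrC p r) (distrC q r) (distrC r s) (distrC q s) (distrC p s).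
have := normr_ge0 (q - p); have := normr_ge0 (s - r).
have := normr_ge0 (r - p); have := normr_ge0 (s - q).
lra.
Qed.

(** Averaging over four children moves the coefficients by at most their
    oscillation within each parent cell: a discrete Poincare inequality. *)
Lemma refine_dist_le j (b b' : nat -> nat -> R) :
  (forall i l, (i < 2 ^ j)%N -> (l < 2 ^ j)%N -> b i l =
     (b' i.*2 l.*2 + b' i.*2.+1 l.*2) + (b' i.*2 l.*2.+1 + b' i.*2.+1 l.*2.+1)) ->
  \sum_(i < (2 ^ j.+1)%N) \sum_(l < (2 ^ j.+1)%N) `|b' i l - b i./2 l./2 / 4| <=
  2 * (dvar 0 j.+1 b' + dvar 1 j.+1 b').
Proof.
move=> bb'.
rewrite /dvar/= expnS mul2n.
rewrite (sum_double2 _ (fun i l => `|b' i l - b i./2 l./2 / 4|)).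
rewrite (sum_double2 _ (fun i l => (i.+1 < (2 ^ j).*2)%N%:R * `|b' i.+1 l - b' i l|)).
rewrite (sum_double2 _ (fun i l => (l.+1 < (2 ^ j).*2)%N%:R * `|b' i l.+1 - b' i l|)).
rewrite -big_split/= mulr_sumr; apply: ler_sum => i _.
rewrite -big_split/= mulr_sumr; apply: ler_sum => l _.
rewrite !uphalf_double !doubleK !bb'//.
have hi : (i.*2.+1 < (2 ^ j).*2)%N by rewrite -doubleS leq_double.
have hl : (l.*2.+1 < (2 ^ j).*2)%N by rewrite -doubleS leq_double.
rewrite hi hl !mul1r.
apply: le_trans (mean4_dev erefl) _.
rewrite ler_pM2l//.
set x1 := `|_ - _|; set x2 := `|_ - _|; set x3 := `|_ - _|; set x4 := `|_ - _|.
set y1 := _%:R * _; set y2 := _%:R * _; set y3 := _%:R * _; set y4 := _%:R * _.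
have : 0 <= y1 by rewrite mulr_ge0.
have : 0 <= y2 by rewrite mulr_ge0.
have : 0 <= y3 by rewrite mulr_ge0.
have : 0 <= y4 by rewrite mulr_ge0.
lra.
Qed.

Lemma osc_le_tv c (N i m : nat) : (i <= N)%N -> (m <= N)%N ->
  `|c i - c m| <= \sum_(t < N) `|c t.+1 - c t|.
Proof.
elim: N i m => [|N IH] i m.
  by rewrite !leqn0 => /eqP -> /eqP ->; rewrite subrr normr0 big_ord0.
have key n : (n <= N)%N -> `|c N.+1 - c n| <= \sum_(t < N.+1) `|c t.+1 - c t|.
  move=> nN; rewrite big_ord_recr/= (_ : c N.+1 - c n = (c N - c n) + (c N.+1 - c N)); last by ring.
  by apply: le_trans (ler_normD _ _) _; rewrite lerD2r IH.
rewrite leq_eqVlt ltnS => /predU1P[->|iN]; rewrite leq_eqVlt ltnS => /predU1P[->|mN].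
- by rewrite subrr normr0 sumr_ge0.
- exact: key.
- by rewrite distrC key.
- by apply: le_trans (IH _ _ iN mN) _; rewrite big_ord_recr/= lerDl.
Qed.

Lemma sum_guard (N : nat) (F : nat -> R) :
  \sum_(i < N.+1) (i.+1 < N.+1)%N%:R * F i = \sum_(i < N) F i.
Proof.
rewrite big_ord_recr/= ltnn mul0r addr0; apply: eq_bigr => i _.
by rewrite ltnS ltn_ord mul1r.
Qed.

(** A value differs from every other one, hence from their mean, by at most the
    variation. *)
Lemma sup_le_mean_tv c (N i : nat) : (i < N)%N ->
  N%:R * `|c i| <= \sum_(m < N) `|c m| +
    N%:R * \sum_(m < N) (m.+1 < N)%N%:R * `|c m.+1 - c m|.
Proof.
case: N => // N; rewrite ltnS => iN; rewrite (sum_guard _ (fun m => `|c m.+1 - c m|)).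
set V := \sum_(t < N) _.
have h (m : 'I_N.+1) : `|c i| <= `|c m| + V.
  rewrite -[c i](subrK (c m)) addrC; apply: le_trans (ler_normD _ _) _.
  by rewrite lerD2l osc_le_tv// -ltnS.
have : \sum_(m < N.+1) `|c i| <= \sum_(m < N.+1) (`|c m| + V) by apply: ler_sum => m _.
by rewrite big_split/= !sumr_const card_ord !mulr_natl.
Qed.

(** Discrete form of the embedding of BV into L^2: each entry is bounded both by a
    function of its row and by a function of its column. *)
Lemma discrete_sobolev j b :
  4 ^+ j * \sum_(i < (2 ^ j)%N) \sum_(l < (2 ^ j)%N) b i l ^+ 2 <=
  (\sum_(i < (2 ^ j)%N) \sum_(l < (2 ^ j)%N) `|b i l| + 2 ^+ j * dvar 0 j b) *
  (\sum_(i < (2 ^ j)%N) \sum_(l < (2 ^ j)%N) `|b i l| + 2 ^+ j * dvar 1 j b).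
Proof.
set N := (2 ^ j)%N.
have p : 2 ^+ j = N%:R :> R by rewrite /N natrX.
have -> : 4 ^+ j = N%:R ^+ 2 :> R by rewrite pow4 p expr2.
pose f l : R := \sum_(i < N) `|b i l| + N%:R * \sum_(i < N) (i.+1 < N)%N%:R * `|b i.+1 l - b i l|.
pose g i : R := \sum_(l < N) `|b i l| + N%:R * \sum_(l < N) (l.+1 < N)%N%:R * `|b i l.+1 - b i l|.
have fE : \sum_(i < N) \sum_(l < N) `|b i l| + 2 ^+ j * dvar 0 j b = \sum_(l < N) f l.
  rewrite /dvar/= -/N p exchange_big/= [X in _ * X]exchange_big/= mulr_sumr -big_split/=.
  by apply: eq_bigr => l _; rewrite /f.
have gE : \sum_(i < N) \sum_(l < N) `|b i l| + 2 ^+ j * dvar 1 j b = \sum_(i < N) g i.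
  by rewrite /dvar/= -/N p mulr_sumr -big_split/=.
rewrite fE gE [leRHS]mulrC mulr_sumr [leRHS]mulr_suml; apply: ler_sum => i _.
rewrite mulr_sumr [leRHS]mulr_sumr; apply: ler_sum => l _.
have h1 : N%:R * `|b i l| <= f l by exact: (@sup_le_mean_tv (fun i => b i l)).
have h2 : N%:R * `|b i l| <= g i by exact: (@sup_le_mean_tv (fun l => b i l)).
have -> : N%:R ^+ 2 * b i l ^+ 2 = (N%:R * `|b i l|) * (N%:R * `|b i l|).
  by rewrite -expr2 exprMn real_normK ?num_real.
by apply: ler_pM.
Qed.

End discrete.

(** * Fast L^1 convergence *)

Lemma cvgn_EFin (R : realType) (u : nat -> R) (l : R) :
  u n @[n --> \oo] --> l -> (u n)%:E @[n --> \oo] --> l%:E.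
Proof. by move=> ul; apply: cvg_EFin; [exact: nearW|]. Qed.

Section fast_cauchy.
Context d (T : measurableType d) (R : realType) (mu : {measure set T -> \bar R}).
Local Notation L1 u := (mu.-integrable [set: T] (EFin \o u)).

Lemma Rint_tri (u v w : T -> R) : L1 u -> L1 v -> L1 w ->
  \int[mu]_x `|u x - w x| <= \int[mu]_x `|u x - v x| + \int[mu]_x `|v x - w x|.
Proof.
move=> iu iv iw; rewrite -RintegralD//; try exact: L1_norm (L1_B _ _).
apply: le_Rintegral => //; first exact: L1_norm (L1_B iu iw).
  by apply: L1_D; apply: L1_norm (L1_B _ _).
move=> x _; rewrite (_ : u x - w x = (u x - v x) + (v x - w x)) ?ler_normD//; ring.
Qed.

Lemma ae_fatou (F : nat -> T -> R) (G : T -> R) (K : R) :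
  (forall m, measurable_fun setT (F m)) -> (forall m x, 0 <= F m x) ->
  measurable_fun setT G -> (forall x, 0 <= G x) ->
  {ae mu, forall x, F m x @[m --> \oo] --> G x} ->
  (forall m, (\int[mu]_x (F m x)%:E <= K%:E)%E) ->
  (\int[mu]_x (G x)%:E <= K%:E)%E.
Proof.
move=> mF F0 mG G0 FG FK.
have mF' m : measurable_fun setT (fun x => (F m x)%:E) by exact/measurable_EFinP.
have -> : (\int[mu]_x (G x)%:E = \int[mu]_x limn_einf (fun m => (F m x)%:E))%E.
  apply: ge0_ae_eq_integral => //.
  - exact/measurable_EFinP.
  - rewrite (_ : (fun x => _) = (fun x => - limn_esup (fun m => - (F m x)%:E))%E).
      apply: measurableT_comp => //; apply: measurable_fun_limn_esup => m.
      exact: measurableT_comp.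
    apply/funext => x; rewrite -limn_einfN; congr limn_einf.
    by apply/funext => m; exact/esym/oppeK.
  - by move=> x _; rewrite lee_fin.
  - move=> x _; rewrite limn_einf_lim; apply: lime_ge; first exact: is_cvg_einfs.
    by apply: nearW => m; apply: le_ereal_inf_tmp => _ [k _ <-]; rewrite lee_fin.
  apply: filterS FG => x gx _.
  by have [-> _] := cvg_limn_einf_sup (cvgn_EFin gx).
apply: le_trans (fatou mu measurableT mF' _) _; first by move=> *; rewrite lee_fin.
rewrite limn_einf_lim; apply: lime_le; first exact: is_cvg_einfs.
apply: nearW => m; apply: le_trans (FK m).
by apply: ereal_inf_lbound; exists m => /=.
Qed.

(** Riesz-Fischer: the series of the moduli of the increments has a finite integral, so
    it converges almost everywhere. *)
Lemma L1_fast_cvg (f : nat -> T -> R) (C : R) :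
  (forall n, L1 (f n)) ->
  (forall n, \int[mu]_x `|f n.+1 x - f n x| <= C / 2 ^+ n) ->
  exists g, [/\ L1 g, {ae mu, forall x, f n x @[n --> \oo] --> g x} &
    forall n, \int[mu]_x `|g x - f n x| <= 2 * C / 2 ^+ n].
Proof.
move=> intf hf.
have idf n m : L1 (fun x => f n x - f m x) by exact: L1_B.
have mf n := L1_measurable (intf n).
have C0 : 0 <= C.
  have := hf 0%N; rewrite expr0 divr1; apply: le_trans.
  exact: Rintegral_ge0.
pose h n (x : T) : \bar R := (`|f n.+1 x - f n x|)%:E.
have mh n : measurable_fun setT (h n).
  by apply/measurable_EFinP; exact: L1_measurable (L1_norm (idf _ _)).
have h0 n x : (0 <= h n x)%E by rewrite lee_fin.
pose G (x : T) : \bar R := (\sum_(n <oo) h n x)%E.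
have mG : measurable_fun setT G.
  exact: (@ge0_emeasurable_sum _ _ _ _ h predT).
have hle n m : (n <= m)%N -> \int[mu]_x `|f m x - f n x| <= 2 * C / 2 ^+ n - 2 * C / 2 ^+ m.
  move=> /subnKC <-; elim: (m - n)%N => [|k IH].
    rewrite addn0 subrr (@eq_Rintegral _ _ _ _ _ (fun=> 0)); last by move=> x _; rewrite subrr normr0.
    by rewrite /Rintegral integral0.
  rewrite addnS; apply: le_trans (Rint_tri (intf _) (intf (n + k)%N) (intf n)) _.
  apply: le_trans (lerD (hf _) IH) _.
  rewrite (exprS 2 (n + k)) invfM.
  set a := (2 ^+ (n + k))^-1; set b := (2 ^+ n)^-1; lra.
have Gfin : (\int[mu]_x G x <= (2 * C)%:E)%E.
  rewrite integral_nneseries//.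
  apply: lime_le; first by apply: is_cvg_nneseries => n _ _; exact: integral_ge0.
  apply: nearW => n; apply: (@le_trans _ _ (2 * C - 2 * C / 2 ^+ n)%:E); last first.
    by rewrite lee_fin gerBl divr_ge0// ?mulr_ge0// exprn_ge0.
  elim: n => [|n IH]; first by rewrite big_nil expr0 divr1 subrr.
  rewrite big_nat_recr//=; apply: (le_trans (leeD IH (_ : _ <= (C / 2 ^+ n)%:E)%E)).
    by rewrite /h -(Rint_fin (L1_norm (idf _ _))) lee_fin.
  rewrite -EFinD lee_fin (exprS 2 n) invfM; set b := (2 ^+ n)^-1; lra.
have iG : mu.-integrable setT G.
  apply/integrableP; split => //.
  rewrite (eq_integral G); first exact: le_lt_trans Gfin (ltry _).
  by move=> x _; rewrite gee0_abs//; apply: nneseries_ge0.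
have aecv : {ae mu, forall x, cvgn (fun n => f n x)}.
  have := integrable_ae measurableT iG; apply: filterS => x /(_ I) Gx.
  have cs : cvgn (series (telescope (fun n => f n x))).
    apply: normed_cvg; apply: nondecreasing_is_cvgn.
      apply: nondecreasing_series => n _ _; exact: normr_ge0.
    exists (fine (G x)) => _ [n _ <-].
    rewrite -lee_fin fineK// /series /= -sumEFin.
    exact: (@nneseries_lim_ge _ (h ^~ x) predT).
  rewrite (_ : (fun n => f n x) = (fun n => f 0%N x + series (telescope (fun n => f n x)) n)).
    by apply: is_cvgD => //; exact: is_cvg_cst.
  by apply/funext => n; rewrite -eq_sum_telescope.
pose g x := fine (limn_esup (fun n => (f n x)%:E)).
have mg : measurable_fun setT g.
  apply: (measurableT_comp (fine_measurable measurableT)).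
  by apply: measurable_fun_limn_esup => n; exact/measurable_EFinP.
have aeg : {ae mu, forall x, f n x @[n --> \oo] --> g x}.
  apply: filterS aecv => x /cvg_ex[l fl].
  have [_ e] := cvg_limn_einf_sup (cvgn_EFin fl).
  rewrite /g [limn_esup _]e.
  exact: fl.
have key n : (\int[mu]_x (`|g x - f n x|)%:E <= (2 * C / 2 ^+ n)%:E)%E.
  apply: (@ae_fatou (fun m x => `|f (maxn m n) x - f n x|)) => [m|||||m].
  - exact: L1_measurable (L1_norm (idf _ _)).
  - by move=> m x.
  - by apply: measurableT_comp => //; exact: measurable_funB.
  - by [].
  - apply: filterS aeg => x gx; apply: cvg_norm; apply: cvgB; last exact: cvg_cst.
    apply: (cvg_comp (fun m => maxn m n) (fun m => f m x)) gx.
    by apply: cvg_geq_oo => m; exact: leq_maxl.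
  rewrite -(Rint_fin (L1_norm (idf _ _))) lee_fin.
  apply: le_trans (hle _ _ (leq_maxr m n)) _.
  by rewrite gerBl divr_ge0// ?mulr_ge0// exprn_ge0.
have ig : L1 g.
  have i0 : L1 (fun x => g x - f 0%N x).
    apply/integrableP; split.
      by apply/measurable_EFinP; exact: measurable_funB.
    apply: le_lt_trans (key 0%N) (ltry _).
  rewrite (_ : g = fun x => (g x - f 0%N x) + f 0%N x); first exact: L1_D.
  by apply/funext => x; rewrite subrK.
exists g; split => // n.
by rewrite -lee_fin Rint_fin//; exact: L1_norm (L1_B ig (intf n)).
Qed.

End fast_cauchy.

(** * Functions are determined by their integrals over dyadic cells *)

Section determined_by_cells.
Context {R : realType}.
Local Notation L1 u := ((lebD R).-integrable setT (EFin \o u)).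

(** The indicator of the dyadic intervals that lie to the left of [s]; these converge
    to the indicator of a half-line. So the integral of [f] over every quadrant
    vanishes, and two Dynkin classes extend this to all rectangles and then to all
    Borel sets. *)
Let below (s : R) (j : nat) (y : R) : R :=
  \sum_(i < (2 ^ j)%N) (i.+1%:R <= 2 ^+ j * s)%R%:R * unit_ind (2 ^+ j * y - i%:R).

Let below_cvg (s y : R) : (forall j, 0 < 2 ^+ j * y < (2 ^ j)%:R) ->
  (forall j (i : nat), 2 ^+ j * y != i%:R) ->
  below s j y @[j --> \oo] --> ((y < s)%R%:R : R).
Proof.
move=> hy hn; have [ys|sy] := ltP y s; apply: cvg_near_cst; last first.
  apply: nearW => j; apply: big1 => i _.
  rewrite /unit_ind; case: ifP; rewrite ?mulr0// => /andP[_ hi].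
  rewrite lt_geF ?mul0r//; apply: le_lt_trans (_ : _ <= 2 ^+ j * y) _.
    by rewrite ler_pM2l ?pow2_gt0.
  by rewrite -natr1; lra.
near=> j.
rewrite /below -[RHS](sum_unit_ind (hy j) (hn j)); apply: eq_bigr => i _.
rewrite /unit_ind; case: ifP; rewrite ?mulr0// => /andP[hi _].
suff -> : i.+1%:R <= 2 ^+ j * s by rewrite mul1r.
have : 1 <= 2 ^+ j * (s - y).
  rewrite -ler_pdivrMr ?subr_gt0// mul1r.
  apply: (@le_trans _ _ j%:R).
    by apply: ltW; near: j; exact: nbhs_infty_gtr.
  by rewrite -natrX ler_nat ltnW// ltn_expl.
by rewrite -natr1 mulrBr; lra.
Unshelve. all: by end_near.
Qed.

Let below_ge0 s j y : 0 <= below s j y.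
Proof. by apply: sumr_ge0 => i _; rewrite mulr_ge0// unit_ind_ge0. Qed.

Let below_le1 s j y : below s j y <= 1.
Proof.
rewrite /below; case: (unit_ind_shift (2 ^+ j * y) (2 ^ j)) => [h|[a ha]].
  by rewrite big1// => i _; rewrite h mulr0.
rewrite (bigD1 a)//= big1 ?addr0 => [|i /negPf ia].
  by rewrite ha eqxx mulr1 lern1 leq_b1.
by rewrite ha ia mulr0.
Qed.

Let measurable_below s j : measurable_fun setT (below s j).
Proof.
apply: measurable_sum => i; apply: measurable_funM => //.
apply: measurableT_comp measurable_unit_ind _.
by apply: measurable_funB => //; apply: measurable_funM.
Qed.

Variable f : plane R -> R.
Hypothesis intf : L1 f.
Hypothesis f0 : forall j (i l : 'I_(2 ^ j)), coef j f i l = 0.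

Let quadrant0 (s t : R) : \int[lebD R]_x (f x * ((x.1 < s)%R%:R * (x.2 < t)%R%:R)) = 0.
Proof.
have mlt1 : measurable_fun setT (fun x : plane R => ((x.1 < s)%R%:R * (x.2 < t)%R%:R : R)).
  rewrite (_ : (fun _ => _) = \1_(`]-oo, s[%classic `*` `]-oo, t[%classic)).
    by apply: measurable_indic; apply: measurableX; exact: measurable_itv.
  apply/funext => x; rewrite indicE in_setX -natrM mulnb !mem_setE.
  by rewrite !in_itv.
have cv : \int[lebD R]_x (f x * (below s j x.1 * below t j x.2)) @[j --> \oo] -->
    \int[lebD R]_x (f x * ((x.1 < s)%R%:R * (x.2 < t)%R%:R)).
  apply: (Rint_dominated_ae (C := 1)) => //.
  - move=> j; apply: measurable_funM.
      exact: (measurableT_comp (measurable_below s j) measurable_fst).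
    exact: (measurableT_comp (measurable_below t j) measurable_snd).
  - by move=> j x; rewrite ger0_norm ?mulr_ge0 ?below_ge0// mulr_ile1 ?below_ge0 ?below_le1.
  have : {ae lebD R, forall x, forall j, @unit_square R x /\
      forall i : nat, 2 ^+ j * x.1 != i%:R /\ 2 ^+ j * x.2 != i%:R}.
    by apply/ae_foralln => j; exact: ae_off_grid.
  apply: filterS => x hx; apply: cvgM; apply: below_cvg => j.
  - by have [Dx h] := hx j; have [] := square_range Dx h.
  - by move=> i; have [_ /(_ i)[]] := hx j.
  - by have [Dx h] := hx j; have [] := square_range Dx h.
  - by move=> i; have [_ /(_ i)[]] := hx j.
apply: (cvg_unique _ cv) => //=.
apply: cvg_near_cst; apply: nearW => j.
pose c (s : R) (i : 'I_(2 ^ j)) : R := (i.+1%:R <= 2 ^+ j * s)%R%:R.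
under eq_Rintegral => x _.
  rewrite (_ : f x * _ = \sum_(i < (2 ^ j)%N) \sum_(l < (2 ^ j)%N) (c s i * c t l) * (f x * cell j i l x)).
    over.
  rewrite /below mulr_suml mulr_sumr; apply: eq_bigr => i _.
  rewrite mulr_sumr mulr_sumr; apply: eq_bigr => l _.
  by rewrite /cell /c; ring.
rewrite Rint_sum; last by move=> i; apply: L1_sum => l; apply: L1_Z; exact: L1_cell.
apply: big1 => i _.
rewrite Rint_sum; last by move=> l; apply: L1_Z; exact: L1_cell.
apply: big1 => l _; rewrite RintegralZl//; last exact: L1_cell.
by rewrite [X in _ * X]f0 mulr0.
Qed.

Let Z (E : set (plane R)) : Prop := \int[lebD R]_x (f x * \1_E x) = 0.

Let int_ind (E : set (plane R)) : measurable E -> L1 (fun x => f x * \1_E x).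
Proof.
move=> mE; apply: (L1_mulr (C := 1)) => // x.
by rewrite indicE; case: (_ \in _); rewrite ?normr1 ?normr0.
Qed.

Let ZC (E F : set (plane R)) : measurable E -> measurable F -> E `<=` F ->
  Z F -> Z E -> Z (F `\` E).
Proof.
move=> mE mF EF ZF ZE; rewrite /Z.
rewrite (@eq_Rintegral _ _ _ _ _ (fun x => f x * \1_F x - f x * \1_E x)).
  by rewrite RintegralB//; [rewrite ZF ZE subrr|exact: int_ind|exact: int_ind].
move=> x _; rewrite -mulrBr; congr (_ * _); rewrite !indicE in_setD.
case: (boolP (x \in E)) => [xE|_]; last by rewrite andbT subr0.
by rewrite (mem_set (EF _ (set_mem xE))) subrr.
Qed.

Let Zbigcup (E : (set (plane R))^nat) : (forall n, measurable (E n)) ->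
  trivIset setT E -> (forall n, Z (E n)) -> Z (\bigcup_n E n).
Proof.
move=> mE tE ZE; rewrite /Z.
have key (A : set (plane R)) : measurable A ->
    (\int[lebD R]_(x in A) (f x)%:E)%E = (\int[lebD R]_x (f x * \1_A x))%:E.
  move=> mA; rewrite Rint_fin; last exact: int_ind.
  rewrite [LHS]integral_mkcond; apply: eq_integral => x _.
  by rewrite patchE indicE; case: ifP; rewrite ?mulr1 ?mulr0.
apply: EFin_inj; rewrite -key; last exact: bigcupT_measurable.
rewrite integral_bigcup//; last by apply: integrableS intf => //; exact: bigcupT_measurable.
by apply: eseries0 => n _ _; rewrite key// ZE.
Qed.

Let Rgen : @measurable _ (measurableTypeR R) = <<s @RGenInftyO.G R >>.
Proof. exact: RGenInftyO.measurableE. Qed.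

Let GI : setI_closed (@RGenInftyO.G R).
Proof.
move=> _ _ [x ->] [y ->]; exists (Num.min x y).
by apply/seteqP; split => t /=; rewrite !in_itv/= lt_min => /andP.
Qed.

Let halfplane0 (t : R) (X : set (measurableTypeR R)) : measurable X ->
  Z (X `*` `]-oo, t[%classic).
Proof.
have mt : measurable (`]-oo, t[%classic : set (measurableTypeR R)) by exact: measurable_itv.
have quad (s : R) : Z (`]-oo, s[%classic `*` `]-oo, t[%classic).
  rewrite /Z -[RHS](quadrant0 s t); apply: eq_Rintegral => x _; congr (_ * _).
  by rewrite indicE in_setX -natrM mulnb !mem_setE !in_itv.
have ZT : Z (setT `*` `]-oo, t[%classic).
  rewrite /Z -[RHS](quad 2); apply: ae_Rint_eq.
  - by apply: int_ind; exact: measurableX.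
  - by apply: L1_measurable; apply: int_ind; apply: measurableX => //; exact: measurable_itv.
  apply: filterS (ae_off_grid 0) => x [[/= + _] _]; rewrite in_itv/= => /andP[_ x1].
  congr (_ * _); rewrite !indicE !in_setX in_setT !mem_setE !in_itv/= (le_lt_trans x1)//.
  by rewrite ltr1n.
move=> mX; have := mX; rewrite [X in X _ -> _]Rgen.
apply: (@dynkin_induction _ (measurableTypeR R) (@RGenInftyO.G R)
   (fun X => Z (X `*` `]-oo, t[%classic))) => //.
- by move=> _ [s ->]; exact: quad.
- move=> S mS ZS; have -> : ~` S `*` `]-oo, t[%classic =
      (setT `*` `]-oo, t[%classic) `\` (S `*` `]-oo, t[%classic).
    by apply/seteqP; split => [[x y] /= [nS yt]|[x y] /= [[_ yt] h]]; split => //;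
      [move=> []|move=> Sx; exact: h].
  by apply: ZC => //; [exact: measurableX|exact: measurableX|move=> [x y] []].
- move=> F mF tF ZF; rewrite (_ : _ `*` _ = \bigcup_k (F k `*` `]-oo, t[%classic)).
    apply: Zbigcup => //; first by move=> n; exact: measurableX.
    by move=> i k _ _ [[x y] [[Fi _] [Fk _]]]; apply: (tF i k) => //; exists x.
  by apply/seteqP; split => [[x y] [[k _ Fk] yt]|[x y] [k _ [Fk yt]]];
    [exists k|split => //; exists k].
Qed.

Let rectangle0 (X Y : set (measurableTypeR R)) : measurable X -> measurable Y ->
  Z (X `*` Y).
Proof.
move=> mX mY; have := mY; rewrite [X in X _ -> _]Rgen.
have ZT : Z (X `*` setT).
  rewrite /Z -[RHS](halfplane0 2 mX); apply: ae_Rint_eq.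
  - by apply: int_ind; exact: measurableX.
  - by apply: L1_measurable; apply: int_ind; apply: measurableX => //; exact: measurable_itv.
  apply: filterS (ae_off_grid 0) => x [[/= _ +] _]; rewrite in_itv/= => /andP[_ x1].
  congr (_ * _); rewrite !indicE !in_setX in_setT [in RHS]mem_setE in_itv/= (le_lt_trans x1)//.
  by rewrite ltr1n.
apply: (@dynkin_induction _ (measurableTypeR R) (@RGenInftyO.G R)
   (fun Y => Z (X `*` Y))) => //.
- by move=> _ [s ->]; exact: halfplane0.
- move=> S mS ZS; have -> : X `*` ~` S = (X `*` setT) `\` (X `*` S).
    by apply/seteqP; split => [[x y] /= [Xx nS]|[x y] /= [[Xx _] h]]; split => //;
      [move=> []|move=> Sx; exact: h].
  by apply: ZC => //; [exact: measurableX|exact: measurableX|move=> [x y] []].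
- move=> F mF tF ZF; rewrite (_ : _ `*` _ = \bigcup_k (X `*` F k)).
    apply: Zbigcup => //; first by move=> n; exact: measurableX.
    by move=> i k _ _ [[x y] [[_ Fi] [_ Fk]]]; apply: (tF i k) => //; exists y.
  by apply/seteqP; split => [[x y] [Xx [k _ Fk]]|[x y] [k _ [Xx Fk]]];
    [exists k|split => //; exists k].
Qed.

Lemma ae_eq0_cells : {ae lebD R, forall x, f x = 0}.
Proof.
have gen := @measurable_prod_measurableType _ _ (measurableTypeR R) (measurableTypeR R).
have all0 (E : set (plane R)) : measurable E -> Z E.
  move=> mE; have := mE; rewrite [X in X _ -> _]gen.
  apply: (@dynkin_induction _ (plane R) _ Z) => //.
  - move=> _ _ [A mA [B mB <-]] [C mC [D mD <-]].
    exists (A `&` C); first exact: measurableI.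
    by exists (B `&` D); [exact: measurableI|rewrite setXI].
  - by rewrite -setXTT; exact: rectangle0.
  - by move=> _ [A mA [B mB <-]]; exact: rectangle0.
  - move=> S mS ZS; rewrite -setTD; apply: ZC => //.
    by rewrite -setXTT; exact: rectangle0.
have : ae_eq (lebD R) setT (EFin \o f) (cst 0%E).
  apply: integral_ae_eq => // E _ mE; rewrite integral0.
  transitivity ((\int[lebD R]_x (f x * \1_E x))%:E); last by rewrite [X in X%:E](all0 E mE).
  rewrite Rint_fin; last exact: int_ind.
  rewrite [LHS]integral_mkcond; apply: eq_integral => x _.
  by rewrite patchE indicE; case: ifP; rewrite ?mulr1 ?mulr0.
by move=> h; apply: (filterS _ h) => x /(_ I)[].
Qed.

End determined_by_cells.

(** * Compactness in L^1 of sets of bounded discrete variation *)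

Section compactness.
Context {R : realType}.
Local Notation L1 u := ((lebD R).-integrable setT (EFin \o u)).
Local Notation refines b := (forall j i l, (i < 2 ^ j)%N -> (l < 2 ^ j)%N ->
  b j i l = (b j.+1 i.*2 l.*2 + b j.+1 i.*2.+1 l.*2) +
            (b j.+1 i.*2 l.*2.+1 + b j.+1 i.*2.+1 l.*2.+1)).

Lemma double_ltn_pow2 j i : (i < 2 ^ j)%N ->
  (i.*2 < 2 ^ j.+1)%N /\ (i.*2.+1 < 2 ^ j.+1)%N.
Proof. by move=> h; rewrite expnS mul2n; split; lia. Qed.

Lemma ae_step_refine j (b : nat -> nat -> R) :
  {ae lebD R, forall x, step j b x = step j.+1 (fun i l => b i./2 l./2 / 4) x}.
Proof.
apply: filterS (ae_cell_refine j) => x h; rewrite /step expnS mul2n.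
rewrite (sum_double2 _ (fun i l => 4 ^+ j.+1 * (b i./2 l./2 / 4) * cell j.+1 i l x)).
apply: eq_bigr => i _; apply: eq_bigr => l _; rewrite h /= !uphalf_double !doubleK.
by rewrite exprS; field.
Qed.

Lemma step_refine_dist (b : nat -> nat -> nat -> R) (K : R) : refines b ->
  (forall j k, 2 ^+ j * dvar k j (b j) <= K) ->
  forall j, \int[lebD R]_x `|step j.+1 (b j.+1) x - step j (b j) x| <= 2 * K / 2 ^+ j.
Proof.
move=> rb hK j.
rewrite (@ae_Rint_eq _ _ _ _ _ (fun x => `|step j.+1 (fun i l => b j.+1 i l - b j i./2 l./2 / 4) x|)); first last.
- by apply: filterS (ae_step_refine j (b j)) => x ->; rewrite stepB.
- by apply: (@L1_measurable _ _ _ (lebD R)); apply: L1_norm; exact: L1_step.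
- by apply: L1_norm; apply: L1_B; exact: L1_step.
rewrite Rint_norm_step; apply: le_trans (refine_dist_le (rb j)) _.
have p0 := pow2_gt0 (R := R) j.
rewrite ler_pdivlMr//.
by have := hK j.+1 0; have := hK j.+1 1; rewrite exprS; lra.
Qed.

Lemma coef_dist (u v : plane R -> R) j i l : L1 u -> L1 v ->
  `|coef j u i l - coef j v i l| <= \int[lebD R]_x `|u x - v x|.
Proof.
move=> iu iv; rewrite -coef_funB//; apply: le_trans (Rint_le_norm (L1_cell j i l (L1_B iu iv))) _.
apply: le_Rintegral => //.
- exact: L1_norm (L1_cell j i l (L1_B iu iv)).
- exact: L1_norm (L1_B iu iv).
- by move=> x _; rewrite normrM ler_piMr// cell_norm.
Qed.

Lemma le_div_pow2_eq0 (x K : R) : (forall j, `|x| <= K / 2 ^+ j) -> x = 0.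
Proof.
move=> h; apply/eqP; rewrite -normr_le0.
have lim0 : (K / 2 ^+ j @[j --> \oo] --> (0 : R)).
  have -> : (fun j => K / 2 ^+ j) = geometric K 2^-1.
    by apply/funext => j; rewrite /geometric/= exprVn.
  by apply: cvg_geometric; rewrite ger0_norm ?invr_ge0// invf_lt1// ltr1n.
by apply: (cvgr_to_ge lim0); apply: nearW.
Qed.

(** Convergence of a martingale, with a rate: by the Poincare inequality, consecutive
    levels are at a distance of order [2 ^- j] when the variation is bounded. *)
Lemma coef_realization (b : nat -> nat -> nat -> R) (K : R) : refines b ->
  (forall j k, 2 ^+ j * dvar k j (b j) <= K) ->
  exists u, [/\ L1 u, {ae lebD R, forall x, step j (b j) x @[j --> \oo] --> u x},
    forall j, \int[lebD R]_x `|u x - step j (b j) x| <= 4 * K / 2 ^+ j &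
    forall j i l, (i < 2 ^ j)%N -> (l < 2 ^ j)%N -> coef j u i l = b j i l].
Proof.
move=> rb hK.
have [u [iu aeu hu]] := L1_fast_cvg (fun j => L1_step j (b j)) (step_refine_dist rb hK).
have hu' j : \int[lebD R]_x `|u x - step j (b j) x| <= 4 * K / 2 ^+ j.
  by rewrite (_ : 4 * K = 2 * (2 * K)) ?hu//; ring.
have cs k : forall j i l, (i < 2 ^ j)%N -> (l < 2 ^ j)%N ->
    coef j (step (j + k) (b (j + k)%N)) i l = b j i l.
  elim: k => [|k IH] j i l hi hl.
    by rewrite addn0; exact: (coef_step (b j) (Ordinal hi) (Ordinal hl)).
  have [i1 i2] := double_ltn_pow2 hi; have [l1 l2] := double_ltn_pow2 hl.
  rewrite coef_refine; last exact: L1_step.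
  by rewrite addnS -addSn !(IH j.+1)// -rb.
exists u; split => // j i l hi hl.
apply/eqP; rewrite -subr_eq0; apply/eqP; apply: (@le_div_pow2_eq0 _ (4 * K / 2 ^+ j)) => k.
rewrite -mulrA -invfM -exprD -(cs k j i l hi hl).
exact: le_trans (coef_dist _ _ _ iu (L1_step _ _)) (hu' _).
Qed.

(** The function realized by the coefficients of [u] has the same cell integrals as
    [u], hence is [u]. *)
Lemma step_coef_cvg (u : plane R -> R) (K : R) : L1 u ->
  (forall j k, 2 ^+ j * dvar k j (coef j u) <= K) ->
  {ae lebD R, forall x, step j (coef j u) x @[j --> \oo] --> u x} /\
  forall j, \int[lebD R]_x `|u x - step j (coef j u) x| <= 4 * K / 2 ^+ j.
Proof.
move=> iu hK.
have [v [iv aev hv cv]] := coef_realization (fun j i l _ _ => coef_refine j i l iu) hK.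
have uv : {ae lebD R, forall x, u x - v x = 0}.
  apply: ae_eq0_cells; first exact: L1_B.
  by move=> j i l; rewrite coef_funB// cv ?ltn_ord// subrr.
split.
  by apply: filterS2 uv aev => x /eqP; rewrite subr_eq0 => /eqP ->.
move=> j; rewrite (@ae_Rint_eq _ _ _ _ _ (fun x => `|v x - step j (coef j u) x|)) ?hv//.
- by apply: L1_norm; apply: L1_B => //; exact: L1_step.
- by apply: (@L1_measurable _ _ _ (lebD R)); apply: L1_norm; apply: L1_B => //; exact: L1_step.
by apply: filterS uv => x /eqP; rewrite subr_eq0 => /eqP ->.
Qed.

(** The embedding of BV into L^2, by Fatou from its discrete form. *)
Lemma sobolev_L2 (u : plane R -> R) (K : 'I_2 -> R) : L1 u ->
  (forall j k, 2 ^+ j * dvar k j (coef j u) <= K k) ->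
  (\int[lebD R]_x (u x ^+ 2)%:E <=
   ((\int[lebD R]_x `|u x| + K 0) * (\int[lebD R]_x `|u x| + K 1))%:E)%E.
Proof.
move=> iu hK.
have Kmax j k : 2 ^+ j * dvar k j (coef j u) <= K 0 + K 1.
  have K0 k' : 0 <= K k' by apply: le_trans (hK 0%N k'); rewrite mulr_ge0 ?exprn_ge0 ?dvar_ge0.
  apply: le_trans (hK j k) _; have [->|->] := ord2P k; [rewrite lerDl|rewrite lerDr]; exact: K0.
have [aeu _] := step_coef_cvg iu Kmax.
have msq (v : plane R -> R) : measurable_fun setT v -> measurable_fun setT (fun x => v x ^+ 2).
  by move=> mv; exact: measurable_funX.
apply: (@ae_fatou _ _ _ _ (fun j x => step j (coef j u) x ^+ 2)).
- by move=> j; apply: msq; exact: measurable_step.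
- by move=> j x; exact: sqr_ge0.
- by apply: msq; exact: L1_measurable iu.
- by move=> x; exact: sqr_ge0.
- by apply: filterS aeu => x hx; rewrite expr2; under eq_fun do rewrite expr2; exact: cvgM.
move=> j; have istep : L1 (fun x => step j (coef j u) x ^+ 2).
  have -> : (fun x => step j (coef j u) x ^+ 2) = (fun x => \sum_(i < (2 ^ j)%N) \sum_(l < (2 ^ j)%N)
      (4 ^+ j * coef j u i l) ^+ 2 * cell j i l x).
    by apply/funext => x; rewrite (step_map (F := fun t => t ^+ 2))// expr0n.
  by do 2 apply: L1_sum => ?; apply: L1_Z; exact: L1_cell1.
rewrite -(Rint_fin istep) lee_fin Rint_sqr_step.
apply: le_trans (discrete_sobolev _ _) _.
have S0 : 0 <= \sum_(i < (2 ^ j)%N) \sum_(l < (2 ^ j)%N) `|coef j u i l|.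
  by apply: sumr_ge0 => i _; apply: sumr_ge0.
by apply: ler_pM; rewrite ?addr_ge0// ?mulr_ge0 ?exprn_ge0 ?dvar_ge0//;
  apply: lerD => //; exact: sum_norm_coef_le.
Qed.

Lemma cvgn_sum (m : nat) (F : 'I_m -> nat -> R) (l : 'I_m -> R) :
  (forall i, F i n @[n --> \oo] --> l i) ->
  \sum_i F i n @[n --> \oo] --> \sum_i l i.
Proof.
elim: m F l => [|m IH] F l h.
  by under eq_fun do rewrite big_ord0; rewrite big_ord0; exact: cvg_cst.
under eq_fun do rewrite big_ord_recl.
by rewrite big_ord_recl; apply: cvgD => //; apply: IH => i.
Qed.

Lemma cvg_dvar k j (c : nat -> nat -> nat -> R) (b : nat -> nat -> R) :
  (forall i l, c n i l @[n --> \oo] --> b i l) ->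
  dvar k j (c n) @[n --> \oo] --> dvar k j b.
Proof.
move=> cb; rewrite /dvar; case: ifP => _;
  (apply: cvgn_sum => i; apply: cvgn_sum => l; apply: cvgMl_tmp; apply: cvg_norm;
   apply: cvgB; exact: cb).
Qed.

(** Rellich compactness. Along a diagonal subsequence all cell integrals converge, and
    the limits are consistent, hence realized by some [v]. At a fixed level finitely
    many coefficients are compared, and the distance from a function to its level [j]
    step function is uniformly of order [2 ^- j]. *)
Lemma dvar_compactness (u : nat -> plane R -> R) (M K : R) :
  (forall n, L1 (u n)) -> (forall n, \int[lebD R]_x `|u n x| <= M) ->
  (forall n j k, 2 ^+ j * dvar k j (coef j (u n)) <= K) ->
  exists (psi : nat -> nat) (v : plane R -> R),
    [/\ {homo psi : p q / (p < q)%N}, L1 v &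
      \int[lebD R]_x `|u (psi n) x - v x| @[n --> \oo] --> (0 : R)].
Proof.
move=> iu uM hK.
have [|psi hpsi cpsi] := @diagonal_extraction R (nat * (nat * nat))%type
    (fun n t => coef t.1 (u n) t.2.1 t.2.2).
  move=> [j [i l]]; exists M => n /=.
  have := coef_dist j i l (iu n) (L1_0 (lebD R)).
  rewrite (_ : coef j (fun=> 0) i l = 0); last first.
    by rewrite /coef; under eq_Rintegral do rewrite mul0r; rewrite /Rintegral integral0.
  rewrite subr0; under eq_Rintegral do rewrite subr0.
  by move/le_trans; apply.
pose b j i l := lim (coef j (u (psi n)) i l @[n --> \oo]).
have hb j i l : coef j (u (psi n)) i l @[n --> \oo] --> b j i l.
  exact: (cpsi (j, (i, l))).
have rb : refines b.
  move=> j i l _ _; apply: (cvg_unique _ (hb j i l)) => //=.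
  under eq_fun => n do rewrite coef_refine//.
  by apply: cvgD; apply: cvgD; exact: hb.
have bK j k : 2 ^+ j * dvar k j (b j) <= K.
  have cv : 2 ^+ j * dvar k j (coef j (u (psi n))) @[n --> \oo] --> 2 ^+ j * dvar k j (b j).
    by apply: cvgMl_tmp; apply: (@cvg_dvar _ _ (fun n => coef j (u (psi n)))); exact: hb.
  by apply: (cvgr_to_le cv); apply: nearW.
have [v [iv _ hv cv]] := coef_realization rb bK.
exists psi, v; split => //.
have K0 : 0 <= K by apply: le_trans (bK 0%N 0); rewrite mulr_ge0 ?exprn_ge0 ?dvar_ge0.
have key n j : \int[lebD R]_x `|u (psi n) x - v x| <= 8 * K / 2 ^+ j +
    \sum_(i < (2 ^ j)%N) \sum_(l < (2 ^ j)%N) `|coef j (u (psi n)) i l - b j i l|.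
  have [_ /(_ j) h1] := step_coef_cvg (iu (psi n)) (hK (psi n)).
  have h3 := hv j.
  have is1 := L1_step j (coef j (u (psi n))).
  have is2 := L1_step j (b j).
  apply: le_trans (Rint_tri (iu _) is1 iv) _.
  have := Rint_tri is1 is2 iv.
  rewrite [X in _ <= X + _](_ : _ =
    \sum_(i < (2 ^ j)%N) \sum_(l < (2 ^ j)%N) `|coef j (u (psi n)) i l - b j i l|); last first.
    by under eq_Rintegral do rewrite stepB; rewrite Rint_norm_step.
  have -> : \int[lebD R]_x `|step j (b j) x - v x| = \int[lebD R]_x `|v x - step j (b j) x|.
    by apply: eq_Rintegral => x _; rewrite distrC.
  have -> : 8 * K / 2 ^+ j = 4 * K / 2 ^+ j + 4 * K / 2 ^+ j by field; rewrite gt_eqF// pow2_gt0.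
  lra.
apply/cvgrPdist_lt => e e0.
have [j hj] : exists j : nat, 8 * K / 2 ^+ j < e / 2.
  have [j _ hj] : \forall j \near \oo, (8 * K) / (e / 2) < j%:R by exact: nbhs_infty_gtr.
  exists j; rewrite ltr_pdivrMr ?pow2_gt0// -ltr_pdivrMl ?divr_gt0// [X in X < _]mulrC.
  by apply: lt_le_trans (hj j (leqnn j)) _; rewrite -natrX ler_nat ltnW// ltn_expl.
have cs : \sum_(i < (2 ^ j)%N) \sum_(l < (2 ^ j)%N) `|coef j (u (psi n)) i l - b j i l|
    @[n --> \oo] --> (0 : R).
  rewrite [X in _ --> X](_ : _ = \sum_(i < (2 ^ j)%N) \sum_(l < (2 ^ j)%N) (0 : R)); last first.
    by rewrite big1// => i _; rewrite big1.
  apply: cvgn_sum => i; apply: cvgn_sum => l.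
  rewrite -(normr0 R) -(subrr (b j i l)); apply: cvg_norm.
  by apply: cvgB; [exact: hb|exact: cvg_cst].
near=> n; rewrite sub0r normrN ger0_norm; last by apply: Rintegral_ge0.
apply: le_lt_trans (key n j) _; rewrite (splitr e); apply: ltrD => //.
by near: n; apply: (cvgr_lt _ cs); rewrite divr_gt0.
Unshelve. all: by end_near.
Qed.

End compactness.

(** * Derivative charges bound the discrete variation *)

Section charge_facts.
Context {R : realType}.
Implicit Types (nu : {charge set (plane R) -> \bar R}).

Definition mass nu : R := fine (charge_variation (hahnP nu) (@unit_square R)).

Lemma massE nu : (mass nu)%:E = charge_variation (hahnP nu) (@unit_square R).
Proof.
rewrite /mass fineK// /charge_variation fin_numD !fin_num_measure//;
  exact: measurable_unit_square.
Qed.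

Lemma mass_ge0 nu : 0 <= mass nu.
Proof. by rewrite -lee_fin massE adde_ge0. Qed.

Lemma finite_measure_integrable d (T : measurableType d) (mu : {measure set T -> \bar R})
    (A : set T) (f : T -> R) (C : R) : measurable A -> (mu A < +oo)%E ->
  measurable_fun A f -> (forall x, A x -> `|f x| <= C) -> mu.-integrable A (EFin \o f).
Proof.
move=> mA muA mf fC; apply: measurable_bounded_integrable => //.
by exists C; split; [exact: num_real|move=> y Cy x Ax; exact: le_trans (fC x Ax) (ltW Cy)].
Qed.

Lemma Rint_bound d (T : measurableType d) (mu : {measure set T -> \bar R})
    (A : set T) (f : T -> R) (C : R) : measurable A -> (mu A < +oo)%E ->
  measurable_fun A f -> (forall x, A x -> `|f x| <= C) ->
  `|\int[mu]_(x in A) f x| <= C * fine (mu A).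
Proof.
move=> mA muA mf fC; have iF := finite_measure_integrable mA muA mf fC.
apply: le_trans (le_normr_Rintegral mA iF) _.
rewrite -Rintegral_cst//; apply: le_Rintegral => //.
  exact: integrable_norm.
by apply: (finite_measure_integrable (C := `|C|)) => //; exact: measurable_cst.
Qed.

Lemma charge_integral_le nu (f : plane R -> R) : measurable_fun (@unit_square R) f ->
  (forall x, unit_square x -> `|f x| <= 1) ->
  `|charge_integral nu (@unit_square R) f| <= mass nu.
Proof.
move=> mf f1; have mD := @measurable_unit_square R.
have fin (m : {finite_measure set (plane R) -> \bar R}) : (m (@unit_square R) < +oo)%E.
  by rewrite ltey_eq fin_num_measure.
rewrite /charge_integral /mass /charge_variation fineD ?fin_num_measure//.
apply: le_trans (ler_normB _ _) _; rewrite -[leRHS]mul1r mulrDr.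
by apply: lerD; apply: Rint_bound => //; exact: fin.
Qed.

End charge_facts.

Lemma within_continuous_measurable (R : realType) (A : set (plane R)) (f : R * R -> R) :
  measurable A -> {within (A : set (R * R)), continuous f} -> measurable_fun A (f : plane R -> R).
Proof.
move=> mA /continuousP cf; apply: (measurability _ (RGenOInfty.measurableE R)) => //.
move=> _ [_ [a ->] <-].
have oa : open (`]a, +oo[%classic : set R) by exact: interval_open.
have [U oU UA] := (open_subspaceP _ _).1 (cf _ oa).
have -> : A `&` f @^-1` `]a, +oo[%classic = U `&` A by rewrite UA setIC.
by apply: measurableI => //; exact: open_measurable_plane.
Qed.

Lemma continuous_measurable_plane (R : realType) (A : set (plane R)) (f : R * R -> R) :
  measurable A -> continuous f -> measurable_fun A (f : plane R -> R).
Proof. by move=> mA cf; apply: within_continuous_measurable => //; exact: continuous_subspaceT. Qed.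

Section signs.
Context {R : realType}.

Lemma sum_by_parts (s b : nat -> R) (n : nat) :
  \sum_(i < n.+1) (s i - s i.+1) * b i =
  s 0%N * b 0%N - s n.+1 * b n + \sum_(i < n) s i.+1 * (b i.+1 - b i).
Proof.
elim: n => [|n IH]; first by rewrite big_ord_recr !big_ord0/=; ring.
by rewrite big_ord_recr/= IH [in RHS]big_ord_recr/=; ring.
Qed.

(** The variation in dual form: summation by parts against the signs of the
    differences. The partial sums of [c] are, up to sign, those signs. *)
Lemma sign_dual (N : nat) (b : nat -> R) : exists c : nat -> R,
  [/\ forall m, (m <= N)%N -> `|\sum_(i < m) c i| <= 1, \sum_(i < N) c i = 0 &
    \sum_(i < N) c i * b i = \sum_(i < N) (i.+1 < N)%N%:R * `|b i.+1 - b i|].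
Proof.
pose s i : R := if (0 < i < N)%N then Num.sg (b i - b i.-1) else 0.
have sN : s N = 0 by rewrite /s ltnn andbF.
have sum m : \sum_(i < m) (s i - s i.+1) = - s m.
  elim: m => [|m IH]; first by rewrite big_ord0 /s/= oppr0.
  by rewrite big_ord_recr/= IH; ring.
exists (fun i => s i - s i.+1); split.
- move=> m _; rewrite sum normrN /s; case: ifP => _; last by rewrite normr0.
  by rewrite normr_sg; case: (_ != _).
- by rewrite sum sN oppr0.
have s0 : s 0%N = 0 by [].
have sS i : (i.+1 < N)%N -> s i.+1 * (b i.+1 - b i) = `|b i.+1 - b i|.
  by move=> iN; rewrite /s/= iN -normrEsg.
case: N s sN sum s0 sS => [|n] s sN sum s0 sS; first by rewrite !big_ord0.
rewrite sum_by_parts sN s0 !mul0r subrr add0r.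
rewrite (sum_guard n (fun i => `|b i.+1 - b i|)); apply: eq_bigr => i _.
by apply: sS; rewrite ltnS.
Qed.

End signs.

Section derivative_charge_bound.
Context {R : realType}.
Local Notation L1 u := ((lebD R).-integrable setT (EFin \o u)).

Lemma L1D_L1 (u : L1D R) : L1 u.
Proof. by apply/Lfun1_integrable; exact: LfunP. Qed.

Lemma test_function_bound (k : 'I_2) (u : L1D R) nu (phi : R * R -> R) :
  is_derivative_charge k u nu -> test_function (@unit_square R)° phi ->
  (forall x, `|phi x| <= 1) ->
  `|\int[lebD R]_x (u x * partial k phi x)| <= mass nu.
Proof.
move=> [_ hnu] tphi phi1; rewrite hnu// normrN; apply: charge_integral_le => //.
apply: continuous_measurable_plane; first exact: measurable_unit_square.
by have [/(_ [::])[]] := tphi.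
Qed.

(** Testing the derivative against smooth tents, whose derivatives converge
    boundedly to combinations of indicators of cells. *)
Lemma tent_bound (k : 'I_2) (u : L1D R) nu (j : nat) (c : nat -> nat -> R) :
  is_derivative_charge k u nu ->
  (if k == 0 then forall l, (l < 2 ^ j)%N ->
     (forall m, (m <= 2 ^ j)%N -> `|\sum_(i < m) c i l| <= 1) /\ \sum_(i < (2 ^ j)%N) c i l = 0
   else forall i, (i < 2 ^ j)%N ->
     (forall m, (m <= 2 ^ j)%N -> `|\sum_(l < m) c i l| <= 1) /\ \sum_(l < (2 ^ j)%N) c i l = 0) ->
  2 ^+ j * (\sum_(i < (2 ^ j)%N) \sum_(l < (2 ^ j)%N) c i l * coef j u i l) <= mass nu.
Proof.
move=> hnu hc; set N := (2 ^ j)%N in hc *.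
have [chi [H [delta [theta [sm chi01 chi0 chicv Hp]]]]] := @cutoff_exists R.
have iu := L1D_L1 u.
have p0 := pow2_gt0 (R := R) j.
have pN : 2 ^+ j = N%:R :> R by rewrite /N natrX.
(* The primitive is used in the direction of derivation, the bump in the other. *)
pose F n := if k == 0 then H n else chi n.
pose G n := if k == 0 then chi n else H n.
pose phi n (x : R * R) := \sum_(i < N) \sum_(l < N) c i l * (F n (2 ^+ j * x.1 - i%:R) * G n (2 ^+ j * x.2 - l%:R)).
pose dphi n (x : R * R) := \sum_(i < N) \sum_(l < N) c i l * (2 ^+ j * (chi n (2 ^+ j * x.1 - i%:R) * chi n (2 ^+ j * x.2 - l%:R))).
have sF n : smooth1 (F n) by rewrite /F; case: ifP => _; have [] := sm n.
have sG n : smooth1 (G n) by rewrite /G; case: ifP => _; have [] := sm n.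
have s2 n : smooth2 (phi n).
  apply: smooth2_sum => i; apply: smooth2_sum => l.
  rewrite (_ : (fun _ => _) = fun x : R * R => (fun y => cst (c i l) y * F n (2 ^+ j * y + - i%:R)) x.1 *
      (fun y => G n (2 ^+ j * y + - l%:R)) x.2).
    apply: (@smooth2_tens _ (fun y => cst (c i l) y * F n (2 ^+ j * y + - i%:R))
      (fun y => G n (2 ^+ j * y + - l%:R))); last exact: smooth1_aff.
    apply: (@smooth1_M _ _ (fun y => F n (2 ^+ j * y + - i%:R))); first exact: smooth1_cst.
    exact: smooth1_aff.
  by apply/funext => x /=; rewrite mulrA.
have affd (f : R -> R) f' (y : R) (m : nat) : (forall t : R, is_derive t (1:R) f (f' t)) ->
    is_derive y (1 : R) (fun y => f (2 ^+ j * y - m%:R)) (f' (2 ^+ j * y - m%:R) * 2 ^+ j).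
  move=> df; apply: (is_derive1_comp (f := f) (g := fun y => 2 ^+ j * y + - m%:R)) => //.
  exact: is_derive_aff.
have dph n (x : R * R) : is_derive x (basis2 R k) (phi n) (dphi n x).
  apply: is_derive_bigsum => i; apply: is_derive_bigsum => l.
  have dH : forall t : R, is_derive t (1:R) (H n) (chi n t) by have [] := Hp n.
  apply: (@is_deriveZ R (R * R)%type R).
  have [k0|k1] := ord2P k.
    rewrite /F /G k0 /=.
    have := @is_derive_tens0 R (fun y => H n (2 ^+ j * y - i%:R)) (fun y => chi n (2 ^+ j * y - l%:R)) _ x (affd _ _ x.1 i dH).
    by move=> D; apply: is_derive_eq D _; ring.
  rewrite /F /G k1 /=.
  have := @is_derive_tens1 R (fun y => chi n (2 ^+ j * y - i%:R)) (fun y => H n (2 ^+ j * y - l%:R)) _ x (affd _ _ x.2 l dH).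
  by move=> D; apply: is_derive_eq D _; ring.
have phiE n x : phi n x = if k == 0 then
    \sum_(l < N) (\sum_(i < N) c i l * H n (2 ^+ j * x.1 - i%:R)) * chi n (2 ^+ j * x.2 - l%:R)
  else \sum_(i < N) (\sum_(l < N) c i l * H n (2 ^+ j * x.2 - l%:R)) * chi n (2 ^+ j * x.1 - i%:R).
  rewrite /phi /F /G; case: ifP => _.
    rewrite exchange_big/=; apply: eq_bigr => l _; rewrite mulr_suml.
    by apply: eq_bigr => i _; rewrite mulrA.
  apply: eq_bigr => i _; rewrite mulr_suml; apply: eq_bigr => l _; ring.
have phi1 n x : `|phi n x| <= 1.
  have [delta0 c0] := chi0 n; have [_ H0 H1 Hb th1] := Hp n.
  rewrite phiE; case: ifP hc => _ hc.
    apply: (@sum_chi_le _ _ _ (chi01 n) delta0 c0 N (fun l => \sum_(i < N) c i l * H n (2 ^+ j * x.1 - i%:R))) => l lN.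
    by apply: (@sum_primitive_le _ _ _ _ delta0 H0 H1 Hb th1 N (fun i => c i l)); have [] := hc l lN.
  apply: (@sum_chi_le _ _ _ (chi01 n) delta0 c0 N (fun i => \sum_(l < N) c i l * H n (2 ^+ j * x.2 - l%:R))) => i iN.
  by apply: (@sum_primitive_le _ _ _ _ delta0 H0 H1 Hb th1 N (fun l => c i l)); have [] := hc i iN.
have test n : test_function (@unit_square R)° (phi n).
  split; first exact: smooth2_smooth.
  have [delta0 c0] := chi0 n; have [_ H0 H1 Hb th1] := Hp n.
  pose J := `[delta n / N%:R, (N%:R - delta n) / N%:R]%classic : set R.
  exists (J `*` J); split.
  - by apply: compact_setX; exact: segment_compact.
  - rewrite interior_unit_square => -[x y] /=; rewrite /J/= !in_itv/= -pN => -[].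
    have key (t : R) : delta n / 2 ^+ j <= t <= (2 ^+ j - delta n) / 2 ^+ j -> 0 < t < 1.
      move=> /andP[a b]; apply/andP; split; first by apply: lt_le_trans a; rewrite divr_gt0.
      by apply: le_lt_trans b _; rewrite ltr_pdivrMr// mul1r gtrBl.
    by move=> /key -> /key ->.
  move=> x; have JE (t : R) : J t <-> (delta n <= 2 ^+ j * t <= N%:R - delta n).
    by rewrite /J/= in_itv/= -pN ler_pdivrMr// ler_pdivlMr// [t * _]mulrC.
  move=> nJ.
  have nJ' : ~~ (delta n <= 2 ^+ j * x.1 <= N%:R - delta n) \/ ~~ (delta n <= 2 ^+ j * x.2 <= N%:R - delta n).
    apply/orP; rewrite -negb_and; apply/negP => /andP[a b].
    by apply: nJ; split; apply/JE.
  rewrite phiE; case: ifP hc => _ hc; case: nJ' => nJ'.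
  - apply: big1 => l _; rewrite (@sum_primitive_eq0 _ _ _ _ delta0 H0 H1 N (fun i => c i l)) ?mul0r//.
    by have [] := hc l (ltn_ord l).
  - exact: (@sum_chi_eq0 _ _ _ delta0 c0 N (fun l => \sum_(i < N) c i l * H n (2 ^+ j * x.1 - i%:R))).
  - exact: (@sum_chi_eq0 _ _ _ delta0 c0 N (fun i => \sum_(l < N) c i l * H n (2 ^+ j * x.2 - l%:R))).
  - apply: big1 => i _; rewrite (@sum_primitive_eq0 _ _ _ _ delta0 H0 H1 N (fun l => c i l)) ?mul0r//.
    by have [] := hc i (ltn_ord i).
have bound n : `|\int[lebD R]_x (u x * dphi n x)| <= mass nu.
  have := test_function_bound hnu (test n) (phi1 n).
  suff -> : partial k (phi n) = dphi n by [].
  by apply/funext => x; exact: derive_val.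
have chi1 n y : `|chi n y| <= 1 by have /andP[a b] := chi01 n y; rewrite ger0_norm.
pose lim_phi (x : plane R) := \sum_(i < N) \sum_(l < N) c i l * (2 ^+ j * cell j i l x).
have cv : \int[lebD R]_x (u x * dphi n x) @[n --> \oo] --> \int[lebD R]_x (u x * lim_phi x).
  apply: (Rint_dominated (C := \sum_(i < N) \sum_(l < N) `|c i l| * 2 ^+ j)) => //.
  - move=> n; apply: continuous_measurable_plane => //.
    have [d sd dd] := smooth2_ex k (s2 n).
    suff -> : dphi n = d by exact: smooth2_continuous.
    apply/funext => x; have := derive_val (is_derive := dph n x).
    by rewrite (derive_val (is_derive := dd x)).
  - move=> n x; apply: le_trans (ler_norm_sum _ _ _) _; apply: ler_sum => i _.
    apply: le_trans (ler_norm_sum _ _ _) _; apply: ler_sum => l _.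
    rewrite !normrM ler_wpM2l// (ger0_norm (ltW p0)) -[leRHS]mulr1 ler_wpM2l ?(ltW p0)//.
    by rewrite mulr_ile1// chi1.
  - move=> x; apply: cvgn_sum => i; apply: cvgn_sum => l; apply: cvgMl_tmp.
    by apply: cvgMl_tmp; apply: cvgM; exact: chicv.
have -> : 2 ^+ j * (\sum_(i < N) \sum_(l < N) c i l * coef j u i l) = \int[lebD R]_x (u x * lim_phi x).
  under [RHS]eq_Rintegral => x _.
    rewrite (_ : u x * _ = \sum_(i < N) \sum_(l < N) (c i l * 2 ^+ j) * (u x * cell j i l x)); first over.
    rewrite mulr_sumr; apply: eq_bigr => i _; rewrite mulr_sumr; apply: eq_bigr => l _; ring.
  rewrite Rint_sum; last by move=> i; apply: L1_sum => l; apply: L1_Z; exact: L1_cell.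
  rewrite mulr_sumr; apply: eq_bigr => i _.
  rewrite Rint_sum; last by move=> l; apply: L1_Z; exact: L1_cell.
  rewrite mulr_sumr; apply: eq_bigr => l _.
  by rewrite RintegralZl//; [rewrite mulrCA mulrA|exact: L1_cell].
apply: le_trans (ler_norm _) _; apply: (cvgr_to_le (cvg_norm cv)); exact: nearW.
Qed.

(** Testing with the coefficients that are dual to the variation of each row, or of
    each column. *)
Lemma dvar_le_mass (k : 'I_2) (u : L1D R) nu (j : nat) :
  is_derivative_charge k u nu -> 2 ^+ j * dvar k j (coef j u) <= mass nu.
Proof.
move=> hnu; set b := coef j u; rewrite /dvar; case: ifPn => k0.
  pose c i l := sval (cid (sign_dual (2 ^ j) (fun i => b i l))) i.
  have hc l := svalP (cid (sign_dual (2 ^ j) (fun i => b i l))).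
  rewrite [X in _ * X](_ : _ = \sum_(i < (2 ^ j)%N) \sum_(l < (2 ^ j)%N) c i l * b i l).
    by apply: tent_bound hnu _; rewrite k0 => l _; have [] := hc l.
  rewrite exchange_big/= [RHS]exchange_big/=; apply: eq_bigr => l _.
  by have [_ _ <-] := hc l.
pose c i l := sval (cid (sign_dual (2 ^ j) (b i))) l.
have hc i := svalP (cid (sign_dual (2 ^ j) (b i))).
rewrite [X in _ * X](_ : _ = \sum_(i < (2 ^ j)%N) \sum_(l < (2 ^ j)%N) c i l * b i l).
  by apply: tent_bound hnu _; rewrite (negPf k0) => i _; have [] := hc i.
by apply: eq_bigr => i _; have [_ _ <-] := hc i.
Qed.

End derivative_charge_bound.

(** * Pairs of measures representing a derivative *)

Section measure_operations.
Context d (T : measurableType d) (R : realType).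
Implicit Types (m : {measure set T -> \bar R}) (A I : set T) (f : T -> R).

Lemma finite_sub m A : measurable A -> (m setT < +oo)%E -> (m A < +oo)%E.
Proof. by move=> mA; apply: le_lt_trans; apply: le_measure; rewrite ?inE. Qed.

Lemma mrestrE m I (mI : measurable I) A : mrestr m mI A = m (A `&` I).
Proof. by []. Qed.

Lemma mscaleE m (c : {nonneg R}) A : mscale c m A = (c%:num%:E * m A)%E.
Proof. by []. Qed.

Lemma mscale_finite m (c : {nonneg R}) : (m setT < +oo)%E -> (mscale c m setT < +oo)%E.
Proof.
move=> fm; rewrite mscaleE -ge0_fin_numE; last by rewrite mule_ge0.
by rewrite fin_numM// ge0_fin_numE.
Qed.

Lemma mrestr_finite m I (mI : measurable I) : (m setT < +oo)%E -> (mrestr m mI setT < +oo)%E.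
Proof. by move=> fm; rewrite mrestrE setTI; exact: finite_sub. Qed.

Lemma add_measureE m1 m2 A : measure_add m1 m2 A = (m1 A + m2 A)%E.
Proof. exact: measure_addE. Qed.

Lemma add_measure_finite m1 m2 : (m1 setT < +oo)%E -> (m2 setT < +oo)%E ->
  (measure_add m1 m2 setT < +oo)%E.
Proof. by move=> f1 f2; rewrite add_measureE lte_add_pinfty. Qed.

Lemma fine_add_measure m1 m2 A : (m1 setT < +oo)%E -> (m2 setT < +oo)%E -> measurable A ->
  fine (measure_add m1 m2 A) = fine (m1 A) + fine (m2 A).
Proof.
by move=> f1 f2 mA; rewrite add_measureE fineD// ge0_fin_numE//; exact: finite_sub.
Qed.

Lemma Rint_measure_add m1 m2 A f (C : R) : measurable A ->
  (m1 setT < +oo)%E -> (m2 setT < +oo)%E -> measurable_fun A f ->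
  (forall x, A x -> `|f x| <= C) ->
  \int[measure_add m1 m2]_(x in A) f x = \int[m1]_(x in A) f x + \int[m2]_(x in A) f x.
Proof.
move=> mA f1 f2 mf fC.
have i1 := finite_measure_integrable mA (finite_sub mA f1) mf fC.
have i2 := finite_measure_integrable mA (finite_sub mA f2) mf fC.
by rewrite /Rintegral integral_measure_add// fineD//; exact: integrable_fin_num.
Qed.

(** Equality of the signed measures [p - q] and [n - m], stated without subtraction of
    extended reals. *)
Lemma Rint_balance (p m n q : {measure set T -> \bar R}) A f (C : R) : measurable A ->
  (p setT < +oo)%E -> (m setT < +oo)%E -> (n setT < +oo)%E -> (q setT < +oo)%E ->
  measurable_fun A f -> (forall x, A x -> `|f x| <= C) ->
  (forall B, measurable B -> (p B + m B = n B + q B)%E) ->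
  \int[p]_(x in A) f x + \int[m]_(x in A) f x =
  \int[n]_(x in A) f x + \int[q]_(x in A) f x.
Proof.
move=> mA fp fm fn fq mf fC e.
rewrite -!(Rint_measure_add (C := C))//.
apply: Rint_eq_measure => B mB _.
exact: etrans (add_measureE p m B) (etrans (e B mB) (esym (add_measureE n q B))).
Qed.

Lemma Rint_mrestr_fin m A I (mI : measurable I) f (C : R) : measurable A ->
  (m (A `&` I) < +oo)%E -> measurable_fun A f -> (forall x, A x -> `|f x| <= C) ->
  \int[mrestr m mI]_(x in A) f x = \int[m]_(x in A `&` I) f x.
Proof.
move=> mA fm mf fC; have mAI : measurable (A `&` I) by exact: measurableI.
rewrite /Rintegral; congr fine.
rewrite (@negligible_integral _ _ _ _ A (A `\` I)) => //; first last.
- by rewrite [LHS]mrestrE setDE -setIA setICl setI0 measure0.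
- exact: (finite_measure_integrable (C := C)).
- exact: measurableD.
rewrite setDD; apply: eq_measure_integral => B mB BAI.
by rewrite [LHS]mrestrE setIidl// => x /BAI[].
Qed.

Lemma Rint_mrestr m A I (mI : measurable I) f (C : R) : measurable A ->
  (m setT < +oo)%E -> measurable_fun A f -> (forall x, A x -> `|f x| <= C) ->
  \int[mrestr m mI]_(x in A) f x = \int[m]_(x in A `&` I) f x.
Proof.
move=> mA fm; apply: Rint_mrestr_fin => //.
by apply: finite_sub => //; exact: measurableI.
Qed.

Lemma Rint_mscale m (c : {nonneg R}) A f (C : R) : measurable A ->
  (m setT < +oo)%E -> measurable_fun A f -> (forall x, A x -> `|f x| <= C) ->
  \int[mscale c m]_(x in A) f x = c%:num * \int[m]_(x in A) f x.
Proof.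
move=> mA fm mf fC.
have fm' := mscale_finite c fm.
have key (n : {measure set T -> \bar R}) : (n setT < +oo)%E ->
    \int[n]_(x in A) f x = \int[n]_(x in A) (f x + C) - C * fine (n A).
  move=> fn; rewrite RintegralD//; first by rewrite Rintegral_cst// addrK.
    exact: (finite_measure_integrable mA (finite_sub mA fn) mf fC).
  by apply: (finite_measure_integrable (C := `|C|)) => //; exact: finite_sub.
rewrite key// (key m)// mulrBr.
have -> : \int[mscale c m]_(x in A) (f x + C) = c%:num * \int[m]_(x in A) (f x + C).
  rewrite /Rintegral ge0_integral_mscale//.
  - rewrite fineM//; apply: integrable_fin_num => //.
    apply: (finite_measure_integrable (C := C + C)) => //; first exact: finite_sub.
      exact: measurable_funD.
    move=> x Ax; apply: le_trans (ler_normD _ _) _; apply: lerD; first exact: fC.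
    by rewrite ger0_norm// (le_trans _ (fC x Ax)).
  - by apply/measurable_EFinP; exact: measurable_funD.
  - by move=> x Ax; rewrite lee_fin -lerBlDr sub0r; have := fC x Ax; rewrite ler_norml => /andP[].
rewrite [X in fine X]mscaleE fineM//; last first.
  by rewrite ge0_fin_numE//; exact: finite_sub.
by rewrite mulrCA.
Qed.

End measure_operations.

Section has_variation.
Context {R : realType}.
Local Notation L1 u := ((lebD R).-integrable setT (EFin \o u)).
Local Notation D := (@unit_square R).

(** Pairs of positive measures whose difference is the derivative. Unlike Jordan
    decompositions, such pairs can be added, rescaled and passed to the limit. *)
Definition represents_derivative (k : 'I_2) (u : plane R -> R)
    (m1 m2 : {measure set (plane R) -> \bar R}) : Prop :=
  forall phi, test_function D° phi ->
    \int[lebD R]_x (u x * partial k phi x) =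
    - (\int[m1]_(x in D) phi x - \int[m2]_(x in D) phi x).

Definition has_variation (k : 'I_2) (u : plane R -> R) (M : R) : Prop :=
  exists m1 m2 : {measure set (plane R) -> \bar R},
    [/\ (m1 setT < +oo)%E, (m2 setT < +oo)%E, represents_derivative k u m1 m2 &
      fine (m1 D) + fine (m2 D) <= M].

Let mD : measurable (D : set (plane R)) := @measurable_unit_square R.

Lemma compact_unit_square : compact D.
Proof. by apply: compact_setX; exact: segment_compact. Qed.

Lemma within_continuous_bounded (f : R * R -> R) : {within D, continuous f} ->
  exists C, forall x, D x -> `|f x| <= C.
Proof.
move=> cf; have := continuous_compact cf compact_unit_square.
move/compact_bounded => [M [_ hM]]; exists (M + 1) => x Dx.
by apply: (hM (M + 1)); [rewrite ltrDl|exists x].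
Qed.

Lemma test_function_facts (phi : R * R -> R) : test_function D° phi ->
  [/\ measurable_fun D (phi : plane R -> R), exists C, forall x, D x -> `|phi x| <= C &
    forall x, ~ D° x -> phi x = 0].
Proof.
move=> [sphi [K [cK KD vK]]].
have cphi : continuous phi by have [] := sphi [::].
split.
- exact: continuous_measurable_plane.
- by apply: within_continuous_bounded; exact: continuous_subspaceT.
- by move=> x nDx; apply: vK => /KD.
Qed.

Lemma test_function_partial (k : 'I_2) (phi : R * R -> R) : smooth phi ->
  [/\ continuous (partial k phi), measurable_fun setT (partial k phi : plane R -> R) &
    exists C, forall x, D x -> `|partial k phi x| <= C].
Proof.
move=> sphi; have cphi : continuous (partial k phi) by have [] := sphi [:: k].
split => //; first exact: continuous_measurable_plane.
by apply: within_continuous_bounded; exact: continuous_subspaceT.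
Qed.

Lemma ae_lebD_square : {ae lebD R, forall x, D x}.
Proof. by apply: filterS (ae_off_grid 0) => x []. Qed.

Lemma L1_partial (k : 'I_2) (u : plane R -> R) (phi : R * R -> R) : L1 u -> smooth phi ->
  L1 (fun x => u x * partial k phi x).
Proof.
move=> iu sphi; have [cp mp [C hC]] := test_function_partial k sphi.
have i1 : L1 (fun x => u x * (partial k phi x * \1_D x)).
  apply: (L1_mulr (C := `|C|)) => // [|x].
    by apply: measurable_funM => //; exact: measurable_indic.
  rewrite indicE; case: (boolP (x \in D)) => [/set_mem Dx|_]; last by rewrite mulr0 normr0.
  by rewrite mulr1 (le_trans (hC x Dx))// ler_norm.
have m2 : measurable_fun setT (fun x => u x * partial k phi x).
  by apply: measurable_funM => //; exact: L1_measurable iu.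
apply/integrableP; split; first exact/measurable_EFinP.
move/integrableP : i1 => [mi]; apply: le_lt_trans.
rewrite le_eqVlt; apply/orP; left; apply/eqP.
apply: ge0_ae_eq_integral => //.
- by apply: measurableT_comp => //; exact/measurable_EFinP.
- exact: measurableT_comp.
- apply: filterS ae_lebD_square => x Dx _ /=.
  by rewrite indicE mem_set// mulr1.
Qed.

Lemma has_variationD k (u v : plane R -> R) (M N : R) : L1 u -> L1 v ->
  has_variation k u M -> has_variation k v N ->
  has_variation k (fun x => u x + v x) (M + N).
Proof.
move=> iu iv [m1 [m2 [f1 f2 hm hM]]] [n1 [n2 [g1 g2 hn hN]]].
exists (measure_add m1 n1), (measure_add m2 n2); split.
- exact: add_measure_finite.
- exact: add_measure_finite.
- move=> phi tphi; have [mphi [C hC] _] := test_function_facts tphi.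
  rewrite !(Rint_measure_add (C := C))//.
  under eq_Rintegral do rewrite mulrDl.
  rewrite RintegralD//; last 2 first.
  + by apply: L1_partial => //; have [] := tphi.
  + by apply: L1_partial => //; have [] := tphi.
  by rewrite hm// hn//; ring.
have -> := fine_add_measure f1 g1 mD.
have -> := fine_add_measure f2 g2 mD.
by lra.
Qed.

Lemma has_variationZ k (u : plane R -> R) (M c : R) : L1 u ->
  has_variation k u M -> has_variation k (fun x => c * u x) (`|c| * M).
Proof.
move=> iu [m1 [m2 [f1 f2 hm hM]]].
have c0 : 0 <= `|c| by [].
pose a := NngNum c0.
have fE (m : {measure set (plane R) -> \bar R}) : (m setT < +oo)%E ->
    fine (mscale a m D) = `|c| * fine (m D).
  move=> fm; rewrite [X in fine X]mscaleE fineM// ge0_fin_numE//; exact: finite_sub.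
have le : `|c| * fine (m1 D) + `|c| * fine (m2 D) <= `|c| * M.
  by rewrite -mulrDr ler_wpM2l.
have Zi phi : test_function D° phi -> \int[lebD R]_x (c * u x * partial k phi x) =
    c * \int[lebD R]_x (u x * partial k phi x).
  move=> tphi; under eq_Rintegral do rewrite -mulrA.
  by rewrite RintegralZl//; apply: L1_partial => //; have [] := tphi.
have [cge|clt] := leP 0 c.
  exists (mscale a m1), (mscale a m2); split; [exact: mscale_finite|exact: mscale_finite| |by rewrite !fE].
  move=> phi tphi; have [mphi [C hC] _] := test_function_facts tphi.
  rewrite !(Rint_mscale _ (C := C))// Zi// hm//= ger0_norm//; ring.
exists (mscale a m2), (mscale a m1); split; [exact: mscale_finite|exact: mscale_finite| |by rewrite !fE// addrC].
move=> phi tphi; have [mphi [C hC] _] := test_function_facts tphi.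
rewrite !(Rint_mscale _ (C := C))// Zi// hm//= ltr0_norm//; ring.
Qed.

Lemma has_variation_ae k (u v : plane R -> R) (M : R) : L1 u -> L1 v ->
  {ae lebD R, forall x, u x = v x} -> has_variation k u M -> has_variation k v M.
Proof.
move=> iu iv uv [m1 [m2 [f1 f2 hm hM]]]; exists m1, m2; split => // phi tphi.
rewrite -hm//; have [sphi _] := tphi; apply: ae_Rint_eq.
- exact: L1_partial.
- exact: L1_measurable (L1_partial k iu sphi).
- by apply: filterS uv => x ->.
Qed.

Lemma has_variation_le k (u : plane R -> R) (M N : R) : M <= N ->
  has_variation k u M -> has_variation k u N.
Proof.
move=> MN [m1 [m2 [f1 f2 hm hM]]]; exists m1, m2; split => //.
exact: le_trans hM MN.
Qed.

Lemma has_variation_cst0 k : has_variation k (fun=> 0) 0.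
Proof.
have z A : (mzero : {measure set (plane R) -> \bar R}) A = 0%E by [].
exists mzero, mzero; split.
- by rewrite z ltry.
- by rewrite z ltry.
- by move=> phi _; rewrite subrr oppr0; under eq_Rintegral do rewrite mul0r;
    rewrite /Rintegral integral0.
- by rewrite z addr0.
Qed.

Lemma has_variation_sum k (n : nat) (F : 'I_n -> plane R -> R) (M : 'I_n -> R) :
  (forall i, L1 (F i)) -> (forall i, has_variation k (F i) (M i)) ->
  has_variation k (fun x => \sum_i F i x) (\sum_i M i).
Proof.
elim: n F M => [|n IH] F M iF hF.
  by under [X in has_variation _ X]eq_fun do rewrite big_ord0; rewrite big_ord0; exact: has_variation_cst0.
under [X in has_variation _ X]eq_fun do rewrite big_ord_recl.
rewrite big_ord_recl; apply: has_variationD => //; first exact: L1_sum.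
exact: IH.
Qed.

(** The two positive parts may charge the boundary of the square or overlap;
    restricting to the interior only decreases the total variation. *)
Lemma derivative_charge_of_measures k (u : L1D R) (m1 m2 : {measure set (plane R) -> \bar R}) :
  (m1 setT < +oo)%E -> (m2 setT < +oo)%E -> represents_derivative k u m1 m2 ->
  exists nu : {charge set (plane R) -> \bar R},
    [/\ is_derivative_charge k u nu,
     mass nu <= fine (m1 (D `&` D°)) + fine (m2 (D `&` D°)) &
     forall f : plane R -> R, measurable_fun D f -> (exists C, forall x, D x -> `|f x| <= C) ->
      charge_integral nu D f = \int[m1]_(x in D `&` D°) f x - \int[m2]_(x in D `&` D°) f x].
Proof.
move=> f1 f2 hm.
have mI : measurable (D° : set (plane R)).
  by rewrite interior_unit_square; apply: measurableX; exact: measurable_itv.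
have mDI : measurable (D `&` D° : set (plane R)) by exact: measurableI.
pose M1 : {finite_measure set (plane R) -> \bar R} := mfrestr mI (finite_sub mI f1).
pose M2 : {finite_measure set (plane R) -> \bar R} := mfrestr mI (finite_sub mI f2).
pose nu : {charge set (plane R) -> \bar R} := cadd (charge_of_finite_measure M1) (copp (charge_of_finite_measure M2)).
have nuE (A : set (plane R)) : nu A = (m1 (A `&` D°) - m2 (A `&` D°))%E by [].
have fin (m : {measure set (plane R) -> \bar R}) A : (m setT < +oo)%E -> measurable A -> m A \is a fin_num.
  by move=> fm mA; rewrite ge0_fin_numE//; exact: finite_sub.
have [[mP _] [mN _] PN PN0] := hahnP nu.
have jpE A : measurable A -> jordan_pos (hahnP nu) A = nu (A `&` hahn_pos nu).
  by move=> mA; rewrite jordan_posE cjordan_posE /crestr0 mem_set.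
have jnE A : measurable A -> jordan_neg (hahnP nu) A = (- nu (A `&` hahn_neg nu))%E.
  by move=> mA; rewrite jordan_negE cjordan_negE /crestr0 mem_set.
have int (f : plane R -> R) : measurable_fun D f -> (exists C, forall x, D x -> `|f x| <= C) ->
      charge_integral nu D f = \int[m1]_(x in D `&` D°) f x - \int[m2]_(x in D `&` D°) f x.
  move=> mf [C hC]; rewrite /charge_integral.
  set jp := jordan_pos _; set jn := jordan_neg _.
  have fp : (jp setT < +oo)%E by rewrite ltey_eq fin_num_measure.
  have fn : (jn setT < +oo)%E by rewrite ltey_eq fin_num_measure.
  have := Rint_balance mD fp (mrestr_finite mI f2) fn (mrestr_finite mI f1) mf hC.
  rewrite !(Rint_mrestr _ (C := C))//.
  move=> h; suff : forall B, measurable B -> (jp B + mrestr m2 mI B = jn B + mrestr m1 mI B)%E by move=> /h; lra.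
  move=> A mA; rewrite !mrestrE.
  have : (nu A = jp A - jn A)%E by rewrite (jordan_decomp (hahnP nu) mA) /cadd/= cscaleN1.
  rewrite nuE.
  have := fin m1 (A `&` D°) f1 (measurableI _ _ mA mI).
  have := fin m2 (A `&` D°) f2 (measurableI _ _ mA mI).
  have : jp A \is a fin_num by rewrite fin_num_measure.
  have : jn A \is a fin_num by rewrite fin_num_measure.
  case: (jn A) => // n _; case: (jp A) => // p _; case: (m2 _) => // y _; case: (m1 _) => // x _.
  rewrite -!EFinN -!EFinD => -[] e; congr EFin; lra.
exists nu; split => //; last first.
  rewrite /mass /charge_variation fineD ?fin_num_measure//.
  have le1 (m : {measure set (plane R) -> \bar R}) A B : (m setT < +oo)%E -> measurable A ->
      measurable B -> A `<=` B -> fine (m A) <= fine (m B).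
    by move=> fm mA mB AB; apply: fine_le; rewrite ?fin//; apply: le_measure; rewrite ?inE.
  have mDPI P : measurable P -> measurable (D `&` P `&` D° : set (plane R)).
    by move=> mP'; apply: measurableI => //; exact: measurableI.
  apply: lerD.
    rewrite jpE// nuE fineB ?fin//; try exact: mDPI.
    apply: (@le_trans _ _ (fine (m1 (D `&` hahn_pos nu `&` D°)))).
      by rewrite gerBl fine_ge0.
    by apply: le1 => //; [exact: mDPI|move=> x [[Dx _] Ix]].
  rewrite jnE// nuE oppeB ?fin_num_adde_defr ?fin//; try exact: mDPI.
  rewrite fineD ?fin_numN ?fin//; try exact: mDPI.
  apply: (@le_trans _ _ (fine (m2 (D `&` hahn_neg nu `&` D°)))).
    by rewrite fineN addrC gerBl fine_ge0.
  by apply: le1 => //; [exact: mDPI|move=> x [[Dx _] Ix]].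
split => [A mA|phi tphi]; first by rewrite !nuE -setIA setIid.
have [mphi bphi z] := test_function_facts tphi.
have eI (m : {measure set (plane R) -> \bar R}) : \int[m]_(x in D `&` D°) phi x = \int[m]_(x in D) phi x.
  rewrite Rintegral_mkcondr; apply: eq_Rintegral => x _.
  rewrite patchE; case: ifPn => // /negP xI.
  by rewrite z// => h; apply: xI; rewrite inE.
by rewrite hm// int// !eI.
Qed.

Lemma partial_variation_le_mass k (u : L1D R) nu : is_derivative_charge k u nu ->
  (partial_variation k u <= (mass nu)%:E)%E.
Proof. by move=> h; rewrite massE; apply: ereal_inf_lbound; exists nu. Qed.

Lemma has_variation_partial k (u : L1D R) (M : R) : has_variation k u M ->
  (partial_variation k u <= M%:E)%E.
Proof.
move=> [m1 [m2 [f1 f2 hm hM]]].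
have [nu [dnu mnu _]] := derivative_charge_of_measures f1 f2 hm.
apply: le_trans (partial_variation_le_mass dnu) _; rewrite lee_fin.
apply: le_trans mnu _; apply: le_trans hM.
have mI : measurable (D `&` D° : set (plane R)).
  by apply: measurableI => //; rewrite interior_unit_square; apply: measurableX; exact: measurable_itv.
by apply: lerD; apply: fine_le; rewrite ?ge0_fin_numE//; try exact: finite_sub;
  apply: le_measure; rewrite ?inE//; exact: subIsetl.
Qed.

End has_variation.

(** * The variation of a step function *)

Lemma pushforward_measure d1 d2 (X : measurableType d1) (Y : measurableType d2)
    (R : realType) (mu : {measure set X -> \bar R}) (phi : X -> Y) :
  measurable_fun setT phi -> (mu setT < +oo)%E ->
  exists m : {measure set Y -> \bar R},
    (forall A, m A = mu (phi @^-1` A)) /\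
    forall (D : set Y) (f : Y -> R) (C : R), measurable D -> measurable_fun setT f ->
      (forall x, D x -> `|f x| <= C) ->
      \int[m]_(y in D) f y = \int[mu]_(x in phi @^-1` D) f (phi x).
Proof.
move=> mphi fmu.
pose m : {measure set Y -> \bar R} := pushforward mu phi; exists (m mphi); split => // D f C mD mf fC.
have mpre : measurable (phi @^-1` D) by rewrite -[X in measurable X]setTI; exact: mphi.
rewrite /Rintegral; congr fine; apply: (integral_pushforward mphi) => //.
  exact/measurable_EFinP.
apply: (finite_measure_integrable (f := f \o phi) (C := C)) => //.
- exact: finite_sub.
- by apply: measurable_funTS; exact: measurableT_comp.
- by move=> x /fC.
Qed.

Lemma Rint_measure0 d (T : measurableType d) (R : realType)
    (m : {measure set T -> \bar R}) (A : set T) (f : T -> R) :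
  (forall B, m B = 0%E) -> \int[m]_(x in A) f x = 0.
Proof.
move=> m0; rewrite /Rintegral.
have -> : (\int[m]_(x in A) (f x)%:E = 0)%E; last by [].
rewrite -(integral_measure_zero A (EFin \o f)).
by apply: eq_measure_integral => B _ _; rewrite m0.
Qed.

Section edges.
Context {R : realType}.
Local Notation L1 u := ((lebD R).-integrable setT (EFin \o u)).
Local Notation D := (@unit_square R).
Local Notation leb := (@lebesgue_measure R).

Let mD : measurable (D : set (plane R)) := @measurable_unit_square R.

Lemma is_derive_cross0 (phi : R * R -> R) (t y : R) : smooth phi ->
  is_derive t (1 : R) (fun t => phi (t, y)) (partial 0 phi (t, y)).
Proof.
move=> sphi; have [_ /(_ 0 (t, y))/cvg_ex[l hl]] := sphi [::].
apply: is_derive_cvg; rewrite /partial /derive.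
have -> : (fun h : R => h^-1 * (phi (h *: (1 : R) + t, y) - phi (t, y))) =
    (fun h : R => h^-1 *: ((phi \o shift (t, y)) (h *: basis2 R 0) - phi (t, y))).
  apply/funext => h; rewrite /basis2 eqxx /shift /=; congr (_ * (phi _ - _)).
  by congr (_, _); rewrite /= [_ *: 0]mulr0 add0r.
by rewrite (cvg_lim _ hl).
Qed.

Lemma is_derive_cross1 (phi : R * R -> R) (t y : R) : smooth phi ->
  is_derive t (1 : R) (fun t => phi (y, t)) (partial 1 phi (y, t)).
Proof.
move=> sphi; have [_ /(_ 1 (y, t))/cvg_ex[l hl]] := sphi [::].
apply: is_derive_cvg; rewrite /partial /derive.
have -> : (fun h : R => h^-1 * (phi (y, h *: (1 : R) + t) - phi (y, t))) =
    (fun h : R => h^-1 *: ((phi \o shift (y, t)) (h *: basis2 R 1) - phi (y, t))).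
  apply/funext => h; rewrite /basis2 /shift /=; congr (_ * (phi _ - _)).
  by congr (_, _); rewrite /= [_ *: 0]mulr0 add0r.
by rewrite (cvg_lim _ hl).
Qed.

Lemma integral_derive (f F : R -> R) (a b : R) : a < b -> continuous f ->
  (forall t, is_derive t (1 : R) F (f t)) ->
  (\int[leb]_(t in `]a, b[) (f t)%:E = (F b - F a)%:E)%E.
Proof.
move=> ab cf dF.
have cF : continuous F by move=> t; exact: is_derive_continuous (dF t).
have mf : measurable_fun setT f by exact: continuous_measurable_fun.
rewrite -(@integral_itv_bndoo _ a b (EFin \o f) true false); last first.
  by apply: measurable_funTS; exact/measurable_EFinP.
rewrite (@continuous_FTC2 _ f F)//.
- exact: continuous_subspaceT.
- split; first by move=> t _; have [] := dF t.
  + by apply: cvg_at_right_filter; exact: cF.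
  + by apply: cvg_at_left_filter; exact: cF.
- by move=> t _; rewrite derive1E; exact: derive_val.
Qed.

Lemma cross_continuous0 (g : R * R -> R) (y : R) : continuous g ->
  continuous (fun t => g (t, y)).
Proof.
move=> cg t.
have h : (fun s : R => (s, y)) @ t --> (t, y) by exact: (cvg_pair (@cvg_id _ _) (@cvg_cst _ _ _ _ _)).
exact: (cvg_comp (fun s : R => (s, y)) g h (cg (t, y))).
Qed.

Lemma cross_continuous1 (g : R * R -> R) (y : R) : continuous g ->
  continuous (fun t => g (y, t)).
Proof.
move=> cg t.
have h : (fun s : R => (y, s)) @ t --> (y, t) by exact: (cvg_pair (@cvg_cst _ _ _ _ _) (@cvg_id _ _)).
exact: (cvg_comp (fun s : R => (y, s)) g h (cg (y, t))).
Qed.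

Definition halfind (a : R) (t : R) : R := (a < t)%R%:R.
Definition itvind (c d t : R) : R := (c < t < d)%R%:R.

(** The half-strip beyond the edge [{a} x ]c, d[], in direction [k]: its derivative in
    this direction lives on the edge. *)
Definition edge (k : 'I_2) (a c d : R) (x : plane R) : R :=
  if k == 0 then halfind a x.1 * itvind c d x.2 else itvind c d x.1 * halfind a x.2.

Lemma itvindE c d t : itvind c d t = \1_(`]c, d[%classic) t.
Proof. by rewrite indicE mem_setE in_itv/=. Qed.

Lemma halfindE a t : halfind a t = \1_(`]a, +oo[%classic) t.
Proof. by rewrite indicE mem_setE in_itv/= andbT. Qed.

Lemma measurable_itvind c d : measurable_fun setT (itvind c d).
Proof. by rewrite (_ : itvind c d = \1_(`]c, d[%classic)); [exact: measurable_indic|apply/funext => t; exact: itvindE]. Qed.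

Lemma measurable_halfind a : measurable_fun setT (halfind a).
Proof. by rewrite (_ : halfind a = \1_(`]a, +oo[%classic)); [exact: measurable_indic|apply/funext => t; exact: halfindE]. Qed.

Lemma measurable_edge k a c d : measurable_fun setT (edge k a c d).
Proof.
rewrite /edge; case: (k == 0); apply: measurable_funM.
- exact: (measurableT_comp (measurable_halfind a) measurable_fst).
- exact: (measurableT_comp (measurable_itvind c d) measurable_snd).
- exact: (measurableT_comp (measurable_itvind c d) measurable_fst).
- exact: (measurableT_comp (measurable_halfind a) measurable_snd).
Qed.

Lemma edge_norm k a c d x : `|edge k a c d x| <= 1.
Proof.
have h (b b' : bool) : `|b%:R * b'%:R| <= 1 :> R.
  by case: b; case: b'; rewrite ?mulr0 ?mul0r ?mulr1 ?normr0 ?normr1.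
by rewrite /edge; case: ifP => _; exact: h.
Qed.

Lemma L1_edge k a c d : L1 (edge k a c d).
Proof.
have := L1_mulr (L1_cst 1) (@measurable_edge k a c d) (@edge_norm k a c d).
by rewrite (_ : (fun x => _) = edge k a c d)//; apply/funext => x; rewrite mul1r.
Qed.

Lemma lebD_leb2 (g : plane R -> R) (C : R) : measurable_fun D g ->
  (forall x, D x -> `|g x| <= C) -> measurable_fun setT g ->
  (\int[lebD R]_x (g x)%:E = \int[leb2 R]_x (g x * \1_D x)%:E)%E.
Proof.
move=> mg gC mgT.
rewrite [RHS](_ : _ = \int[leb2 R]_(x in D) (g x)%:E)%E; last first.
  rewrite [RHS]integral_mkcond; apply: eq_integral => x _.
  by rewrite patchE indicE; case: ifP; rewrite ?mulr1 ?mulr0.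
have -> : (\int[lebD R]_x (g x)%:E = \int[lebD R]_(x in D) (g x)%:E)%E.
  rewrite [RHS]integral_mkcond; apply: ae_eq_integral => //.
  - exact/measurable_EFinP.
  - apply/(measurable_restrictT _ mD).
    exact/measurable_EFinP.
  - by apply: filterS (@ae_lebD_square R) => x Dx _; rewrite patchE mem_set.
by apply: eq_measure_integral => A mA AD; rewrite lebD_sub.
Qed.

Lemma leb2_integrable (g : plane R -> R) (C : R) : measurable_fun setT g ->
  (forall x, D x -> `|g x| <= C) -> (leb2 R).-integrable setT (fun x => (g x * \1_D x)%:E).
Proof.
move=> mg gC.
have -> : (fun x => (g x * \1_D x)%:E) = (EFin \o g) \_ D.
  by apply/funext => x; rewrite patchE indicE; case: ifP; rewrite ?mulr1 ?mulr0.
have fD : (leb2 R D < +oo)%E.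
  by have := @lebD_setT R; rewrite lebDE setTI => ->; rewrite ltry.
have mg' : measurable_fun D g by exact: measurable_funTS.
exact/(integrable_mkcond _ mD).1/(finite_measure_integrable mD fD mg' gC).
Qed.

(** Fubini, then the fundamental theorem of calculus on each line in direction [k],
    from [a] to the far side of the square, where test functions vanish. *)
Lemma edge_derivative (k : 'I_2) (a c d : R) (phi : R * R -> R) :
  0 <= a < 1 -> 0 <= c -> d <= 1 -> test_function D° phi ->
  \int[lebD R]_x (edge k a c d x * partial k phi x) =
  - \int[leb]_(y in `]c, d[) (if k == 0 then phi (a, y) else phi (y, a)).
Proof.
move=> /andP[a0 a1] c0 d1 tphi; have [sphi _] := tphi.
have [cp mp [C hC]] := test_function_partial k sphi.
have [mphi [C' hC'] z] := test_function_facts tphi.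
have cphi : continuous phi by have [] := sphi [::].
pose g x := edge k a c d x * partial k phi x.
have mg : measurable_fun setT (g : plane R -> R) by apply: measurable_funM => //; exact: measurable_edge.
have gC x : D x -> `|g x| <= C.
  move=> Dx; rewrite /g normrM; apply: le_trans (hC x Dx).
  by rewrite ler_piMl// edge_norm.
have ig := leb2_integrable mg gC.
rewrite /Rintegral (lebD_leb2 (C := C))//; last exact: measurable_funTS.
have inI (y : R) : `]c, d[%classic y -> 0 < y < 1.
  by rewrite /= in_itv/= => /andP[? ?]; rewrite (le_lt_trans c0)//= (lt_le_trans _ d1).
have zb (x y : R) : (x = 0 \/ x = 1) -> phi (x, y) = 0 /\ phi (y, x) = 0.
  move=> h; split; apply: z; rewrite interior_unit_square /= !in_itv/= => -[/andP[? ?] /andP[? ?]];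
    case: h => ?; lra.
suff inner (y : R) : (\int[leb]_t (if k == 0 then g (t, y) * \1_D (t, y) else g (y, t) * \1_D (y, t))%:E =
    - (itvind c d y * (if k == 0 then phi (a, y) else phi (y, a)))%:E)%E.
  have -> : (\int[leb2 R]_x (g x * \1_D x)%:E = \int[leb]_y - (itvind c d y * (if k == 0 then phi (a, y) else phi (y, a)))%:E)%E.
    case: (k == 0) in inner *.
      rewrite -[LHS](integral21_prod_meas1 ig).
      by apply: eq_integral => y _; rewrite /fubini_G inner.
    rewrite -[LHS](integral12_prod_meas1 ig).
    by apply: eq_integral => y _; rewrite /fubini_F inner.
  rewrite -fineN; congr fine.
  transitivity (\int[leb]_(y in `]c, d[) - (if k == 0 then phi (a, y) else phi (y, a))%:E)%E.
    rewrite [RHS]integral_mkcond; apply: eq_integral => y _.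
    rewrite patchE /itvind mem_setE in_itv/=; case: (c < y < d).
      by rewrite mul1r.
    by rewrite mul0r oppr0.
  rewrite integralN//.
  apply: integrable_add_def; first exact: measurable_itv.
  pose psi (x : measurableTypeR R) : R := if k == 0 then phi (a, x) else phi (x, a).
  have mI : measurable (`]c, d[%classic : set (measurableTypeR R)) by exact: measurable_itv.
  have fI : (leb `]c, d[%classic < +oo)%E.
    by rewrite lebesgue_measure_itv/=; case: ifP => _; rewrite ?ltry// -EFinB ltry.
  have mpsi : measurable_fun (`]c, d[%classic : set (measurableTypeR R)) psi.
    apply: measurable_funTS; apply: continuous_measurable_fun.
    rewrite /psi; case: (k == 0); first exact: cross_continuous1.
    exact: cross_continuous0.
  apply: (@finite_measure_integrable R _ _ leb _ psi C' mI fI mpsi).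
  move=> y /inI /andP[y0 y1]; rewrite /psi.
  by case: (k == 0); apply: hC'; split; rewrite /= in_itv/= ?(ltW y0) ?(ltW y1)// a0 ltW.
have [cdy|cdy] := boolP (c < y < d); last first.
  rewrite /itvind (negPf cdy) mul0r oppe0.
  apply: integral0_eq => t _; rewrite /g /edge /itvind/=.
  by case: (k == 0); rewrite (negPf cdy) ?mulr0 ?mul0r ?mul0r// mulr0n ?mul0r ?mulr0 ?mul0r.
have /andP[y0 y1] : 0 < y < 1 by apply: inI; rewrite /= in_itv.
rewrite /itvind cdy mul1r.
transitivity (\int[leb]_(t in `]a, 1%R[) (if k == 0 then partial k phi (t, y) else partial k phi (y, t))%:E)%E.
  rewrite -(@integral_itv_bndoo _ a 1 _ false false); last first.
    apply: measurable_funTS; apply/measurable_EFinP; apply: continuous_measurable_fun.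
    case: (k == 0); first exact: cross_continuous0.
    exact: cross_continuous1.
  rewrite [RHS]integral_mkcond; apply: eq_integral => t _; rewrite patchE mem_setE in_itv/=.
  have tE : \1_D (t, y) = (0 <= t <= 1)%R%:R :> R /\ \1_D (y, t) = (0 <= t <= 1)%R%:R :> R.
    by rewrite !indicE !in_setX !mem_setE !in_itv/= (ltW y0) (ltW y1) ?andbT.
  rewrite /g /edge /halfind /itvind/=.
  case: (k == 0); rewrite cdy ?(proj1 tE) ?(proj2 tE); case: (ltP a t) => at_;
    rewrite ?mul0r ?mulr0 ?mul0r//= ?mulr1 ?mul1r.
  - by rewrite (ltW (le_lt_trans a0 at_))/=; case: (t <= 1); rewrite ?mulr1 ?mulr0.
  - by rewrite (ltW (le_lt_trans a0 at_))/=; case: (t <= 1); rewrite ?mulr1 ?mulr0.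
case: (ord2P k) => -> /=.
  have c0' : continuous (fun t => partial 0 phi (t, y)).
    by apply: cross_continuous0; have [] := sphi [:: 0].
  rewrite [LHS](integral_derive a1 c0' (fun t => is_derive_cross0 t y sphi)).
  by have [-> _] := zb 1 y (or_intror erefl); rewrite sub0r.
have c1' : continuous (fun t => partial 1 phi (y, t)).
  by apply: cross_continuous1; have [] := sphi [:: 1].
rewrite [LHS](integral_derive a1 c1' (fun t => is_derive_cross1 t y sphi)).
by have [_ ->] := zb 1 y (or_intror erefl); rewrite sub0r.
Qed.

(** The derivative of an edge is arc length on the edge; when the edge lies on
    the boundary of the square it is invisible to test functions. *)
Lemma has_variation_edge (k : 'I_2) (a c d : R) : 0 <= a < 1 -> 0 <= c -> c <= d -> d <= 1 ->
  has_variation k (edge k a c d) (if a == 0 then 0 else d - c).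
Proof.
move=> a01 c0 cd d1.
pose iota (y : measurableTypeR R) : plane R := if k == 0 then (a, y) else (y, a).
have miota : measurable_fun setT iota.
  by rewrite /iota; case: (k == 0); apply: measurable_fun_pair => //; exact: measurable_cst.
have mI : measurable (`]c, d[%classic : set (measurableTypeR R)) by exact: measurable_itv.
have inI (y : R) : `]c, d[%classic y -> D (iota y).
  rewrite /= in_itv/= => /andP[? ?]; have /andP[? ?] := a01.
  by rewrite /iota; case: (k == 0); split; rewrite /= in_itv/=; lra.
have fI : (mrestr leb mI setT < +oo)%E.
  by rewrite mrestrE setTI [X in (X < _)%E]lebesgue_measure_oo ?ltry.
have [m [mE mint]] := pushforward_measure miota fI.
have fm : (m setT < +oo)%E by rewrite mE preimage_setT.
have [m0 m0E] : exists m0 : {measure set (plane R) -> \bar R}, forall A, m0 A = 0%E.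
  by exists mzero.
have f0 : (m0 setT < +oo)%E by rewrite m0E ltry.
have rep : represents_derivative k (edge k a c d) m m0.
  move=> phi tphi; rewrite edge_derivative//; congr (- _).
  have [mphi [C hC] z] := test_function_facts tphi.
  rewrite (Rint_measure0 _ _ m0E) subr0.
  have mphiT : measurable_fun setT (phi : plane R -> R).
    by apply: continuous_measurable_plane => //; have [/(_ [::])[]] := tphi.
  have mpre : measurable (iota @^-1` D) by rewrite -[X in measurable X]setTI; exact: miota.
  have e : (iota @^-1` D) `&` `]c, d[%classic = `]c, d[%classic.
    by apply/seteqP; split => [x []//|x cdx]; split => //; exact: inI.
  rewrite (mint _ _ C)// (Rint_mrestr_fin mI (C := C))//.
  - rewrite e; apply: eq_Rintegral => y _; rewrite /iota; by case: (k == 0).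
  - by rewrite e [X in (X < _)%E]lebesgue_measure_oo ?ltry.
  - by apply: measurable_funTS; exact: (measurableT_comp mphiT miota).
  - by move=> y /hC.
have [a0|a0] := eqVneq a 0; last first.
  exists m, m0; split => //.
  rewrite m0E addr0 mE [X in fine X](_ : _ = (d - c)%:E)//.
  rewrite [LHS]mrestrE (_ : _ `&` _ = `]c, d[%classic); first exact: lebesgue_measure_oo.
  by apply/seteqP; split => [x []//|x cdx]; split => //; exact: inI.
exists m0, m0; split => //; last by rewrite m0E addr0.
move=> phi tphi; rewrite edge_derivative//.
rewrite (Rint_measure0 _ _ m0E) subrr oppr0.
have [_ _ z] := test_function_facts tphi.
rewrite (@eq_Rintegral _ _ _ _ _ (fun=> 0)); first by rewrite /Rintegral integral0 oppr0.
move=> y _; case: (k == 0); apply: z; rewrite interior_unit_square a0 /= !in_itv/= ltxx => -[]//.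
Qed.

End edges.

Section step_variation.
Context {R : realType}.
Local Notation L1 u := ((lebD R).-integrable setT (EFin \o u)).

(** The value before the first one counts as 0, so the first jump is [c 0]. *)
Definition jump (c : nat -> R) (i : nat) : R := c i - (if i is i'.+1 then c i' else 0).

(** Off the nodes the indicator of a unit interval is the difference of two indicators of
    half-lines; then sum by parts. *)
Lemma sum_jump (c : nat -> R) (n : nat) (y : R) : y < n%:R -> (forall i : nat, y != i%:R) ->
  \sum_(i < n) c i * unit_ind (y - i%:R) = \sum_(i < n) jump c i * (i%:R < y)%R%:R.
Proof.
move=> yn yi.
have uE (i : nat) : unit_ind (y - i%:R) = (i%:R < y)%R%:R - (i.+1%:R < y)%R%:R :> R.
  have := yi i.+1; have := yi i; rewrite /unit_ind -[i.+1]addn1 natrD.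
  case: (ltgtP y i%:R) => // h1 _; case: (ltgtP y (i%:R + 1)) => // h2 _;
    (case: ifP => [/andP[h3 h4]|/negP h3]; rewrite ?subrr ?subr0 ?sub0r//;
     exfalso; first [lra | apply: h3; lra]).
have key m : \sum_(i < m) c i * unit_ind (y - i%:R) + (if m is m'.+1 then c m' * (m%:R < y)%R%:R else 0)
    = \sum_(i < m) jump c i * (i%:R < y)%R%:R.
  elim: m => [|m IH]; first by rewrite !big_ord0 addr0.
  rewrite !big_ord_recr/= -IH uE /jump.
  by case: m {IH} => [|m]; ring.
rewrite -key; case: n yn {key} => [|n] yn; first by rewrite addr0.
by rewrite ltNge (ltW yn) mulr0 addr0.
Qed.

Lemma sum_guard_shift (n : nat) (F : nat -> R) :
  \sum_(i < n) (if (i : nat) is i'.+1 then F i' else 0) = \sum_(i < n) (i.+1 < n)%N%:R * F i.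
Proof.
case: n => [|n]; first by rewrite !big_ord0.
rewrite big_ord_recl/= add0r big_ord_recr/= ltnn mul0r addr0.
by apply: eq_bigr => i _; rewrite ltnS ltn_ord mul1r.
Qed.

Lemma itvind_scale (N y : R) (l : nat) : 0 < N ->
  unit_ind (N * y - l%:R) = itvind (l%:R / N) (l.+1%:R / N) y.
Proof.
move=> N0; rewrite /unit_ind /itvind (ltr_pdivrMr _ _ N0) (ltr_pdivlMr _ _ N0) (mulrC y).
rewrite subr_gt0 ltrBlDl -[l.+1]addn1 natrD.
by case: ifP.
Qed.

Lemma step_edges0 (j : nat) (b : nat -> nat -> R) :
  {ae lebD R, forall x, step j b x = \sum_(i < (2 ^ j)%N) \sum_(l < (2 ^ j)%N)
    (4 ^+ j * jump (b ^~ l) i) * edge 0 (i%:R / 2 ^+ j) (l%:R / 2 ^+ j) (l.+1%:R / 2 ^+ j) x}.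
Proof.
apply: filterS (ae_off_grid j) => x [Dx hx].
have [/andP[_ h1] _] := square_range Dx hx.
rewrite /step exchange_big/= [RHS]exchange_big/=; apply: eq_bigr => l _.
transitivity (4 ^+ j * unit_ind (2 ^+ j * x.2 - l%:R) *
  \sum_(i < (2 ^ j)%N) b i l * unit_ind (2 ^+ j * x.1 - i%:R)).
  by rewrite mulr_sumr; apply: eq_bigr => i _; rewrite /cell; ring.
rewrite (sum_jump (b ^~ l))//; last by move=> i; case: (hx i).
rewrite mulr_sumr; apply: eq_bigr => i _.
rewrite /edge/= -itvind_scale ?pow2_gt0// /halfind (ltr_pdivrMr _ _ (pow2_gt0 j)) (mulrC x.1).
ring.
Qed.

Lemma step_edges1 (j : nat) (b : nat -> nat -> R) :
  {ae lebD R, forall x, step j b x = \sum_(i < (2 ^ j)%N) \sum_(l < (2 ^ j)%N)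
    (4 ^+ j * jump (b i) l) * edge 1 (l%:R / 2 ^+ j) (i%:R / 2 ^+ j) (i.+1%:R / 2 ^+ j) x}.
Proof.
apply: filterS (ae_off_grid j) => x [Dx hx].
have [_ /andP[_ h1]] := square_range Dx hx.
apply: eq_bigr => i _.
transitivity (4 ^+ j * unit_ind (2 ^+ j * x.1 - i%:R) *
  \sum_(l < (2 ^ j)%N) b i l * unit_ind (2 ^+ j * x.2 - l%:R)).
  by rewrite mulr_sumr; apply: eq_bigr => l _; rewrite /cell; ring.
rewrite (sum_jump (b i))//; last by move=> l; case: (hx l).
rewrite mulr_sumr; apply: eq_bigr => l _.
rewrite /edge/= -itvind_scale ?pow2_gt0// /halfind (ltr_pdivrMr _ _ (pow2_gt0 j)) (mulrC x.2).
ring.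
Qed.

Lemma has_variation_grid_edge k (j i l : nat) (c : R) : (i < 2 ^ j)%N -> (l < 2 ^ j)%N ->
  has_variation k (fun x => 4 ^+ j * c * edge k (i%:R / 2 ^+ j) (l%:R / 2 ^+ j) (l.+1%:R / 2 ^+ j) x)
    (2 ^+ j * (if i is i'.+1 then `|c| else 0)).
Proof.
move=> ij lj; have N0 := @pow2_gt0 R j.
have le1 (n : nat) : (n <= 2 ^ j)%N -> n%:R / 2 ^+ j <= 1 :> R.
  by move=> h; rewrite (ler_pdivrMr _ _ N0) mul1r -natrX ler_nat.
have := @has_variation_edge R k (i%:R / 2 ^+ j) (l%:R / 2 ^+ j) (l.+1%:R / 2 ^+ j).
move=> /(_ _ _ _ _)/(has_variationZ (4 ^+ j * c) (L1_edge _ _ _ _))-h.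
apply: has_variation_le (h _ _ _ _); last 4 first.
- rewrite divr_ge0 ?(ltW N0)//= (ltr_pdivrMr _ _ N0) mul1r -natrX ltr_nat//.
- by rewrite divr_ge0 ?(ltW N0).
- by rewrite (ler_pM2r _) ?invr_gt0// ler_nat.
- exact: le1.
rewrite mulf_eq0 invr_eq0 (gt_eqF N0) orbF pnatr_eq0.
case: i {ij h} => [|i]/=; first by rewrite !mulr0.
rewrite normrM (ger0_norm (ltW (pow4_gt0 j))) pow4 -mulrBl -[l.+1]addn1 natrD addrAC subrr add0r mul1r.
by rewrite [X in X / _](_ : _ = 2 ^+ j * `|c| * 2 ^+ j) ?mulfK ?gt_eqF//; ring.
Qed.

Lemma has_variation_sum2 k (n : nat) (F : 'I_n -> 'I_n -> plane R -> R) (M : 'I_n -> 'I_n -> R) :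
  (forall i l, L1 (F i l)) -> (forall i l, has_variation k (F i l) (M i l)) ->
  has_variation k (fun x => \sum_i \sum_l F i l x) (\sum_i \sum_l M i l).
Proof.
move=> iF hF.
apply: (has_variation_sum (F := fun i x => \sum_l F i l x) (M := fun i => \sum_l M i l)) => i.
  exact: L1_sum.
exact: has_variation_sum.
Qed.

(** A step function is a combination of half-strips, with the jumps as coefficients.
    The jumps from 0 to the values of the first cells take place on the boundary of the
    square, and do not contribute. *)
Lemma has_variation_step k (j : nat) (b : nat -> nat -> R) :
  has_variation k (step j b) (2 ^+ j * dvar k j b).
Proof.
have L1e k' (n : nat) (c a p q : 'I_n -> 'I_n -> R) :
    L1 (fun x => \sum_(i < n) \sum_(l < n) (c i l) * edge k' (a i l) (p i l) (q i l) x).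
  by do 2 apply: L1_sum => ?; apply: L1_Z; exact: L1_edge.
case: (ord2P k) => ->.
- have := @has_variation_sum2 0 (2 ^ j) (fun i l x =>
     4 ^+ j * jump (b ^~ l) i * edge 0 (i%:R / 2 ^+ j) (l%:R / 2 ^+ j) (l.+1%:R / 2 ^+ j) x) _
     (fun i l => L1_Z _ (L1_edge _ _ _ _)) (fun i l => has_variation_grid_edge _ _ (ltn_ord i) (ltn_ord l)).
  move/(has_variation_ae (L1e _ _ _ _ _ _) (L1_step j b) _) => h.
  apply: has_variation_le (h _); last by apply: filterS (step_edges0 j b) => x ->.
  rewrite /dvar/= exchange_big/= [in leRHS]exchange_big/= mulr_sumr; apply: ler_sum => l _.
  rewrite -mulr_sumr -(sum_guard_shift _ (fun i => `|b i.+1 l - b i l|)).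
  rewrite ler_pM2l ?pow2_gt0//; apply: ler_sum => i _.
  by case: (i : nat).
- have := @has_variation_sum2 1 (2 ^ j) (fun i l x =>
     4 ^+ j * jump (b i) l * edge 1 (l%:R / 2 ^+ j) (i%:R / 2 ^+ j) (i.+1%:R / 2 ^+ j) x) _
     (fun i l => L1_Z _ (L1_edge _ _ _ _)) (fun i l => has_variation_grid_edge _ _ (ltn_ord l) (ltn_ord i)).
  move/(has_variation_ae (L1e _ _ _ _ _ _) (L1_step j b) _) => h.
  apply: has_variation_le (h _); last by apply: filterS (step_edges1 j b) => x ->.
  rewrite /dvar/= mulr_sumr; apply: ler_sum => i _.
  rewrite -mulr_sumr -(sum_guard_shift _ (fun l => `|b i l.+1 - b i l|)).
  rewrite ler_pM2l ?pow2_gt0//; apply: ler_sum => l _.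
  by case: (l : nat).
Qed.

End step_variation.

(** * Weak compactness of measures on the square *)

Section within_square.
Context {R : realType}.
Local Notation D := (@unit_square R).

Lemma within_square_cvg (f : R * R -> R) (x : nat -> R * R) (l : R * R) :
  {within D, continuous f} -> (forall n, D (x n)) -> D l ->
  (x n).1 @[n --> \oo] --> l.1 -> (x n).2 @[n --> \oo] --> l.2 ->
  f (x n) @[n --> \oo] --> f l.
Proof.
move=> /subspace_continuousP cf Dx Dl x1 x2.
have xl : x n @[n --> \oo] --> l.
  rewrite (_ : x = fun n => ((x n).1, (x n).2)); last by apply/funext => n; case: (x n).
  by case: l x1 x2 {Dl} => a b; exact: cvg_pair.
move=> A /(cf l Dl) /xl [N _ NA]; exists N => // n /NA /=; exact.
Qed.

Lemma unit_square_lim (x : nat -> R * R) (l : R * R) : (forall n, D (x n)) ->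
  (x n).1 @[n --> \oo] --> l.1 -> (x n).2 @[n --> \oo] --> l.2 -> D l.
Proof.
move=> Dx x1 x2.
have h (a : nat -> R) b : (forall n, 0 <= a n <= 1) -> a n @[n --> \oo] --> b -> 0 <= b <= 1.
  move=> a01 ab; have -> : b = limn a by apply/esym/cvg_lim.
  have ca : cvgn a by apply/cvg_ex; exists b.
  by apply/andP; split; [apply: limr_ge|apply: limr_le] => //; apply: nearW => n; case/andP: (a01 n).
by split; rewrite /= in_itv/=; [apply: h x1|apply: h x2] => n; have [] := Dx n; rewrite /= !in_itv.
Qed.

(** Heine's theorem, by extraction. *)
Lemma within_square_uniform (f : R * R -> R) (e : R) : {within D, continuous f} -> 0 < e ->
  exists J : nat, forall x y, D x -> D y ->
    `|x.1 - y.1| <= 2 ^- J -> `|x.2 - y.2| <= 2 ^- J -> `|f x - f y| <= e.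
Proof.
move=> cf e0; apply: contrapT => /forallNP H.
have /choice[x /choice[y hxy]] : forall J : nat, exists x y, [/\ D x, D y,
    `|x.1 - y.1| <= 2 ^- J, `|x.2 - y.2| <= 2 ^- J & e < `|f x - f y|].
  move=> J; apply: contrapT => /forallNP h; apply: (H J) => x y Dx Dy h1 h2.
  rewrite leNgt; apply/negP => h3; apply: (h x); exists y; split => //.
pose a n (b : bool) := if b then (x n).1 else (x n).2.
have [|psi hpsi ca] := @diagonal_extraction R bool a.
  move=> b; exists 1 => n; have [[/= h1 h2] _ _ _ _] := hxy n.
  move: h1 h2; rewrite !in_itv/= /a => /andP[? ?] /andP[? ?].
  by case: b; rewrite ger0_norm.
pose l := (limn (fun n => a (psi n) true), limn (fun n => a (psi n) false)).
have x1 : (x (psi n)).1 @[n --> \oo] --> l.1 by exact: (ca true).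
have x2 : (x (psi n)).2 @[n --> \oo] --> l.2 by exact: (ca false).
have p2 : (2 ^- (psi n) : R) @[n --> \oo] --> 0.
  suff h : (2 ^- n : R) @[n --> \oo] --> 0 by exact: (cvg_subseq hpsi h).
  rewrite (_ : (fun n : nat => 2 ^- n) = geometric 1 2^-1).
    by apply: cvg_geometric; rewrite ger0_norm ?invr_ge0// invf_lt1// ltr1n.
  by apply/funext => n; rewrite /geometric/= mul1r exprVn.
have close (u v : nat -> R) (m : R) : u n @[n --> \oo] --> m ->
    (forall n, `|u n - v n| <= 2 ^- (psi n)) -> v n @[n --> \oo] --> m.
  move=> um uv.
  have d0 : (u n - v n) @[n --> \oo] --> 0.
    apply/norm_cvg0P; apply: (squeeze_cvgr _ (@cvg_cst _ 0 _ _ _) p2).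
    by apply: nearW => n; rewrite normr_ge0 uv.
  have -> : v = u \- (fun n => u n - v n) by apply/funext => n /=; ring.
  by rewrite -[m]subr0; exact: cvgB.
have y1 : (y (psi n)).1 @[n --> \oo] --> l.1 by apply: close x1 _ => n; case: (hxy (psi n)).
have y2 : (y (psi n)).2 @[n --> \oo] --> l.2 by apply: close x2 _ => n; case: (hxy (psi n)).
have Dl : D l by apply: unit_square_lim x1 x2 => n; case: (hxy (psi n)).
have fx : f (x (psi n)) @[n --> \oo] --> f l.
  by apply: within_square_cvg x1 x2 => // n; case: (hxy (psi n)).
have fy : f (y (psi n)) @[n --> \oo] --> f l.
  by apply: within_square_cvg y1 y2 => // n; case: (hxy (psi n)).
have h0 : (f (x (psi n)) - f (y (psi n))) @[n --> \oo] --> 0 by rewrite -[0](subrr (f l)); exact: cvgB.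
have [N _ /(_ N (leqnn N))] := cvgr0_norm_lt _ h0 _ e0.
by have [_ _ _ _] := hxy (psi N); rewrite /=; lra.
Qed.

End within_square.

(** * Measures with prescribed masses on dyadic cells *)

Section locator.
Context {R : realType}.
Variables (M : nat -> nat -> R).
Hypothesis M0 : forall j K, 0 <= M j K.
Hypothesis M4 : forall j K, M j K = (M j.+1 K.*2.*2 + M j.+1 K.*2.*2.+1) +
   (M j.+1 K.*2.+1.*2 + M j.+1 K.*2.+1.*2.+1).

Definition cumul (j K : nat) : R := \sum_(i < K) M j i.

(** Consecutive intervals of length [M j K] that tile [[0, M 0 0[]; by consistency the
    slots of the four children tile the slot of their parent. *)
Definition slot (j K : nat) (t : R) : bool := cumul j K <= t < cumul j K.+1.

Definition locate (j : nat) (F : nat -> R) (t : R) : R :=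
  \sum_(K < (4 ^ j)%N) F K * (slot j K t)%:R.

(** The cell that contains [x] at level [j.+1] is child number
    [K.*2.*2 + 2 a + b] of its parent [K]; this is the corner it stands for. *)
Fixpoint corner (j K : nat) : R * R :=
  if j is j'.+1 then
    ((corner j' K./2./2).1 + (odd K./2)%:R / 2 ^+ j, (corner j' K./2./2).2 + (odd K)%:R / 2 ^+ j)
  else (0, 0).

Lemma cumulS j K : cumul j K.+1 = cumul j K + M j K.
Proof. by rewrite /cumul big_ord_recr. Qed.

Lemma cumul_children j K : cumul j.+1 K.*2.*2 = cumul j K.
Proof.
rewrite /cumul sum_double (sum_double K (fun i => M j.+1 i.*2 + M j.+1 i.*2.+1)).
by apply: eq_bigr => i _; rewrite [RHS]M4.
Qed.

Lemma cumul_le j (K L : nat) : (K <= L)%N -> cumul j K <= cumul j L.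
Proof.
move=> /subnKC <-; elim: (L - K)%N => [|n IH]; first by rewrite addn0.
by rewrite addnS cumulS (le_trans IH)// lerDl.
Qed.

Lemma cumul_total j : cumul j (4 ^ j) = M 0 0.
Proof.
elim: j => [|j IH]; first by rewrite cumulS /cumul big_ord0 add0r.
by rewrite -IH -[RHS]cumul_children expnS; congr (cumul _ _); lia.
Qed.

Lemma slot_unique j K L t : slot j K t -> slot j L t -> K = L.
Proof.
wlog KL : K L / (K < L)%N => [h hK hL|].
  by case: (ltngtP K L) => // KL; [exact: h|apply/esym; exact: h].
move=> /andP[_ h1] /andP[h2 _]; exfalso.
by have := cumul_le j KL; lra.
Qed.

Lemma slot_exists j t : 0 <= t < M 0 0 -> exists2 K, (K < 4 ^ j)%N & slot j K t.
Proof.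
rewrite -(cumul_total j) => /andP[t0]; elim: (4 ^ j)%N => [|n IH].
  by rewrite /cumul big_ord0; lra.
have [/IH[K Kn hK] _|h1 h2] := ltP t (cumul j n); first by exists K => //; exact: leqW.
by exists n => //; rewrite /slot h1.
Qed.

Lemma slot_parent j K t : slot j.+1 K t -> slot j K./2./2 t.
Proof.
have e : K = (odd K + (odd K./2 + K./2./2.*2).*2)%N by rewrite !odd_double_half.
move=> /andP[h1 h2]; apply/andP; split.
- apply: le_trans h1; rewrite -[leLHS]cumul_children; apply: cumul_le.
  by rewrite {2}e; lia.
- apply: lt_le_trans h2 _; rewrite -[leRHS]cumul_children; apply: cumul_le.
  by rewrite {1}e; case: (odd K); case: (odd K./2); lia.
Qed.

Lemma locateE j F K t : (K < 4 ^ j)%N -> slot j K t -> locate j F t = F K.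
Proof.
move=> Kj hK; rewrite /locate (bigD1 (Ordinal Kj))//= hK mulr1 big1 ?addr0// => L.
case: (boolP (slot j L t)) => [hL|_ _]; last by rewrite mulr0.
by move/negP; case; apply/eqP/val_inj => /=; exact: slot_unique hL hK.
Qed.

Lemma slot_range j K t : (K < 4 ^ j)%N -> slot j K t -> 0 <= t < M 0 0.
Proof.
move=> Kj /andP[h1 h2]; rewrite -(cumul_total j); apply/andP; split.
  by apply: le_trans h1; apply: sumr_ge0.
by apply: lt_le_trans h2 _; exact: cumul_le.
Qed.

Lemma locate_out j F t : ~~ (0 <= t < M 0 0) -> locate j F t = 0.
Proof.
move=> h; rewrite /locate big1// => K _; case: (boolP (slot j K t)) => [hK|_]; last by rewrite mulr0.
by exfalso; move/negP : h; apply; exact: slot_range hK.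
Qed.

Lemma corner_bound j K : [/\ 0 <= (corner j K).1, (corner j K).1 <= 1 - 2 ^- j,
  0 <= (corner j K).2 & (corner j K).2 <= 1 - 2 ^- j].
Proof.
elim: j K => [|j IH] K; first by rewrite /= expr0 invr1 subrr.
have [h1 h2 h3 h4] := IH K./2./2.
have p0 : 0 <= (2 ^+ j.+1)^-1 :> R by rewrite invr_ge0 exprn_ge0.
have e : (2 ^+ j)^-1 = 2 * (2 ^+ j.+1)^-1 :> R.
  by rewrite exprS invfM mulrA mulfV ?mul1r.
have b (c : bool) : 0 <= (c%:R / 2 ^+ j.+1 : R) <= (2 ^+ j.+1)^-1.
  by case: c; rewrite ?mul0r ?mul1r ?lexx ?p0.
have := b (odd K); have := b (odd K./2) => /andP[b1 b2] /andP[b3 b4] /=.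
by split; lra.
Qed.

Lemma corner_square j K : @unit_square R (corner j K).
Proof.
have [h1 h2 h3 h4] := corner_bound j K.
have p0 : 0 <= (2 ^+ j)^-1 :> R by rewrite invr_ge0 exprn_ge0.
by split; rewrite /= in_itv/=; apply/andP; split => //; lra.
Qed.

Lemma measurable_locate j F : measurable_fun setT (locate j F : measurableTypeR R -> R).
Proof.
apply: measurable_sum => K; apply: measurable_funM => //.
rewrite (_ : (fun t => _) = \1_(`[cumul j K, cumul j K.+1[%classic)).
  by apply: measurable_indic; exact: measurable_itv.
by apply/funext => t; rewrite indicE mem_setE in_itv.
Qed.

(** The limit of the corners of the cells whose slots contain [t]. The coordinates of
    these corners increase with the level. *)
Definition transport (t : R) : R * R :=
  (limn (fun j => locate j (fun K => (corner j K).1) t),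
   limn (fun j => locate j (fun K => (corner j K).2) t)).

Let locate_incr (p : R * R -> R) t : (forall j K, 0 <= p (corner j K) <= 1) ->
  (forall j K, p (corner j K./2./2) <= p (corner j.+1 K)) ->
  cvgn (fun j => locate j (fun K => p (corner j K)) t).
Proof.
move=> p01 pm.
have [t0|t0] := boolP (0 <= t < M 0 0); last first.
  by under eq_fun do rewrite locate_out//; exact: is_cvg_cst.
apply: nondecreasing_is_cvgn.
- apply/nondecreasing_seqP => j.
  have [K Kj hK] := slot_exists j.+1 t0.
  have Kj' : (K./2./2 < 4 ^ j)%N by move: Kj; rewrite expnS -!divn2; lia.
  by rewrite (locateE _ Kj hK) (locateE _ Kj' (slot_parent hK)).
- exists 1 => _ [j _ <-]; have [K Kj hK] := slot_exists j t0.
  by rewrite (locateE _ Kj hK); case/andP: (p01 j K).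
Qed.

Let corner1_01 j K : 0 <= (corner j K).1 <= 1.
Proof. by have [] := corner_square j K; rewrite /= !in_itv. Qed.

Let corner2_01 j K : 0 <= (corner j K).2 <= 1.
Proof. by have [] := corner_square j K; rewrite /= !in_itv. Qed.

Lemma transport1_cvg t : locate j (fun K => (corner j K).1) t @[j --> \oo] --> (transport t).1.
Proof.
apply: (locate_incr (p := fst)); first exact: corner1_01.
by move=> j K /=; rewrite lerDl divr_ge0.
Qed.

Lemma transport2_cvg t : locate j (fun K => (corner j K).2) t @[j --> \oo] --> (transport t).2.
Proof.
apply: (locate_incr (p := snd)); first exact: corner2_01.
by move=> j K /=; rewrite lerDl divr_ge0.
Qed.

Lemma measurable_transport : measurable_fun setT (transport : measurableTypeR R -> plane R).
Proof.
apply: measurable_fun_pair.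
- apply: (measurable_fun_cvg (h := fun j => locate j (fun K => (corner j K).1))) => //.
    by move=> j; exact: measurable_locate.
  by move=> t _; exact: transport1_cvg.
- apply: (measurable_fun_cvg (h := fun j => locate j (fun K => (corner j K).2))) => //.
    by move=> j; exact: measurable_locate.
  by move=> t _; exact: transport2_cvg.
Qed.

Lemma transport_square t : @unit_square R (transport t).
Proof.
have [t0|t0] := boolP (0 <= t < M 0 0); last first.
  have z F : limn (fun j => locate j (F j) t) = 0.
    by under eq_fun do rewrite locate_out//; rewrite lim_cst.
  by rewrite /transport !z; split; rewrite /= in_itv/= lexx ler01.
have /choice[k hk] : forall j, exists K, (K < 4 ^ j)%N /\ slot j K t.
  by move=> j; have [K] := slot_exists j t0; exists K.
apply: (@unit_square_lim R (fun j => corner j (k j))) => [j| |]; first exact: corner_square.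
- by have := @transport1_cvg t; under eq_fun do rewrite (locateE _ (hk _).1 (hk _).2).
- by have := @transport2_cvg t; under eq_fun do rewrite (locateE _ (hk _).1 (hk _).2).
Qed.

Lemma locate_cvg (f : R * R -> R) t : {within @unit_square R, continuous f} ->
  0 <= t < M 0 0 -> locate j (fun K => f (corner j K)) t @[j --> \oo] --> f (transport t).
Proof.
move=> cf t0.
have /choice[k hk] : forall j, exists K, (K < 4 ^ j)%N /\ slot j K t.
  by move=> j; have [K] := slot_exists j t0; exists K.
under eq_fun do rewrite (locateE _ (hk _).1 (hk _).2).
apply: within_square_cvg => // [j| | |]; first exact: corner_square.
- exact: transport_square.
- by have := @transport1_cvg t; under eq_fun do rewrite (locateE _ (hk _).1 (hk _).2).
- by have := @transport2_cvg t; under eq_fun do rewrite (locateE _ (hk _).1 (hk _).2).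
Qed.

End locator.

Lemma lebesgue_measure_co (R : realType) (a b : R) : a <= b ->
  lebesgue_measure `[a, b[%classic = (b - a)%:E.
Proof.
move=> ab; rewrite lebesgue_measure_itv/= lte_fin.
move: ab; rewrite le_eqVlt => /predU1P[->|->]; last by rewrite EFinN.
by rewrite ltxx subrr.
Qed.

Section transported_measure.
Context {R : realType}.
Local Notation D := (@unit_square R).
Variables (M : nat -> nat -> R).
Hypothesis M0 : forall j K, 0 <= M j K.
Hypothesis M4 : forall j K, M j K = (M j.+1 K.*2.*2 + M j.+1 K.*2.*2.+1) +
   (M j.+1 K.*2.+1.*2 + M j.+1 K.*2.+1.*2.+1).

Let I : set (measurableTypeR R) := `[0, M 0 0[%classic.
Let mI : measurable I. Proof. exact: measurable_itv. Qed.

(** The slot of a cell has the mass of this cell as its length, so the Riemann sums of [f]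
    are integrals over [[0, M 0 0[] of functions that converge to [f \o transport]. *)
Lemma transported_measure : exists m : {measure set (plane R) -> \bar R},
  (m setT < +oo)%E /\ forall f : R * R -> R, {within D, continuous f} ->
    \sum_(K < (4 ^ j)%N) f (corner j K) * M j K @[j --> \oo] --> \int[m]_(x in D) f x.
Proof.
have [nu nuE] : exists nu : {measure set (measurableTypeR R) -> \bar R},
    forall A, nu A = lebesgue_measure (A `&` I).
  by exists (mrestr lebesgue_measure mI).
have nuT : nu setT = (M 0 0)%:E.
  by rewrite nuE setTI [LHS]lebesgue_measure_co ?subr0.
have fnu : (nu setT < +oo)%E by rewrite nuT ltry.
have L1F (g : R -> R) (C : R) : measurable_fun setT (g : measurableTypeR R -> R) ->
    (forall t, `|g t| <= C) -> nu.-integrable setT (EFin \o g).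
  by move=> mg gC; exact: (finite_measure_integrable (C := C)).
have slotE j K (t : R) : (slot M j K t)%:R = \1_(`[cumul M j K, cumul M j K.+1[%classic) t :> R.
  by rewrite indicE mem_setE in_itv.
have mslot j K : measurable_fun setT (fun t : measurableTypeR R => (slot M j K t)%:R : R).
  under eq_fun do rewrite slotE; apply: measurable_indic; exact: measurable_itv.
have slotL1 j K : nu.-integrable setT (EFin \o (fun t : R => (slot M j K t)%:R)).
  by apply: (L1F _ 1) => // t; case: slot; rewrite ?normr0 ?normr1.
have slot_int j (K : 'I_(4 ^ j)) : \int[nu]_t (slot M j K t)%:R = M j K.
  rewrite /Rintegral; under eq_integral do rewrite slotE.
  have mJ : measurable (`[cumul M j K, cumul M j K.+1[%classic : set (measurableTypeR R)).
    exact: measurable_itv.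
  rewrite (integral_indic nu measurableT mJ).
  rewrite setIT nuE (_ : _ `&` I = `[cumul M j K, cumul M j K.+1[%classic).
    rewrite [X in fine X]lebesgue_measure_co ?cumulS ?lerDl//=.
    by rewrite addrAC subrr add0r.
  apply/seteqP; split => [t []//|t ht]; split => //.
  by rewrite /I/= in_itv/=; apply: (@slot_range _ _ M0 M4 j K) => //; rewrite /slot; move: ht; rewrite /= in_itv.
have loc_int j F : \int[nu]_t locate M j F t = \sum_(K < (4 ^ j)%N) F K * M j K.
  rewrite Rint_sum => [|K]; last by apply: L1_Z; exact: slotL1.
  by apply: eq_bigr => K _; rewrite RintegralZl// slot_int.
have [m [mE mint]] := pushforward_measure (measurable_transport M0 M4) fnu.
exists m; split; first by rewrite mE preimage_setT.
move=> f cf; have mD := @measurable_unit_square R.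
have [C hC] := within_continuous_bounded cf.
have mf : measurable_fun D (f : plane R -> R) by exact: within_continuous_measurable.
pose g := (f : plane R -> R) \_ D.
have mg : measurable_fun setT g by apply/(measurable_restrictT _ mD).
have gf x : D x -> g x = f x by move=> Dx; rewrite /g patchE mem_set.
have -> : \int[m]_(x in D) f x = \int[nu]_t (1 * g (transport M t)).
  transitivity (\int[m]_(x in D) g x).
    by apply: eq_Rintegral => x; rewrite inE => /gf.
  rewrite (mint _ _ C)//; last by move=> x Dx; rewrite gf// hC.
  rewrite (_ : transport M @^-1` D = setT); first by apply: eq_Rintegral => t _; rewrite mul1r.
  by apply/seteqP; split => // t _; exact: transport_square.
under eq_fun do rewrite -(loc_int _ (fun K => f (corner _ K))).
have C0 : 0 <= C by apply: le_trans (hC _ (corner_square 0 0)).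
have : \int[nu]_t (1 * locate M j (fun K => f (corner j K)) t) @[j --> \oo] -->
    \int[nu]_t (1 * g (transport M t)).
  apply: (Rint_dominated_ae (C := C)).
  - by apply: (L1F _ 1) => // t; rewrite normr1.
  - by move=> j; exact: measurable_locate.
  - by apply: measurableT_comp => //; exact: measurable_transport.
  - move=> j t; have [t0|t0] := boolP (0 <= t < M 0 0); last by rewrite locate_out// normr0.
    have [K Kj hK] := slot_exists M4 j t0.
    by rewrite (locateE M0 _ Kj hK) hC//; exact: corner_square.
  - exists (~` I); split.
    + exact: measurableC.
    + by rewrite nuE setICl measure0.
    + move=> t h It; apply: h => /=; rewrite gf; last exact: transport_square.
      by apply: locate_cvg => //; move: It; rewrite /I/= in_itv.
apply: cvg_trans; rewrite (_ : (fun j => _) = (fun j => \int[nu]_t locate M j (fun K => f (corner j K)) t))//.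
by apply/funext => j; apply: eq_Rintegral => t _; rewrite mul1r.
Qed.

End transported_measure.

Section zindex.
Context {R : realType}.
Local Notation D := (@unit_square R).

Definition digit (t : R) : bool := 2^-1 <= t.

Definition doubling (t : R) : R := 2 * t - (digit t)%:R.

(** The bits of the two coordinates, interleaved. The map [doubling] fixes 1, so
    that the cells partition the closed square. *)
Fixpoint zindex (j : nat) (x : plane R) : nat :=
  if j is j'.+1 then
    (digit (iter j' doubling x.2) + (digit (iter j' doubling x.1) + (zindex j' x).*2).*2)%N
  else 0%N.

Lemma zindex_lt j x : (zindex j x < 4 ^ j)%N.
Proof.
elim: j => [|j IH]//=; move: IH; rewrite expnS.
by case: digit; case: digit => /=; lia.
Qed.

Lemma zindex_half j x : (zindex j.+1 x)./2./2 = zindex j x.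
Proof. by rewrite /= !half_bit_double. Qed.

Lemma iter_doubling_01 j (t : R) : 0 <= t <= 1 -> 0 <= iter j doubling t <= 1.
Proof.
move=> t01; elim: j => [|j]//=; move: (iter j doubling t) => s; rewrite /doubling /digit.
by case: (leP 2^-1 s) => h /andP[h0 h1] /=; apply/andP; split; lra.
Qed.

Lemma corner_zindex j (x : plane R) :
  x.1 = (corner j (zindex j x)).1 + iter j doubling x.1 / 2 ^+ j /\
  x.2 = (corner j (zindex j x)).2 + iter j doubling x.2 / 2 ^+ j.
Proof.
elim: j => [|j [IH1 IH2]]; first by rewrite /= expr0 divr1 divr1 !add0r.
have o2 : odd (zindex j.+1 x) = digit (iter j doubling x.2).
  by rewrite /= oddD odd_double addbF oddb.
have o1 : odd (zindex j.+1 x)./2 = digit (iter j doubling x.1).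
  by rewrite /= half_bit_double oddD odd_double addbF oddb.
have cE : corner j.+1 (zindex j.+1 x) =
    ((corner j (zindex j x)).1 + (digit (iter j doubling x.1))%:R / 2 ^+ j.+1,
     (corner j (zindex j x)).2 + (digit (iter j doubling x.2))%:R / 2 ^+ j.+1) :> R * R.
  by rewrite -(zindex_half j x) -o1 -o2.
have e (t b : R) : b / 2 ^+ j.+1 + (2 * t - b) / 2 ^+ j.+1 = t / 2 ^+ j.
  by rewrite exprS; field; rewrite gt_eqF ?exprn_gt0.
by split; rewrite cE iterS -addrA e.
Qed.

Lemma corner_zindex_dist j (x : plane R) : D x ->
  `|x.1 - (corner j (zindex j x)).1| <= 2 ^- j /\ `|x.2 - (corner j (zindex j x)).2| <= 2 ^- j.
Proof.
move=> [/=]; rewrite !in_itv/= => /(iter_doubling_01 j)/andP[a1 a2] /(iter_doubling_01 j)/andP[b1 b2].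
have [e1 e2] := corner_zindex j x.
have p0 : 0 < 2 ^+ j :> R by rewrite exprn_gt0.
have b (t c r : R) : t = c + r / 2 ^+ j -> 0 <= r -> r <= 1 -> `|t - c| <= 2 ^- j.
  move=> -> r0 r1; rewrite addrAC subrr add0r ger0_norm ?divr_ge0 ?(ltW p0)//.
  by rewrite ler_piMl ?invr_ge0 ?(ltW p0).
by split; [exact: b e1 _ _|exact: b e2 _ _].
Qed.

Lemma measurable_digit : measurable_fun setT (fun t : measurableTypeR R => (digit t)%:R : R).
Proof.
rewrite (_ : (fun t => _) = \1_(`[2^-1, +oo[%classic)).
  by apply: measurable_indic; exact: measurable_itv.
by apply/funext => t; rewrite indicE mem_setE in_itv/= andbT.
Qed.

Lemma measurable_iter_doubling j :
  measurable_fun setT (iter j doubling : measurableTypeR R -> measurableTypeR R).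
Proof.
elim: j => [|j IH]; first exact: measurable_id.
apply: (measurable_funB (f := fun t => 2 * iter j doubling t)); first exact: measurable_funM.
exact: (measurableT_comp measurable_digit IH).
Qed.

Lemma measurable_zindex j : measurable_fun setT (fun x : plane R => (zindex j x)%:R : R).
Proof.
elim: j => [|j IH]; first exact: measurable_cst.
rewrite (_ : (fun x => _) = (fun x : plane R => (digit (iter j doubling x.2))%:R +
   (2 * (digit (iter j doubling x.1))%:R + 4 * (zindex j x)%:R))); last first.
  apply/funext => x /=; rewrite -!muln2 !natrD !natrM !natrD !natrM; ring.
have m2 : measurable_fun setT (fun x : plane R => (digit (iter j doubling x.2))%:R : R).
  exact: (measurableT_comp measurable_digit (measurableT_comp (measurable_iter_doubling j) measurable_snd)).
have m1 : measurable_fun setT (fun x : plane R => (digit (iter j doubling x.1))%:R : R).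
  exact: (measurableT_comp measurable_digit (measurableT_comp (measurable_iter_doubling j) measurable_fst)).
by apply: measurable_funD => //; apply: measurable_funD; exact: measurable_funM.
Qed.

Lemma measurable_zindex_eq j (K : nat) : measurable [set x : plane R | zindex j x = K].
Proof.
rewrite (_ : [set x | _] = (fun x : plane R => (zindex j x)%:R : R) @^-1` [set K%:R]).
  by rewrite -[X in measurable X]setTI; apply: measurable_zindex => //; exact: measurable_set1.
by apply/seteqP; split => x /= => [->//|/eqP]; rewrite eqr_nat => /eqP.
Qed.

Definition zcell j K : set (plane R) := D `&` [set x | zindex j x = K].

Lemma measurable_zcell j K : measurable (zcell j K).
Proof.
apply: measurableI; first exact: measurable_unit_square.
exact: measurable_zindex_eq.
Qed.

Lemma zcell_children j K : zcell j K =
  (zcell j.+1 K.*2.*2 `|` zcell j.+1 K.*2.*2.+1) `|` (zcell j.+1 K.*2.+1.*2 `|` zcell j.+1 K.*2.+1.*2.+1).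
Proof.
have h x : zindex j x = (zindex j.+1 x)./2./2 by rewrite zindex_half.
have key n : n./2./2 = K <-> (n = K.*2.*2 \/ n = K.*2.*2.+1) \/ (n = K.*2.+1.*2 \/ n = K.*2.+1.*2.+1).
  split=> [<-|]; last by lia.
  have := odd_double_half n; have := odd_double_half n./2.
  by case: (odd n); case: (odd n./2) => /=; lia.
rewrite /zcell -!setIUr; congr (_ `&` _); apply/seteqP; split => x; rewrite /setU /mkset h.
  exact: (key _).1.
exact: (key _).2.
Qed.

End zindex.

Section weak_compactness.
Context {R : realType}.
Local Notation D := (@unit_square R).
Implicit Types (mu m : {measure set (plane R) -> \bar R}).

Let mD : measurable (D : set (plane R)) := @measurable_unit_square R.

Definition zmass mu j K : R := fine (mu (zcell j K)).

Lemma zmass_ge0 mu j K : 0 <= zmass mu j K.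
Proof. by rewrite fine_ge0. Qed.

Lemma zmass_le mu j K : (mu setT < +oo)%E -> zmass mu j K <= fine (mu D).
Proof.
move=> fmu; apply: fine_le; rewrite ?ge0_fin_numE//.
- by apply: finite_sub => //; exact: measurable_zcell.
- exact: finite_sub.
- by apply: le_measure; rewrite ?inE//; [exact: measurable_zcell|exact: subIsetl].
Qed.

Lemma zmass_children mu j K : (mu setT < +oo)%E -> zmass mu j K =
  (zmass mu j.+1 K.*2.*2 + zmass mu j.+1 K.*2.*2.+1) +
  (zmass mu j.+1 K.*2.+1.*2 + zmass mu j.+1 K.*2.+1.*2.+1).
Proof.
move=> fmu; have mz := @measurable_zcell R.
have dis (A B : nat) : A <> B -> zcell j.+1 A `&` zcell j.+1 B = set0 :> set (plane R).
  by move=> AB; apply/seteqP; split => // x [[_ h1] [_ h2]]; apply: AB; rewrite -h1 -h2.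
have fin A : measurable A -> mu A \is a fin_num.
  by move=> mA; rewrite ge0_fin_numE//; exact: finite_sub.
rewrite /zmass zcell_children measureU ?measureU//; try exact: measurableU.
- by rewrite !fineD ?fin_numD ?fin.
- by apply: dis; lia.
- by apply: dis; lia.
- by rewrite setIUl !setIUr !dis ?setU0//; lia.
Qed.

Lemma Rint_zindex mu j (F : nat -> R) (C : R) : (mu setT < +oo)%E ->
  (forall K, `|F K| <= C) -> \int[mu]_(x in D) F (zindex j x) = \sum_(K < (4 ^ j)%N) F K * zmass mu j K.
Proof.
move=> fmu FC.
have m1 (K : 'I_(4 ^ j)) : mu.-integrable setT (EFin \o \1_(zcell j K)).
  apply: (finite_measure_integrable (C := 1)) => //.
    by apply: measurable_indic; exact: measurable_zcell.
  by move=> x _; rewrite indicE; case: (_ \in _); rewrite ?normr0 ?normr1.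
transitivity (\int[mu]_x (\sum_(K < (4 ^ j)%N) F K * \1_(zcell j K) x)).
  rewrite Rintegral_mkcond; apply: eq_Rintegral => x _; rewrite patchE.
  case: ifPn => [/set_mem Dx|/negP Dx]; last first.
    rewrite big1// => K _; rewrite indicE memNset ?mulr0// => -[Dx' _].
    by apply: Dx; rewrite inE.
  rewrite (bigD1 (Ordinal (zindex_lt j x)))//= indicE mem_set// mulr1 big1 ?addr0// => K KE.
  rewrite indicE memNset ?mulr0// => -[_ e].
  by move/negP: KE; apply; apply/eqP/val_inj/esym.
rewrite Rint_sum => [|K]; last exact: L1_Z.
apply: eq_bigr => K _; rewrite RintegralZl//; congr (_ * _).
by rewrite /Rintegral (integral_indic mu measurableT (measurable_zcell j K)) setIT.
Qed.

Lemma Rint_zindex_dist mu j (f : R * R -> R) (e : R) : (mu setT < +oo)%E ->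
  {within D, continuous f} -> (forall x, D x -> `|f x - f (corner j (zindex j x))| <= e) ->
  `|\int[mu]_(x in D) f x - \sum_(K < (4 ^ j)%N) f (corner j K) * zmass mu j K| <= e * fine (mu D).
Proof.
move=> fmu cf fe.
have [C hC] := within_continuous_bounded cf.
have fC (K : nat) : `|f (corner j K)| <= C by apply: hC; exact: corner_square.
rewrite -(@Rint_zindex mu j (fun K => f (corner j K)) C)//.
have mf : measurable_fun D (f : plane R -> R) by exact: within_continuous_measurable.
have mg : measurable_fun D (fun x : plane R => f (corner j (zindex j x))).
  apply: measurable_funTS; apply: (measurability _ (RGenOInfty.measurableE R)) => //.
  move=> _ [_ [a ->] <-]; rewrite setTI.
  rewrite (_ : _ @^-1` _ = \bigcup_(K in [set K | a < f (corner j K)]) [set x : plane R | zindex j x = K]).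
    by apply: bigcup_measurable => K _; exact: measurable_zindex_eq.
  apply/seteqP; split => [x /=|x [K /= h ->]]; rewrite in_itv/= andbT//.
  by move=> h; exists (zindex j x).
have fD : (mu D < +oo)%E by exact: finite_sub.
rewrite -RintegralB//; last 2 first.
- exact: (finite_measure_integrable (C := C)).
- exact: (finite_measure_integrable (C := C)).
apply: Rint_bound => //; exact: measurable_funB.
Qed.

(** Prokhorov's theorem on the square. The masses of the dyadic cells converge
    along a subsequence, and a consistent family of cell masses is realised by
    an image of Lebesgue measure on an interval. *)
Lemma weak_compactness (mu : nat -> {measure set (plane R) -> \bar R}) (C : R) :
  (forall n, (mu n setT < +oo)%E) -> (forall n, fine (mu n D) <= C) ->
  exists (psi : nat -> nat) (m : {measure set (plane R) -> \bar R}),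
    [/\ {homo psi : p q / (p < q)%N}, (m setT < +oo)%E &
      forall f : R * R -> R, {within D, continuous f} ->
        \int[mu (psi n)]_(x in D) f x @[n --> \oo] --> \int[m]_(x in D) f x].
Proof.
move=> fmu muC.
have [|psi hpsi ca] := @diagonal_extraction R (nat * nat)%type (fun n i => zmass (mu n) i.1 i.2).
  move=> i; exists C => n; rewrite ger0_norm ?zmass_ge0//.
  by apply: le_trans (muC n); exact: zmass_le.
pose M j K : R := limn (fun n => zmass (mu (psi n)) j K).
have cM j K : zmass (mu (psi n)) j K @[n --> \oo] --> M j K by exact: (ca (j, K)).
have M0 j K : 0 <= M j K.
  by apply: limr_ge; [apply/cvg_ex; exists (M j K)|apply: nearW => n; exact: zmass_ge0].
have M4 j K : M j K = (M j.+1 K.*2.*2 + M j.+1 K.*2.*2.+1) +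
   (M j.+1 K.*2.+1.*2 + M j.+1 K.*2.+1.*2.+1).
  apply/cvg_lim => //; under eq_fun do rewrite zmass_children//.
  by apply: cvgD; apply: cvgD.
have [m [fm hm]] := transported_measure M0 M4.
exists psi, m; split => // f cf.
have C0 : 0 <= C by apply: le_trans (muC 0); rewrite fine_ge0.
apply/cvgrPdist_le => e e0.
have e3 : 0 < e / 3 by rewrite divr_gt0.
have eC : 0 < e / 3 / (C + 1) by rewrite divr_gt0// ltr_wpDl.
have [J hJ] := within_square_uniform cf eC.
move/cvgrPdist_le : (hm f cf) => /(_ _ e3)[N _ hN].
pose j := maxn J N.
have h1 := hN j (leq_maxr J N).
have h2 n : `|\int[mu (psi n)]_(x in D) f x - \sum_(K < (4 ^ j)%N) f (corner j K) * zmass (mu (psi n)) j K| <= e / 3.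
  apply: le_trans (Rint_zindex_dist (e := e / 3 / (C + 1)) (fmu _) cf _) _.
    move=> x Dx; have [d1 d2] := corner_zindex_dist j Dx.
    have le : 2 ^- j <= 2 ^- J :> R.
      by rewrite lef_pV2 ?posrE ?exprn_gt0// ler_weXn2l ?ler1n ?leq_maxl.
    by apply: hJ => //; [exact: corner_square|exact: le_trans d1 le|exact: le_trans d2 le].
  apply: le_trans (ler_wpM2l (ltW eC) (muC _)) _.
  rewrite mulrAC (ler_pdivrMr _ _ (ltr_wpDl C0 ltr01)).
  by apply: ler_wpM2l; [exact: ltW|rewrite lerDl].
have h3 : \sum_(K < (4 ^ j)%N) f (corner j K) * zmass (mu (psi n)) j K @[n --> \oo] -->
    \sum_(K < (4 ^ j)%N) f (corner j K) * M j K.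
  by apply: cvgn_sum => K; apply: cvgMl_tmp; exact: cM.
move/cvgrPdist_le : h3 => /(_ _ e3)[P _ hP].
exists P => // n Pn; have h4 := hP n Pn.
rewrite [X in `|X|](_ : _ =
  (\int[m]_(x in D) f x - \sum_(K < (4 ^ j)%N) f (corner j K) * M j K) +
  (\sum_(K < (4 ^ j)%N) f (corner j K) * M j K - \sum_(K < (4 ^ j)%N) f (corner j K) * zmass (mu (psi n)) j K) +
  - (\int[mu (psi n)]_(x in D) f x - \sum_(K < (4 ^ j)%N) f (corner j K) * zmass (mu (psi n)) j K)); last by ring.
apply: le_trans (ler_normD _ _) _; rewrite normrN.
have := h2 n; have := ler_normD (\int[m]_(x in D) f x - \sum_(K < (4 ^ j)%N) f (corner j K) * M j K)
  (\sum_(K < (4 ^ j)%N) f (corner j K) * M j K - \sum_(K < (4 ^ j)%N) f (corner j K) * zmass (mu (psi n)) j K).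
move: h1 h4 => /=; lra.
Qed.

End weak_compactness.

(** * Limits of derivative charges *)

Section charge_limits.
Context {R : realType}.
Local Notation D := (@unit_square R).

Let mD : measurable (D : set (plane R)) := @measurable_unit_square R.

Lemma squeeze_dist (a b : nat -> R) (l : R) : (forall n, `|a n - l| <= b n) ->
  b n @[n --> \oo] --> 0 -> a n @[n --> \oo] --> l.
Proof.
move=> ab b0; apply/subr_cvg0; apply/norm_cvg0P.
by apply: (squeeze_cvgr _ (@cvg_cst _ 0 _ _ _) b0); apply: nearW => n; rewrite normr_ge0 ab.
Qed.

Lemma L1_cvg_pairing (u : plane R -> R) (u_ : nat -> plane R -> R) (h : plane R -> R) (C : R) :
  (lebD R).-integrable setT (EFin \o u) -> (forall n, (lebD R).-integrable setT (EFin \o u_ n)) ->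
  measurable_fun setT h -> (forall x, D x -> `|h x| <= C) ->
  \int[lebD R]_x `|u_ n x - u x| @[n --> \oo] --> 0 ->
  \int[lebD R]_x (u_ n x * h x) @[n --> \oo] --> \int[lebD R]_x (u x * h x).
Proof.
move=> iu iu_ mh hC cu.
pose g := h \_ D.
have mg : measurable_fun setT g.
  by apply/(measurable_restrictT _ mD); exact: measurable_funTS.
have gC x : `|g x| <= `|C|.
  rewrite /g patchE; case: ifPn => [/set_mem Dx|_]; last by rewrite normr0.
  by rewrite (le_trans (hC x Dx))// ler_norm.
have Lg v : (lebD R).-integrable setT (EFin \o v) ->
    (lebD R).-integrable setT (EFin \o (fun x => v x * g x)).
  by move=> iv; exact: (L1_mulr iv mg gC).
have gE v : (lebD R).-integrable setT (EFin \o v) ->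
    \int[lebD R]_x (v x * h x) = \int[lebD R]_x (v x * g x).
  move=> iv; apply/esym/ae_Rint_eq; first exact: Lg.
    by apply: measurable_funM => //; exact: L1_measurable iv.
  by apply: filterS (@ae_lebD_square R) => x Dx; rewrite /g patchE mem_set.
rewrite gE//; under eq_fun do rewrite gE//.
apply: (squeeze_dist (b := fun n => `|C| * \int[lebD R]_x `|u_ n x - u x|)) => [n|]; last first.
  by rewrite -[0](mulr0 `|C|); exact: cvgMl_tmp.
have id : (lebD R).-integrable setT (EFin \o (fun x => u_ n x - u x)) by exact: L1_B.
rewrite -RintegralB//; [|exact: Lg|exact: Lg].
under eq_Rintegral do rewrite -mulrBl.
apply: le_trans (Rint_le_norm _) _; first exact: (Lg _ id).
rewrite -RintegralZl//; last exact: L1_norm.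
apply: le_Rintegral => //.
- by apply: L1_norm; exact: (Lg _ id).
- by apply: L1_Z; exact: L1_norm.
- by move=> x _; rewrite normrM mulrC ler_wpM2r.
Qed.

(** Weak compactness applies to the two parts of the Jordan decompositions. When
    no variation is lost in the limit, neither limit measure charges the
    boundary, and the weak limit is the derivative itself. *)
Lemma charge_compactness (k : 'I_2) (u_ : nat -> L1D R) (u : L1D R)
    (nu : nat -> {charge set (plane R) -> \bar R}) (L : R) :
  \int[lebD R]_x `|u_ n x - u x| @[n --> \oo] --> 0 ->
  (forall n, is_derivative_charge k (u_ n) (nu n)) -> mass (nu n) @[n --> \oo] --> L ->
  exists (psi : nat -> nat) (nu' : {charge set (plane R) -> \bar R}),
    [/\ {homo psi : p q / (p < q)%N}, is_derivative_charge k u nu',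
      (partial_variation k u <= L%:E)%E &
      (L%:E <= partial_variation k u)%E -> forall f : R * R -> R, {within D, continuous f} ->
        charge_integral (nu (psi n)) D f @[n --> \oo] --> charge_integral nu' D f].
Proof.
move=> cu dnu cL.
pose p n : {finite_measure set (plane R) -> \bar R} := jordan_pos (hahnP (nu n)).
pose q n : {finite_measure set (plane R) -> \bar R} := jordan_neg (hahnP (nu n)).
have massD n : mass (nu n) = fine (p n D) + fine (q n D).
  by rewrite /mass /charge_variation fineD ?fin_num_measure.
have [C hC] : exists C, forall n, mass (nu n) <= C.
  have /cvg_seq_bounded[C [_ hC]] : cvgn (fun n => mass (nu n)) by apply/cvg_ex; exists L.
  exists (C + 1) => n; apply: le_trans (ler_norm _) _.
  by apply: (hC (C + 1)) => //; rewrite ltrDl.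
have finT (m : {finite_measure set (plane R) -> \bar R}) : (m setT < +oo)%E.
  by rewrite ltey_eq fin_num_measure.
have pC n : fine (p n D) <= C by apply: le_trans (hC n); rewrite massD lerDl fine_ge0.
have qC n : fine (q n D) <= C by apply: le_trans (hC n); rewrite massD lerDr fine_ge0.
have [psi1 [m1 [h1 f1 c1]]] := weak_compactness (mu := p) (fun n => finT (p n)) pC.
have [psi2 [m2 [h2 f2 c2]]] := weak_compactness (mu := q \o psi1) (fun n => finT (q (psi1 n))) (fun n => qC (psi1 n)).
pose psi := psi1 \o psi2.
have hpsi : {homo psi : x y / (x < y)%N} by exact: homo_ltn_comp.
have cvgI f : {within D, continuous f} -> charge_integral (nu (psi n)) D f @[n --> \oo] -->
    \int[m1]_(x in D) f x - \int[m2]_(x in D) f x.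
  move=> cf; apply: cvgB; last exact: c2.
  exact: (cvg_subseq h2 (c1 f cf)).
have rep : represents_derivative k u m1 m2.
  move=> phi tphi; have [sphi _] := tphi.
  have [_ mp [B hB]] := test_function_partial k sphi.
  have cphi : {within D, continuous phi}.
    by apply: continuous_subspaceT; have [] := sphi [::].
  have l1 := cvg_subseq hpsi (L1_cvg_pairing (L1D_L1 u) (fun n => L1D_L1 (u_ n)) mp hB cu).
  have l2 : (- charge_integral (nu (psi n)) D phi) @[n --> \oo] -->
      - (\int[m1]_(x in D) phi x - \int[m2]_(x in D) phi x) by exact: cvgN (cvgI _ cphi).
  rewrite -(cvg_lim (@Rhausdorff R) l1) -(cvg_lim (@Rhausdorff R) l2).
  by congr (limn _); apply/funext => n /=; have [_ ->] := dnu (psi n).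
have [nu' [dnu' mnu' inu']] := derivative_charge_of_measures f1 f2 rep.
have mI : measurable (D `&` D° : set (plane R)).
  by apply: measurableI => //; rewrite interior_unit_square; apply: measurableX; exact: measurable_itv.
have mID : measurable (D `\` (D `&` D°) : set (plane R)) by exact: measurableD.
have one_int (m : {measure set (plane R) -> \bar R}) : \int[m]_(x in D) (cst 1 : plane R -> R) x = fine (m D).
  by rewrite Rintegral_cst// mul1r.
have c1D : {within D, continuous (cst 1 : R * R -> R)} by apply: continuous_subspaceT => x; exact: cvg_cst.
have totL : fine (m1 D) + fine (m2 D) = L.
  have l1 : (fine (p (psi n) D) + fine (q (psi n) D)) @[n --> \oo] --> fine (m1 D) + fine (m2 D).
    under eq_fun do rewrite -!one_int; rewrite -!one_int; apply: cvgD; last exact: c2.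
    exact: (cvg_subseq h2 (c1 _ c1D)).
  rewrite -(cvg_lim (@Rhausdorff R) l1) -(cvg_lim (@Rhausdorff R) (cvg_subseq hpsi cL)).
  by congr (limn _); apply/funext => n; rewrite massD.
have split_mass (m : {measure set (plane R) -> \bar R}) : (m setT < +oo)%E ->
    fine (m D) = fine (m (D `&` D°)) + fine (m (D `\` (D `&` D°))).
  move=> fm.
  rewrite -fineD ?ge0_fin_numE//; try exact: finite_sub.
  by rewrite -(measureU m mI mID) ?setDIK// setDUK//; exact: subIsetl.
exists psi, nu'; split => //.
- apply: le_trans (partial_variation_le_mass dnu') _; rewrite lee_fin -totL.
  apply: le_trans mnu' _; rewrite (split_mass m1)// (split_mass m2)//.
  by apply: lerD; rewrite lerDl fine_ge0.
- move=> /le_trans/(_ (partial_variation_le_mass dnu')); rewrite lee_fin => Lm f cf.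
  have mf : measurable_fun D (f : plane R -> R) by exact: within_continuous_measurable.
  have bf := within_continuous_bounded cf.
  rewrite inu'//.
  have z1 : fine (m1 (D `\` (D `&` D°))) = 0 /\ fine (m2 (D `\` (D `&` D°))) = 0.
    have g1 : 0 <= fine (m1 (D `\` (D `&` D°))) by rewrite fine_ge0.
    have g2 : 0 <= fine (m2 (D `\` (D `&` D°))) by rewrite fine_ge0.
    move: totL; rewrite (split_mass m1)// (split_mass m2)// => totL.
    by split; apply/eqP; rewrite eq_le; apply/andP; split => //; lra.
  have [C' hC'] := bf.
  have restr (m : {measure set (plane R) -> \bar R}) : (m setT < +oo)%E ->
      fine (m (D `\` (D `&` D°))) = 0 ->
      \int[m]_(x in D `&` D°) f x = \int[m]_(x in D) f x.
    move=> fm z; rewrite /Rintegral; congr fine; apply/esym.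
    have int : m.-integrable D (EFin \o f).
      by apply: (finite_measure_integrable (C := C')) => //; exact: finite_sub.
    have z' : m (D `\` (D `&` D°)) = 0%E.
      by apply/eqP; rewrite -fine_eq0 ?z// ge0_fin_numE//; exact: finite_sub.
    apply: etrans (negligible_integral mID mD int z') _.
    by rewrite setDD setIA setIid.
  by rewrite !restr ?z1.1 ?z1.2//; exact: cvgI.
Qed.

End charge_limits.

(** * The data term *)

Section L2_functions.
Context d (T : measurableType d) (R : realType) (mu : {measure set T -> \bar R}).
Implicit Types (f g : T -> R).

Lemma sqr_Lnorm2 f : measurable_fun setT f ->
  ('N[mu]_2%:E[EFin \o f] ^+ 2 = \int[mu]_x (f x ^+ 2)%:E)%E.
Proof.
move=> mf; have h2 : (2 : R) != 0 by rewrite pnatr_eq0.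
have := @powR_Lnorm _ T R mu (EFin \o f) 2 h2 => h.
have -> : (\int[mu]_x (f x ^+ 2)%:E = \int[mu]_x `|(EFin \o f) x| `^ 2)%E.
  apply: eq_integral => x _ /=.
  by rewrite powR_mulrn// real_normK// num_real.
rewrite -h; move: h2; have := Lnorm_ge0 mu 2%:E (EFin \o f).
case: (Lnorm _ _ _) => [r r0 _|_ /negPf h2|]//=.
  by rewrite powR_mulrn// -EFin_expe.
by rewrite mulyy h2.
Qed.

Lemma Lnorm2_le f (M : R) : measurable_fun setT f ->
  (\int[mu]_x (f x ^+ 2)%:E <= M%:E)%E -> ('N[mu]_2%:E[EFin \o f] <= (M + 1)%:E)%E.
Proof.
move=> mf; rewrite -sqr_Lnorm2//; have := Lnorm_ge0 mu 2%:E (EFin \o f).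
case: (Lnorm _ _ _) => [r|_|]//=.
rewrite -EFinM !lee_fin => r0 rM.
have := sqr_ge0 (r - 1); nra.
Qed.

Lemma Lfun2_intro f : measurable_fun setT f -> ('N[mu]_2%:E[EFin \o f] < +oo)%E -> f \in Lfun mu 2%:E.
Proof. by move=> mf nf; rewrite inE; apply/andP; split; rewrite inE. Qed.

Lemma Lfun2_measurable f : f \in Lfun mu 2%:E -> measurable_fun setT f.
Proof. by rewrite inE => /andP[]; rewrite inE. Qed.

Lemma Lfun2_finite f : f \in Lfun mu 2%:E -> ('N[mu]_2%:E[EFin \o f] < +oo)%E.
Proof. by rewrite inE => /andP[_]; rewrite inE. Qed.

Lemma bounded_Lfun2 f (C : R) : (mu setT < +oo)%E -> measurable_fun setT f ->
  (forall x, `|f x| <= C) -> f \in Lfun mu 2%:E.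
Proof.
move=> fmu mf fC; apply: Lfun2_intro => //.
have := @Lnorm2_le f (C ^+ 2 * fine (mu setT)) mf => h.
apply: le_lt_trans (h _) (ltry _).
have mf2 : measurable_fun setT (fun x => f x ^+ 2) by exact: measurable_funX.
have fC2 x : setT x -> `|f x ^+ 2| <= C ^+ 2.
  by move=> _; rewrite normrX; apply: lerXn2r => //; rewrite nnegrE// (le_trans _ (fC x)).
have := Rint_bound measurableT fmu mf2 fC2.
rewrite -lee_fin => /(le_trans _); apply.
rewrite -(Rint_fin (finite_measure_integrable measurableT fmu mf2 fC2)) lee_fin.
exact: ler_norm.
Qed.

Lemma L2_pairing f g : f \in Lfun mu 2%:E -> g \in Lfun mu 2%:E ->
  mu.-integrable setT (EFin \o (fun x => f x * g x)) /\
  `|\int[mu]_x (f x * g x)| <= fine ('N[mu]_2%:E[EFin \o f]%E) * fine ('N[mu]_2%:E[EFin \o g]%E).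
Proof.
move=> lf lg; have i := (Lfun1_integrable mu _).1 (Lfun2_mul_Lfun1 lf lg).
split => //; apply: le_trans (Rint_le_norm i) _.
rewrite -lee_fin (Rint_fin (L1_norm i)) EFinM.
have fin h : h \in Lfun mu 2%:E -> (fine ('N[mu]_2%:E[EFin \o h]%E))%:E = ('N[mu]_2%:E[EFin \o h])%E.
  by move=> lh; rewrite fineK// ge0_fin_numE ?Lnorm_ge0//; exact: Lfun2_finite.
rewrite !fin//.
have h2 : 0 < 2 :> R by rewrite ltr0n.
have := @hoelder _ T R mu f g 2 2 (Lfun2_measurable lf) (Lfun2_measurable lg) h2 h2.
by rewrite Lnorm1; apply; rewrite [RHS]splitr !div1r.
Qed.

End L2_functions.

Section L1D_norms.
Context {R : realType}.

Lemma L1normE (u : L1D R) : L1norm u = (\int[lebD R]_x `|u x|)%:E.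
Proof. by rewrite /L1norm Lnorm1 (Rint_fin (L1_norm (L1D_L1 u))). Qed.

Lemma L1_cvgP (u_ : nat -> L1D R) (u : L1D R) :
  L1_cvg u_ u <-> \int[lebD R]_x `|u_ n x - u x| @[n --> \oo] --> 0.
Proof.
have e : (fun n => L1norm (u_ n - u)) = (fun n => (\int[lebD R]_x `|u_ n x - u x|)%:E).
  by apply/funext => n; rewrite L1normE.
rewrite /L1_cvg e; split => h; last exact: cvgn_EFin.
exact: (fine_cvg h).
Qed.

End L1D_norms.

(** Continuity along sequences that converge in [L^1] and are bounded in [L^2], in two
    halves: the lower half serves the passage to limits of minimizers, the upper half
    the recovery sequence. *)
Definition misfit_lsc (R : realType) (d : measurement R) : Prop :=
  forall (u_ : nat -> L1D R) (u : L1D R) (c : R), L1_cvg u_ u ->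
    (exists C : R, forall n, (L2norm (u_ n) <= C%:E)%E) ->
    (forall n, (misfit d (u_ n) <= c%:E)%E) -> (misfit d u <= c%:E)%E.

Definition misfit_usc (R : realType) (d : measurement R) : Prop :=
  forall (u_ : nat -> L1D R) (u : L1D R) (c : R), L1_cvg u_ u ->
    (exists C : R, forall n, (L2norm (u_ n) <= C%:E)%E) ->
    (misfit d u < c%:E)%E -> exists n, (misfit d (u_ n) < c%:E)%E.

Section function_data.
Context {R : realType} (Omega : set (R * R)) (oO : open Omega).
Variables (A : L1D R -> schwartz_distribution Omega) (m : L2_on oO).
Hypothesis hA : assumption_A oO A.

Let nm (g : L2_on oO) : R := fine ('N[leb_on oO]_2%:E[EFin \o g]%E).

Lemma leb_on_finite : (leb_on oO setT < +oo)%E.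
Proof.
have [bO _ _ _ _] := hA.
have [M hM] : exists M : R, forall x, Omega x -> `|x| <= M.
  by move: bO => [M [_ hM]]; exists (M + 1) => x Ox; apply: (hM (M + 1)) => //; rewrite ltrDl.
pose B : set (plane R) := `[- M, M]%classic `*` `[- M, M]%classic.
have OB : (Omega : set (plane R)) `<=` B.
  move=> x /hM; rewrite prod_normE ge_max => /andP[h1 h2].
  by split; rewrite /= in_itv/= -ler_norml.
have mB : measurable B by apply: measurableX; exact: measurable_itv.
rewrite [X in (X < _)%E](_ : _ = leb2 R Omega); last by rewrite /leb_on [LHS]mrestrE setTI.
apply: (@le_lt_trans _ _ (leb2 R B)).
  by apply: le_measure; rewrite ?inE//; exact: open_measurable_plane.
rewrite leb2X; [|exact: measurable_itv|exact: measurable_itv].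
have f : (lebesgue_measure (`[(- M)%R, M]%classic : set (measurableTypeR R)) < +oo)%E.
  by rewrite lebesgue_measure_itv/=; case: ifP => _; rewrite ?ltry// -EFinB ltry.
by rewrite lte_mul_pinfty// ge0_fin_numE.
Qed.

Lemma test_function_L2 phi : test_function Omega phi ->
  (phi : plane R -> R) \in Lfun (leb_on oO) 2%:E.
Proof.
move=> [sphi [K [cK KO vK]]].
have cphi : continuous phi by have [] := sphi [::].
have [M [_ hM]] : bounded_set (phi @` K).
  by apply: compact_bounded; apply: continuous_compact => //; exact: continuous_subspaceT.
apply: (@bounded_Lfun2 _ _ _ _ _ `|M + 1|); first exact: leb_on_finite.
  exact: continuous_measurable_plane.
move=> x; have [Kx|nKx] := pselect (K x); last by rewrite vK// normr0.
apply: le_trans (ler_norm _); apply: (hM (M + 1)); first by rewrite ltrDl.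
by exists x.
Qed.

Lemma nm_ge0 g : 0 <= nm g.
Proof. by rewrite fine_ge0// Lnorm_ge0. Qed.

Lemma nmE (g : L2_on oO) : 'N[leb_on oO]_2%:E[EFin \o g]%E = (nm g)%:E.
Proof. by rewrite /nm finite_norm_fine. Qed.

Lemma nm_triangle (g h k : L2_on oO) : nm (g - k) <= nm (g - h) + nm (h - k).
Proof.
have -> : g - k = (g - h) + (h - k) by rewrite addrA subrK.
exact: ler_LnormD.
Qed.

Lemma nm_dist (g h : L2_on oO) : nm (g - h) = nm (h - g).
Proof.
rewrite -[RHS]LnormrN; congr (fine _); apply: eq_Lnorm => x /=.
by rewrite opprB.
Qed.

Let represents_lim (u_ : nat -> L1D R) (u : L1D R) (g_ : nat -> L2_on oO) (g : L2_on oO) :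
  L1_cvg u_ u -> (forall n, represents (g_ n) (A (u_ n))) ->
  nm (g_ n - g) @[n --> \oo] --> 0 -> represents g (A u).
Proof.
move=> cu hg cg phi tphi.
have [_ _ _ _ hc] := hA; have lphi := test_function_L2 tphi.
have c2 : \int[leb_on oO]_x (g_ n x * phi x) @[n --> \oo] --> \int[leb_on oO]_x (g x * phi x).
  apply: (squeeze_dist (b := fun n => nm (g_ n - g) * fine ('N[leb_on oO]_2%:E[EFin \o phi]%E))); last first.
    by rewrite -[0](mul0r (fine ('N[leb_on oO]_2%:E[EFin \o phi]%E))); exact: cvgMr_tmp.
  move=> n.
  have [i1 _] := L2_pairing (LfunP (g_ n)) lphi.
  have [i2 _] := L2_pairing (LfunP g) lphi.
  rewrite -RintegralB//; under eq_Rintegral do rewrite -mulrBl.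
  by have [_] := L2_pairing (LfunP (g_ n - g)) lphi.
rewrite -(cvg_lim (@Rhausdorff R) (hc u_ u cu phi tphi)) -(cvg_lim (@Rhausdorff R) c2).
by congr (limn _); apply/funext => n /=; exact: hg.
Qed.

(** Compactness provides a limit of the representatives in [L^2(Omega)], and continuity
   into distributions identifies it as a representative of the image of the limit. *)
Let extract (u_ : nat -> L1D R) (u : L1D R) (g_ : nat -> L2_on oO) :
  L1_cvg u_ u -> (exists C : R, forall n, (L2norm (u_ n) <= C%:E)%E) ->
  (forall n, represents (g_ n) (A (u_ n))) ->
  exists (psi : nat -> nat) (g : L2_on oO), represents g (A u) /\
    nm (g_ (psi n) - g) @[n --> \oo] --> 0.
Proof.
move=> cu bu hg; have [_ _ _ hc _] := hA.
have [psi [g [hpsi cg]]] := hc u_ g_ bu hg.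
have cg' : nm (g_ (psi n) - g) @[n --> \oo] --> 0 by exact: (fine_cvg cg).
exists psi, g; split => //.
apply: (represents_lim (u_ := u_ \o psi) (g_ := g_ \o psi)) => // [|n]; last exact: hg.
exact: (cvg_subseq hpsi cu).
Qed.

Let dA := FunctionData A m.

Lemma misfit_function_lt u (c : R) : (misfit dA u < c%:E)%E <->
  exists g : L2_on oO, represents g (A u) /\ nm (g - m) ^+ 2 < c.
Proof.
split => [/ereal_inf_lt[_ [g hg <-]]|[g [hg gc]]].
  by rewrite nmE -EFin_expe lte_fin => gc; exists g.
apply: le_lt_trans (_ : (nm (g - m) ^+ 2)%:E < _)%E; last by rewrite lte_fin.
by apply: ereal_inf_lbound; exists g => //; rewrite nmE -EFin_expe.
Qed.

Lemma misfit_function_ge0 u : (0 <= misfit dA u)%E.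
Proof. by apply: le_ereal_inf_tmp => _ [g _ <-]; rewrite nmE -EFin_expe lee_fin sqr_ge0. Qed.

Lemma misfit_function_fin u : (L2norm u < +oo)%E -> (misfit dA u < +oo)%E.
Proof.
have [_ _ hr _ _] := hA; move=> /hr[g hg].
apply: (@lt_trans _ _ (nm (g - m) ^+ 2 + 1)%:E); last exact: ltry.
by apply/misfit_function_lt; exists g; split => //; rewrite ltrDl.
Qed.

Lemma misfit_function_lsc : misfit_lsc dA.
Proof.
move=> u_ u c cu bu hc; apply/lee_addgt0Pr => e e0.
have /choice[g_ hg] : forall n, exists g, represents g (A (u_ n)) /\ nm (g - m) ^+ 2 < c + e.
  move=> n; apply/misfit_function_lt; apply: le_lt_trans (hc n) _.
  by rewrite lte_fin ltrDl.
have [psi [g [rg cg]]] := extract cu bu (fun n => (hg n).1).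
have ce : 0 <= c + e by apply: le_trans (ltW (hg 0%N).2); exact: sqr_ge0.
have sq n : nm (g_ n - m) <= Num.sqrt (c + e).
  by rewrite -(ler_sqr (nm_ge0 _) (sqrtr_ge0 _)) sqr_sqrtr// ltW// (hg n).2.
have le : nm (g - m) <= Num.sqrt (c + e).
  apply/ler_addgt0Pr => e' e'0.
  have [N _ /(_ N (leqnn N)) hN] := cvgr0_norm_lt _ cg _ e'0.
  have := nm_triangle g (g_ (psi N)) m; have := sq (psi N); rewrite (nm_dist g (g_ (psi N))).
  by move: hN => /=; have := ler_norm (nm (g_ (psi N) - g)); lra.
have le2 : nm (g - m) ^+ 2 <= c + e.
  by rewrite -(sqr_sqrtr ce) ler_sqr ?nnegrE ?nm_ge0 ?sqrtr_ge0.
apply: le_trans (_ : (nm (g - m) ^+ 2)%:E <= _)%E; last by rewrite lee_fin.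
by apply: ereal_inf_lbound; exists g => //; rewrite nmE -EFin_expe.
Qed.

(** Representatives are not known to be unique, so a near optimal representative [g] of
    the limit is not compared with the limit [g'] of representatives [g_ n] directly: the
    functions [g_ n - g' + g] represent [A (u_ n)] and converge to [g]. *)
Lemma misfit_function_usc : misfit_usc dA.
Proof.
move=> u_ u c cu bu /misfit_function_lt[g [rg gc]].
have [_ _ hr _ _] := hA.
have hex n : exists g : L2_on oO, represents g (A (u_ n)).
  by apply: hr; have [C hC] := bu; exact: le_lt_trans (hC n) (ltry _).
have [g_ hg] := choice hex.
have [psi [g' [rg' cg]]] := extract cu bu hg.
have c0 : 0 <= c by apply: le_trans (ltW gc); exact: sqr_ge0.
have gs : nm (g - m) < Num.sqrt c.
  by rewrite -(ltr_sqr (nm_ge0 _) (sqrtr_ge0 _)) sqr_sqrtr.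
have e0 : 0 < Num.sqrt c - nm (g - m) by rewrite subr_gt0.
have [N _ /(_ N (leqnn N)) hN] := cvgr0_norm_lt _ cg _ e0.
exists (psi N); apply/misfit_function_lt.
pose h : L2_on oO := (g_ (psi N) - g') + g.
exists h; split.
  move=> phi tphi; have lphi := test_function_L2 tphi.
  have [i1 _] := L2_pairing (LfunP (g_ (psi N))) lphi.
  have [i2 _] := L2_pairing (LfunP g') lphi.
  have [i3 _] := L2_pairing (LfunP g) lphi.
  have [i4 _] := L2_pairing (LfunP (g_ (psi N) - g')) lphi.
  transitivity (\int[leb_on oO]_x ((g_ (psi N) - g') x * phi x) + \int[leb_on oO]_x (g x * phi x)).
    under [X in _ = X + _]eq_Rintegral do rewrite mulrBl.
    rewrite RintegralB// -(rg phi tphi) -(rg' phi tphi) subrK; exact: hg.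
  rewrite -RintegralD//; apply: eq_Rintegral => x _.
  by rewrite -mulrDl.
have tr : nm (h - m) <= nm (g_ (psi N) - g') + nm (g - m).
  have -> : h - m = (g_ (psi N) - g') + (g - m) by rewrite /h addrA.
  exact: ler_LnormD.
rewrite -(sqr_sqrtr c0) ltr_sqr ?nnegrE ?nm_ge0 ?sqrtr_ge0//.
by move: hN => /=; have := ler_norm (nm (g_ (psi N) - g')); lra.
Qed.

End function_data.

Section vector_data.
Context {R : realType} (M : nat).
Variables (A : L1D R -> 'rV[R]_M) (m : 'rV[R]_M).
Hypothesis hA : assumption_B A.

Let dB := VectorData A m.

Lemma sqr_euclid_norm (y : 'rV[R]_M) : euclid_norm y ^+ 2 = \sum_i y 0 i ^+ 2.
Proof. by rewrite sqr_sqrtr// sumr_ge0// => i _; exact: sqr_ge0. Qed.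

Lemma coord_le_euclid_norm (y : 'rV[R]_M) i : `|y 0 i| <= euclid_norm y.
Proof.
rewrite -ler_sqr ?nnegrE ?sqrtr_ge0// real_normK ?num_real// sqr_euclid_norm (bigD1 i)//= lerDl.
by apply: sumr_ge0 => j _; exact: sqr_ge0.
Qed.

Lemma misfit_vector_cvg (u_ : nat -> L1D R) (u : L1D R) : L1_cvg u_ u ->
  euclid_norm (A (u_ n) - m) ^+ 2 @[n --> \oo] --> euclid_norm (A u - m) ^+ 2.
Proof.
move=> /L1_cvgP cu; have [lin [C hC]] := hA.
have sub v w : A v - A w = A (v - w).
  have -> : v - w = -1 *: w + v by rewrite scaleN1r addrC.
  by rewrite lin scaleN1r addrC.
have cA i : A (u_ n) 0 i @[n --> \oo] --> A u 0 i.
  apply: (squeeze_dist (b := fun n => C * \int[lebD R]_x `|u_ n x - u x|)) => [n|]; last first.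
    by rewrite -[0](mulr0 C); exact: cvgMl_tmp.
  have -> : A (u_ n) 0 i - A u 0 i = (A (u_ n - u)) 0 i by rewrite -sub !mxE.
  apply: le_trans (coord_le_euclid_norm _ _) _.
  by have := hC (u_ n - u); rewrite L1normE -EFinM lee_fin.
under eq_fun do rewrite sqr_euclid_norm; rewrite sqr_euclid_norm.
apply: cvgn_sum => i.
under eq_fun do rewrite expr2; rewrite expr2.
have h : (A (u_ n) - m) 0 i @[n --> \oo] --> (A u - m) 0 i.
  by under eq_fun do rewrite !mxE; rewrite !mxE; apply: cvgB => //; exact: cvg_cst.
exact: cvgM.
Qed.

Lemma misfit_vector_lsc : misfit_lsc dB.
Proof.
move=> u_ u c cu _ hc; rewrite lee_fin.
have h := misfit_vector_cvg cu.
rewrite -(cvg_lim (@Rhausdorff R) h); apply: limr_le.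
  by apply/cvg_ex; exists (euclid_norm (A u - m) ^+ 2).
by apply: nearW => n; rewrite -lee_fin; exact: hc.
Qed.

Lemma misfit_vector_usc : misfit_usc dB.
Proof.
move=> u_ u c cu _; rewrite lte_fin => lt.
have h := misfit_vector_cvg cu.
have [N _ /(_ N (leqnn N)) hN] := cvgr_lt _ h _ lt.
by exists N; rewrite lte_fin.
Qed.

End vector_data.

Section admissible_data.
Context {R : realType} (d : measurement R).
Hypothesis hd : admissible d.

Lemma admissible_lsc : misfit_lsc d.
Proof. by move: hd; case: d => [W oO A m|M A m] h; [exact: misfit_function_lsc|exact: misfit_vector_lsc]. Qed.

Lemma admissible_usc : misfit_usc d.
Proof. by move: hd; case: d => [W oO A m|M A m] h; [exact: misfit_function_usc|exact: misfit_vector_usc]. Qed.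

Lemma misfit_ge0 u : (0 <= misfit d u)%E.
Proof.
move: hd; case: d => [W oO A m|M A m] h; first exact: misfit_function_ge0.
by rewrite lee_fin sqr_ge0.
Qed.

Lemma misfit_fin u : (L2norm u < +oo)%E -> (misfit d u < +oo)%E.
Proof.
move: hd; case: d => [W oO A m|M A m] h; first exact: misfit_function_fin.
by move=> _; exact: ltry.
Qed.

(** Upper semicontinuity along a sequence, from its weak form applied to a
    hypothetical bad subsequence. *)
Lemma misfit_near (u_ : nat -> L1D R) (u : L1D R) (c : R) : L1_cvg u_ u ->
  (exists C : R, forall n, (L2norm (u_ n) <= C%:E)%E) ->
  (misfit d u < c%:E)%E -> \forall n \near \oo, (misfit d (u_ n) < c%:E)%E.
Proof.
move=> cu [C hC] uc; apply: contrapT => H.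
have bad N : exists n, (N <= n)%N /\ ~ (misfit d (u_ n) < c%:E)%E.
  apply: contrapT => /forallNP h; apply: H; exists N => // n Nn.
  by apply: contrapT => hn; apply: (h n).
have [psi hpsi] := choice bad.
have cpsi : L1_cvg (u_ \o psi) u.
  exact: (cvg_comp psi (fun n => L1norm (u_ n - u)) (cvg_geq_oo (fun n => (hpsi n).1)) cu).
have [n] := admissible_usc cpsi (ex_intro _ C (fun n => hC (psi n))) uc.
exact: (hpsi n).2.
Qed.

End admissible_data.

(** * Functions of bounded variation *)

Section bounded_variation.
Context {R : realType}.
Local Notation L1 u := ((lebD R).-integrable setT (EFin \o u)).
Local Notation D := (@unit_square R).
Implicit Types (u v w : L1D R).

(** Locked to keep the infimum behind it from being unfolded. *)
Definition pvar : 'I_2 -> L1D R -> R :=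
  locked (fun (k : 'I_2) (u : L1D R) => fine (partial_variation k u)).

Lemma pvar_def k u : pvar k u = fine (partial_variation k u).
Proof. by rewrite /pvar -lock. Qed.

Lemma ord2_all (P : 'I_2 -> Prop) : P 0 -> P 1 -> forall k, P k.
Proof. by move=> P0 P1 k; case: (ord2P k) => ->. Qed.

Lemma partial_variation_ge0 k u : (0 <= partial_variation k u)%E.
Proof. by apply: le_ereal_inf_tmp => _ [nu _ <-]; rewrite -massE lee_fin mass_ge0. Qed.

Lemma pvar_ge0 k u : 0 <= pvar k u.
Proof. by rewrite pvar_def fine_ge0// partial_variation_ge0. Qed.

Lemma aniso_variationE u : aniso_variation u = (partial_variation 0%R u + partial_variation 1%R u)%E.
Proof. by rewrite /aniso_variation big_ord_recl big_ord1; congr (_ + partial_variation _ _)%E; exact: val_inj. Qed.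

Lemma BV_partial u : BV u <-> forall k, (partial_variation k u < +oo)%E.
Proof.
rewrite /BV/= aniso_variationE; split; last by move=> h; exact: lte_add_pinfty (h 0) (h 1).
have := partial_variation_ge0 0 u; have := partial_variation_ge0 1 u.
move=> p1 p0 h; apply: ord2_all.
  exact: le_lt_trans (leeDl _ p1) h.
exact: le_lt_trans (leeDr _ p0) h.
Qed.

Lemma BV_intro u (K : R) : (forall k, (partial_variation k u <= K%:E)%E) -> BV u.
Proof. by move=> h; apply/BV_partial => k; apply: le_lt_trans (h k) (ltry _). Qed.

Lemma pvarE k u : BV u -> (pvar k u)%:E = partial_variation k u.
Proof. by move=> /BV_partial/(_ k) h; rewrite pvar_def fineK// ge0_fin_numE ?partial_variation_ge0. Qed.

Lemma aniso_variation_pvar u : BV u -> aniso_variation u = (pvar 0 u + pvar 1 u)%:E.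
Proof. by move=> bu; rewrite aniso_variationE; move: (pvarE 0 bu) (pvarE 1 bu) => <- <-. Qed.

Lemma near_optimal_charge k u (e : R) : BV u -> 0 < e ->
  exists nu, is_derivative_charge k u nu /\ mass nu < pvar k u + e.
Proof.
move=> bu e0; have : (partial_variation k u < (pvar k u + e)%:E)%E.
  by rewrite -(pvarE k bu) lte_fin ltrDl.
by move=> /ereal_inf_lt[_ [nu hnu <-]]; rewrite -massE lte_fin => h; exists nu.
Qed.

Lemma pvar_le_mass k u nu : is_derivative_charge k u nu -> pvar k u <= mass nu.
Proof.
move=> h; have := partial_variation_le_mass h => le.
rewrite -lee_fin pvar_def fineK// ge0_fin_numE ?partial_variation_ge0//.
exact: le_lt_trans le (ltry _).
Qed.

Lemma dvar_le_pvar k u j : BV u -> 2 ^+ j * dvar k j (coef j u) <= pvar k u.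
Proof.
move=> bu; apply/ler_addgt0Pr => e e0.
have [nu [hnu lt]] := near_optimal_charge k bu e0.
exact: le_trans (dvar_le_mass j hnu) (ltW lt).
Qed.

Lemma dvar_le_bound u (K : R) : BV u -> (forall k, pvar k u <= K) ->
  forall j k, 2 ^+ j * dvar k j (coef j u) <= K.
Proof. by move=> bu uK j k; exact: le_trans (dvar_le_pvar k j bu) (uK k). Qed.

Lemma L1_L1D (f : plane R -> R) : L1 f -> exists u : L1D R, (u : plane R -> R) = f.
Proof.
move=> /Lfun1_integrable lf.
by exists (Lfun_Sub (lexx 1%E) lf); exact: Lfun_valP.
Qed.

(** The embedding of BV into [L^2], in the form that makes the compactness hypothesis on
    the operator applicable. *)
Lemma L2norm_BV u (K : R) : BV u -> \int[lebD R]_x `|u x| <= K -> (forall k, pvar k u <= K) ->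
  (L2norm u <= (4 * K ^+ 2 + 1)%:E)%E.
Proof.
move=> bu uK vK; apply: Lnorm2_le; first exact: L1_measurable (L1D_L1 u).
apply: le_trans (sobolev_L2 (L1D_L1 u) (fun j k => dvar_le_pvar k j bu)) _.
have K0 : 0 <= K by apply: le_trans (vK 0); exact: pvar_ge0.
have i0 : 0 <= \int[lebD R]_x `|u x| by apply: Rintegral_ge0.
rewrite lee_fin (_ : 4 * K ^+ 2 = (K + K) * (K + K)); last by ring.
have key (a p q : R) : 0 <= a -> a <= K -> 0 <= p -> p <= K -> 0 <= q -> q <= K ->
    (a + p) * (a + q) <= (K + K) * (K + K).
  by move=> *; apply: ler_pM; lra.
exact: (key _ _ _ i0 uK (pvar_ge0 0 u) (vK 0) (pvar_ge0 1 u) (vK 1)).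
Qed.

Lemma BV_L2 u : BV u -> (L2norm u < +oo)%E.
Proof.
move=> bu.
apply: le_lt_trans (L2norm_BV (K := \int[lebD R]_x `|u x| + (pvar 0 u + pvar 1 u)) bu _ _) (ltry _).
  by rewrite lerDl addr_ge0 ?pvar_ge0.
have i0 : 0 <= \int[lebD R]_x `|u x| by apply: Rintegral_ge0.
by apply: ord2_all; have := pvar_ge0 0 u; have := pvar_ge0 1 u; lra.
Qed.

Lemma ae_eq_of_dist (f g : plane R -> R) : L1 f -> L1 g -> \int[lebD R]_x `|f x - g x| = 0 ->
  {ae lebD R, forall x, f x = g x}.
Proof.
move=> i_f ig h.
have id := L1_B i_f ig.
have : (\int[lebD R]_(x in setT) `|(EFin \o (fun x => (f x - g x)%R)) x|)%E = 0%E.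
  by rewrite -[RHS]/(0%R%:E) -h (Rint_fin (L1_norm id)).
move/(ae_eq_integral_abs (lebD R) measurableT (measurable_int _ id)).
by apply: filterS => x /(_ I) /= [] /subr0_eq.
Qed.

Lemma range_step j u : range_dyadic_proj j u ->
  {ae lebD R, forall x, u x = step j (coef j u) x}.
Proof.
move=> [v lv uv].
have iv : L1 v.
  apply/Lfun1_integrable; apply: Lfun_subset12 lv.
  by rewrite lebD_setT.
have uv' : {ae lebD R, forall x, u x = step j (coef j v) x}.
  by apply: filterS uv => x /(_ I); rewrite dyadic_projE.
have cE i l : (i < 2 ^ j)%N -> (l < 2 ^ j)%N -> coef j v i l = coef j u i l.
  move=> ij lj; rewrite (eq_coef_ae j i l (L1D_L1 u) (L1_step j (coef j v)) uv').
  by rewrite (coef_step (coef j v) (Ordinal ij) (Ordinal lj)).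
by apply: filterS uv' => x ->; exact: eq_step.
Qed.

Lemma step_range j u : BV u -> {ae lebD R, forall x, u x = step j (coef j u) x} ->
  range_dyadic_proj j u.
Proof.
move=> bu h; exists u.
  by apply: Lfun2_intro; [exact: L1_measurable (L1D_L1 u)|exact: BV_L2].
by apply: filterS h => x e _; rewrite dyadic_projE//; exact: L1D_L1.
Qed.

(** A function is in the range of the projection when it is its own projection,
    and projections do not increase distances. *)
Lemma range_closed j (u_ : nat -> L1D R) u : BV u ->
  \int[lebD R]_x `|u_ n x - u x| @[n --> \oo] --> 0 ->
  (forall n, range_dyadic_proj j (u_ n)) -> range_dyadic_proj j u.
Proof.
move=> bu cu hr; apply: step_range => //.
apply: ae_eq_of_dist; [exact: L1D_L1|exact: L1_step|].
apply/eqP; rewrite eq_le Rintegral_ge0// andbT.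
have le n : \int[lebD R]_x `|u x - step j (coef j u) x| <= 2 * \int[lebD R]_x `|u_ n x - u x|.
  have -> : 2 * \int[lebD R]_x `|u_ n x - u x| = \int[lebD R]_x `|u x - u_ n x| + \int[lebD R]_x `|u_ n x - u x|.
    rewrite mulr_natl mulr2n; congr (_ + _).
    by apply: eq_Rintegral => x _; rewrite distrC.
  apply: le_trans (Rint_tri (L1D_L1 u) (L1D_L1 (u_ n)) (L1_step j (coef j u))) _.
  rewrite lerD2l; apply: le_trans (step_coef_contract j (L1D_L1 (u_ n)) (L1D_L1 u)).
  rewrite le_eqVlt; apply/orP; left; apply/eqP; apply: ae_Rint_eq.
  - by apply: L1_norm; apply: L1_B; [exact: L1D_L1|exact: L1_step].
  - by apply: L1_measurable; apply: L1_norm; apply: L1_B; exact: L1_step.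
  - by apply: filterS (range_step (hr n)) => x {1}->.
have c0 : (2 * \int[lebD R]_x `|u_ n x - u x|) @[n --> \oo] --> 0.
  by rewrite -[0](mulr0 2); exact: cvgMl_tmp.
rewrite -(cvg_lim (@Rhausdorff R) c0); apply: limr_ge.
  by apply/cvg_ex; exists 0.
exact: nearW.
Qed.

(** The recovery sequence. By the formula for step functions and the bound on the
    discrete variation, projecting increases neither of the partial variations. *)
Lemma projection_recovery u : BV u -> exists v_ : nat -> L1D R,
  [/\ forall j, range_dyadic_proj j (v_ j), forall j, BV (v_ j),
      forall j k, pvar k (v_ j) <= pvar k u,
      forall j, \int[lebD R]_x `|v_ j x| <= \int[lebD R]_x `|u x| &
      \int[lebD R]_x `|v_ j x - u x| @[j --> \oo] --> 0].
Proof.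
move=> bu.
have ex j : exists v : L1D R, (v : plane R -> R) = step j (coef j u) by apply: L1_L1D; exact: L1_step.
have [v_ hv] := choice ex.
have pv j k : (partial_variation k (v_ j) <= (pvar k u)%:E)%E.
  apply: has_variation_partial; rewrite hv.
  exact: has_variation_le (dvar_le_pvar k j bu) (has_variation_step k j (coef j u)).
have bv j : BV (v_ j) by apply/BV_partial => k; exact: le_lt_trans (pv j k) (ltry _).
exists v_; split => //.
- move=> j; apply: step_range => //; apply: aeW => x; rewrite [LHS](congr1 (@^~ x) (hv j)) hv.
  by apply: eq_step => i l ij lj; rewrite (coef_step (coef j u) (Ordinal ij) (Ordinal lj)).
- by move=> j k; rewrite -lee_fin (pvarE k (bv j)).
- by move=> j; rewrite hv Rint_norm_step; apply: sum_norm_coef_le; exact: L1D_L1.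
- have [_ hc] := step_coef_cvg (L1D_L1 u) (dvar_le_bound bu
    (ord2_all (P := fun k => pvar k u <= pvar 0 u + pvar 1 u)
      (ler_wpDr (pvar_ge0 1 u) (lexx _)) (ler_wpDl (pvar_ge0 0 u) (lexx _)))).
  apply: (squeeze_dist (b := fun j => 4 * (pvar 0 u + pvar 1 u) / 2 ^+ j)) => [j|].
    rewrite subr0 ger0_norm ?Rintegral_ge0// hv.
    by under eq_Rintegral do rewrite distrC.
  set K := 4 * _; rewrite (_ : (fun j => _) = geometric K 2^-1).
    by apply: cvg_geometric; rewrite ger0_norm ?invr_ge0// invf_lt1// ltr1n.
  by apply/funext => j; rewrite /geometric/= exprVn.
Qed.

Lemma BV_compactness (u_ : nat -> L1D R) (K : R) : (forall n, BV (u_ n)) ->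
  (forall n, \int[lebD R]_x `|u_ n x| <= K) -> (forall n k, pvar k (u_ n) <= K) ->
  exists (psi : nat -> nat) (w : L1D R), {homo psi : p q / (p < q)%N} /\
    \int[lebD R]_x `|u_ (psi n) x - w x| @[n --> \oo] --> 0.
Proof.
move=> bu uK vK.
have [psi [v [hpsi iv cv]]] := dvar_compactness (fun n => L1D_L1 (u_ n)) uK
  (fun n j k => dvar_le_bound (bu n) (vK n) j k).
have [w wv] := L1_L1D iv.
by exists psi, w; split => //; rewrite wv.
Qed.

(** Charges that are optimal up to [1 / (n + 1)] have masses with the same limits as the
    partial variations; a subsequence is extracted for one direction, then for the
    other. *)
Lemma BV_limit (u_ : nat -> L1D R) u (L : 'I_2 -> R) : (forall n, BV (u_ n)) ->
  \int[lebD R]_x `|u_ n x - u x| @[n --> \oo] --> 0 ->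
  (forall k, pvar k (u_ n) @[n --> \oo] --> L k) ->
  [/\ BV u, forall k, pvar k u <= L k &
    (forall k, L k <= pvar k u) -> exists psi : nat -> nat,
      {homo psi : p q / (p < q)%N} /\ weak_BV_cvg (u_ \o psi) u].
Proof.
move=> bu cu cL.
have e0 (n : nat) : 0 < n.+1%:R^-1 :> R by rewrite invr_gt0.
have ex n : exists nu : 'I_2 -> {charge set (plane R) -> \bar R}, forall k,
    is_derivative_charge k (u_ n) (nu k) /\ mass (nu k) < pvar k (u_ n) + n.+1%:R^-1.
  have [nu0 h0] := near_optimal_charge 0 (bu n) (e0 n).
  have [nu1 h1] := near_optimal_charge 1 (bu n) (e0 n).
  by exists (fun k => if k == 0 then nu0 else nu1); apply: ord2_all.
have [nu_ hnu] := choice ex.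
have cm k : mass (nu_ n k) @[n --> \oo] --> L k.
  apply: (squeeze_cvgr _ (cL k)); last first.
    by rewrite -[L k]addr0; apply: cvgD; [exact: cL|exact: cvg_harmonic].
  apply: nearW => n; have [h1 h2] := hnu n k.
  by rewrite (pvar_le_mass h1) ltW.
have [psi0 [nu0 [hpsi0 d0 le0 w0]]] := charge_compactness cu (fun n => (hnu n 0).1) (cm 0).
have cu0 : \int[lebD R]_x `|u_ (psi0 n) x - u x| @[n --> \oo] --> 0.
  exact: (cvg_subseq hpsi0 cu).
have cm1 : mass (nu_ (psi0 n) 1) @[n --> \oo] --> L 1 by exact: (cvg_subseq hpsi0 (cm 1)).
have [psi1 [nu1 [hpsi1 d1 le1 w1]]] := charge_compactness (u_ := u_ \o psi0) cu0
  (fun n => (hnu (psi0 n) 1).1) cm1.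
have le : forall k, (partial_variation k u <= (L k)%:E)%E by apply: ord2_all.
have bu' : BV u by apply/BV_partial => k; exact: le_lt_trans (le k) (ltry _).
split => //; first by move=> k; rewrite -lee_fin (pvarE k bu').
move=> Lle; exists (psi0 \o psi1); have hpsi := homo_ltn_comp hpsi0 hpsi1.
split => //; split; first by apply/L1_cvgP; exact: (cvg_subseq hpsi cu).
pose nu (k : 'I_2) := if k == 0 then nu0 else nu1.
have Lle' k : ((L k)%:E <= partial_variation k u)%E by rewrite -(pvarE k bu') lee_fin.
exists (fun n => nu_ ((psi0 \o psi1) n)), nu; split.
- by move=> n k; exact: (hnu _ k).1.
- exact: ord2_all.
move=> f cf; apply: cvgn_sum; apply: ord2_all.
- exact: (cvg_subseq hpsi1 (w0 (Lle' 0) (f 0) (cf 0))).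
- exact: (w1 (Lle' 1) (f 1) (cf 1)).
Qed.

End bounded_variation.

(** * The direct method *)

Section functional.
Context {R : realType} (alpha1 alpha : R) (halpha1 : 0 < alpha1) (halpha : 0 < alpha).
Context (d : measurement R) (hd : admissible d).
Implicit Types (u v w : L1D R).

Definition data_term : L1D R -> R := locked (fun u => fine (misfit d u)).

Lemma data_term_ge0 u : 0 <= data_term u.
Proof. by rewrite /data_term -lock fine_ge0// misfit_ge0. Qed.

Lemma data_termE u : BV u -> (data_term u)%:E = misfit d u.
Proof.
move=> bu; rewrite /data_term -lock fineK// ge0_fin_numE ?misfit_ge0//.
by apply: misfit_fin => //; exact: BV_L2.
Qed.

Definition L1_dist u v : R := \int[lebD R]_x `|u x - v x|.

Definition L1_mass u : R := \int[lebD R]_x `|u x|.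

Definition energy u : R := data_term u + alpha1 * L1_mass u + alpha * (pvar 0 u + pvar 1 u).

Lemma L1_mass_ge0 u : 0 <= L1_mass u.
Proof. exact: Rintegral_ge0. Qed.

Lemma L1_mass_dist u v : `|L1_mass u - L1_mass v| <= L1_dist u v.
Proof.
have iu := L1D_L1 u; have iv := L1D_L1 v; have id := L1_B iu iv.
rewrite /L1_mass /L1_dist -RintegralB//; [|exact: L1_norm|exact: L1_norm].
apply: le_trans (Rint_le_norm (L1_B (L1_norm iu) (L1_norm iv))) _.
apply: le_Rintegral => //; first by apply: L1_norm; apply: L1_B; exact: L1_norm.
  exact: L1_norm.
by move=> x _; exact: ler_dist_dist.
Qed.

Lemma S_infE u : BV u -> S_inf d alpha1 alpha u = (energy u)%:E.
Proof.
move=> bu; rewrite /S_inf /energy L1normE aniso_variation_pvar// -data_termE//.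
Qed.

Lemma energy_bounds u : [/\ data_term u <= energy u, L1_mass u <= energy u / alpha1,
  pvar 0 u <= energy u / alpha & pvar 1 u <= energy u / alpha].
Proof.
have := data_term_ge0 u; have := L1_mass_ge0 u; have := pvar_ge0 0 u; have := pvar_ge0 1 u.
rewrite /energy; move: (data_term u) (L1_mass u) (pvar 0 u) (pvar 1 u) => r l p q q0 p0 l0 r0.
have l1 : 0 <= alpha1 * l by rewrite mulr_ge0// ltW.
have p1 : 0 <= alpha * p by rewrite mulr_ge0// ltW.
have q1 : 0 <= alpha * q by rewrite mulr_ge0// ltW.
split; rewrite ?(ler_pdivlMr _ _ halpha) ?(ler_pdivlMr _ _ halpha1); lra.
Qed.

Lemma bounded_energy (u_ : nat -> L1D R) (C : R) : (forall n, energy (u_ n) <= C) ->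
  exists K, [/\ forall n, data_term (u_ n) <= K, forall n, L1_mass (u_ n) <= K &
    forall n k, pvar k (u_ n) <= K].
Proof.
move=> uC.
have C0 : 0 <= C.
  by apply: le_trans (uC 0%N); have [h _ _ _] := energy_bounds (u_ 0%N); exact: le_trans (data_term_ge0 _) h.
have c1 : 0 <= C / alpha1 by rewrite divr_ge0// ltW.
have c2 : 0 <= C / alpha by rewrite divr_ge0// ltW.
have b n : [/\ data_term (u_ n) <= C, L1_mass (u_ n) <= C / alpha1,
    pvar 0 (u_ n) <= C / alpha & pvar 1 (u_ n) <= C / alpha].
  have [h1 h2 h3 h4] := energy_bounds (u_ n).
  have i1 : 0 <= alpha1^-1 by rewrite invr_ge0 ltW.
  have i2 : 0 <= alpha^-1 by rewrite invr_ge0 ltW.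
  split; first exact: le_trans h1 (uC n).
  - exact: le_trans h2 (ler_wpM2r i1 (uC n)).
  - exact: le_trans h3 (ler_wpM2r i2 (uC n)).
  - exact: le_trans h4 (ler_wpM2r i2 (uC n)).
exists (C + (C / alpha1 + C / alpha)); split.
- by move=> n; have [h _ _ _] := b n; lra.
- by move=> n; have [_ h _ _] := b n; lra.
- by move=> n; apply: ord2_all; have [_ _ h h'] := b n; lra.
Qed.

Lemma L2_bounded (u_ : nat -> L1D R) (K : R) : (forall n, BV (u_ n)) ->
  (forall n, L1_mass (u_ n) <= K) -> (forall n k, pvar k (u_ n) <= K) ->
  exists C : R, forall n, (L2norm (u_ n) <= C%:E)%E.
Proof. by move=> bu uK vK; exists (4 * K ^+ 2 + 1) => n; exact: L2norm_BV (bu n) (uK n) (vK n). Qed.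

(** The lower bound. Each of the four terms of the energy is lower semicontinuous, so if the
    energies do not drop in the limit then no term does. *)
Lemma energy_lsc (u_ : nat -> L1D R) u (s : R) : (forall n, BV (u_ n)) ->
  L1_dist (u_ n) u @[n --> \oo] --> 0 -> energy (u_ n) @[n --> \oo] --> s ->
  [/\ BV u, energy u <= s & s <= energy u -> exists psi : nat -> nat,
    [/\ {homo psi : p q / (p < q)%N}, weak_BV_cvg (u_ \o psi) u &
      intermediate_BV_cvg (u_ \o psi) u]].
Proof.
move=> bu cu cs.
have [C hC] : exists C, forall n, energy (u_ n) <= C.
  have /cvg_seq_bounded[C [_ hC]] : cvgn (fun n => energy (u_ n)) by apply/cvg_ex; exists s.
  exists (C + 1) => n; apply: le_trans (ler_norm _) _.
  by apply: (hC (C + 1)) => //; rewrite ltrDl.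
have [K [rK lK vK]] := bounded_energy hC.
have [|phi hphi ca] := @diagonal_extraction R (option 'I_2)
    (fun n i => if i is Some k then pvar k (u_ n) else data_term (u_ n)).
  by case=> [k|]; exists K => n; [rewrite ger0_norm ?pvar_ge0|rewrite ger0_norm ?data_term_ge0].
pose L k : R := limn (fun n => pvar k (u_ (phi n))).
pose l : R := limn (fun n => data_term (u_ (phi n))).
have cL k : pvar k (u_ (phi n)) @[n --> \oo] --> L k by exact: (ca (Some k)).
have cl : data_term (u_ (phi n)) @[n --> \oo] --> l by exact: (ca None).
have cphi : L1_dist (u_ (phi n)) u @[n --> \oo] --> 0 by exact: (cvg_subseq hphi cu).
have [bu' leL weak] := BV_limit (u_ := u_ \o phi) (fun n => bu (phi n)) cphi cL.
have cmass : L1_mass (u_ (phi n)) @[n --> \oo] --> L1_mass u.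
  exact: (squeeze_dist (fun n => L1_mass_dist (u_ (phi n)) u) cphi).
have rl : data_term u <= l.
  apply/ler_addgt0Pr => e e0.
  have [N _ hN] : \forall n \near \oo, data_term (u_ (phi n)) < l + e.
    by apply: (cvgr_lt _ cl); rewrite ltrDl.
  rewrite -lee_fin data_termE//.
  apply: (admissible_lsc hd (u_ := fun n => u_ (phi (n + N)%N))).
  - apply/L1_cvgP; have := cphi; rewrite -(cvg_shiftn N); exact.
  - exact: (L2_bounded (u_ := fun n => u_ (phi (n + N)%N)) (fun n => bu _) (fun n => lK _) (fun n => vK _)).
  - by move=> n; rewrite -data_termE// lee_fin ltW// hN//= leq_addl.
have sE : s = l + alpha1 * L1_mass u + alpha * (L 0 + L 1).
  have h : energy (u_ (phi n)) @[n --> \oo] --> l + alpha1 * L1_mass u + alpha * (L 0 + L 1).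
    apply: cvgD; first by apply: cvgD => //; exact: cvgMl_tmp.
    by apply: cvgMl_tmp; apply: cvgD; exact: cL.
  by rewrite -(cvg_lim (@Rhausdorff R) h) -(cvg_lim (@Rhausdorff R) (cvg_subseq hphi cs)).
have lv : alpha * (pvar 0 u + pvar 1 u) <= alpha * (L 0 + L 1).
  by rewrite (ler_pM2l halpha); apply: lerD; exact: leL.
split => //; first by rewrite sE /energy; move: lv rl; lra.
move=> su.
have Lle k : L k <= pvar k u.
  have sum : L 0 + L 1 <= pvar 0 u + pvar 1 u.
    by rewrite -(ler_pM2l halpha); move: su rl; rewrite sE /energy; lra.
  by move: k; apply: ord2_all; move: sum (leL 0) (leL 1); lra.
have [psi [hpsi w]] := weak Lle.
exists (phi \o psi); split => //; first exact: homo_ltn_comp.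
split; first exact: w.1.
rewrite (aniso_variation_pvar bu').
under eq_fun do rewrite (aniso_variation_pvar (bu _)).
apply: cvgn_EFin; have Le k : pvar k u = L k by apply/eqP; rewrite eq_le leL Lle.
rewrite !Le; apply: cvgD; exact: (cvg_subseq hpsi (cL _)).
Qed.

(** The direct method in a class that is closed under [L^1] limits: it serves both for
    the whole of BV and for the range of a projection. *)
Lemma minimizer_exists (P : L1D R -> Prop) : (exists u, BV u /\ P u) ->
  (forall (u_ : nat -> L1D R) u, BV u -> L1_dist (u_ n) u @[n --> \oo] --> 0 -> (forall n : nat, P (u_ n)) -> P u) ->
  exists u, [/\ BV u, P u & forall v, BV v -> P v -> energy u <= energy v].
Proof.
move=> [u0 [bu0 Pu0]] Pc.
pose E := [set energy u | u in [set u | BV u /\ P u]].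
have hE : has_inf E.
  split; first by exists (energy u0), u0.
  exists 0 => _ [u _ <-]; have [h _ _ _] := energy_bounds u.
  exact: le_trans (data_term_ge0 u) h.
have e0 (n : nat) : 0 < n.+1%:R^-1 :> R by rewrite invr_gt0.
have ex n : exists u, [/\ BV u, P u & energy u < inf E + n.+1%:R^-1].
  by have [_ [u [bu Pu] <-] lt] := inf_adherent (e0 n) hE; exists u.
have [u_ hu] := choice ex.
have lb v : BV v -> P v -> inf E <= energy v.
  by move=> bv Pv; apply: ge_inf; [exact: hE.2|exists v].
have cE : energy (u_ n) @[n --> \oo] --> inf E.
  apply: (squeeze_dist (b := fun n => n.+1%:R^-1)); last exact: cvg_harmonic.
  by move=> n; have [bv Pv lt] := hu n; rewrite ger0_norm ?subr_ge0 ?lb// lerBlDl ltW.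
have [K [_ lK vK]] : exists K, [/\ forall n, data_term (u_ n) <= K, forall n, L1_mass (u_ n) <= K &
    forall n k, pvar k (u_ n) <= K].
  apply: (bounded_energy (C := inf E + 1)) => n; have [_ _ lt] := hu n.
  by apply: le_trans (ltW lt) _; rewrite lerD2l invf_le1// ler1n.
have [psi [w [hpsi cw]]] := BV_compactness (fun n => (let: And3 h _ _ := hu n in h)) lK vK.
have [bw Ew _] := energy_lsc (u_ := u_ \o psi) (fun n => (let: And3 h _ _ := hu (psi n) in h)) cw
  (cvg_subseq hpsi cE).
exists w; split => //.
- by apply: (Pc (u_ \o psi)) => // n; have [] := hu (psi n).
- by move=> v bv Pv; exact: le_trans Ew (lb v bv Pv).
Qed.

Lemma BV_0 : BV (0 : L1D R).
Proof.
apply: (BV_intro (K := 0)) => k; apply: has_variation_partial.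
exact: has_variation_cst0.
Qed.

Lemma energy_minimizer : exists u, BV u /\ forall v, BV v -> energy u <= energy v.
Proof.
have [||u [bu _ hu]] := @minimizer_exists (fun=> True) => //; first by exists 0; split => //; exact: BV_0.
by exists u; split => // v bv; exact: hu.
Qed.

Lemma range_minimizer j : exists u, [/\ BV u, range_dyadic_proj j u &
  forall v, BV v -> range_dyadic_proj j v -> energy u <= energy v].
Proof.
apply: minimizer_exists.
  by have [v_ [h1 h2 _ _ _]] := projection_recovery BV_0; exists (v_ j).
by move=> u_ u bu cu hr; exact: range_closed bu cu hr.
Qed.

Lemma infBV_S_inf u : BV u -> (forall v, BV v -> energy u <= energy v) ->
  infBV (S_inf d alpha1 alpha) = (energy u)%:E.
Proof.
move=> bu hu; apply/eqP; rewrite eq_le; apply/andP; split.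
  by apply: ereal_inf_lbound; exists u => //; rewrite S_infE.
by apply: le_ereal_inf_tmp => _ [v bv <-]; rewrite S_infE// lee_fin hu.
Qed.

Lemma S_E j u : BV u -> range_dyadic_proj j u -> S_ d alpha1 alpha j u = (energy u)%:E.
Proof. by move=> bu ru; rewrite /S_ asboolT// S_infE. Qed.

Lemma infBV_S j u : BV u -> range_dyadic_proj j u ->
  (forall v, BV v -> range_dyadic_proj j v -> energy u <= energy v) ->
  infBV (S_ d alpha1 alpha j) = (energy u)%:E.
Proof.
move=> bu ru hu; apply/eqP; rewrite eq_le; apply/andP; split.
  by apply: ereal_inf_lbound; exists u => //; rewrite S_E.
apply: le_ereal_inf_tmp => _ [v bv <-]; rewrite /S_.
by case: asboolP => rv; rewrite ?leey// S_infE// lee_fin hu.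
Qed.

(** The projections of a minimizer over BV have energies that are eventually at
    most slightly larger. *)
Lemma min_energy_cvg (s_ : nat -> R) u : BV u ->
  (forall j, energy u <= s_ j) ->
  (forall j v, BV v -> range_dyadic_proj j v -> s_ j <= energy v) ->
  s_ j @[j --> \oo] --> energy u.
Proof.
move=> bu lb ub.
have [v_ [rv bv vv lv cv]] := projection_recovery bu.
apply/cvgrPdist_le => e e0.
have mu : (misfit d u < (data_term u + e)%:E)%E by rewrite -data_termE// lte_fin ltrDl.
have bL2 : exists C : R, forall n, (L2norm (v_ n) <= C%:E)%E.
  apply: (L2_bounded (K := L1_mass u + (pvar 0 u + pvar 1 u))) => // [n|n].
    by apply: le_trans (lv n) _; rewrite lerDl addr_ge0 ?pvar_ge0.
  apply: ord2_all; have := L1_mass_ge0 u; have := pvar_ge0 0 u; have := pvar_ge0 1 u;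
    have := vv n 0; have := vv n 1; lra.
have := misfit_near hd ((L1_cvgP v_ u).2 cv) bL2 mu.
apply: filterS => j; rewrite -data_termE// lte_fin => lt.
rewrite distrC ger0_norm ?subr_ge0// lerBlDl.
apply: le_trans (ub j (v_ j) (bv j) (rv j)) _; rewrite /energy.
have h1 : alpha1 * L1_mass (v_ j) <= alpha1 * L1_mass u by rewrite (ler_pM2l halpha1) lv.
have h2 : alpha * (pvar 0 (v_ j) + pvar 1 (v_ j)) <= alpha * (pvar 0 u + pvar 1 u).
  by rewrite (ler_pM2l halpha); apply: lerD; exact: vv.
move: h1 h2 lt; lra.
Qed.

End functional.

Theorem theorem3p1 (R : realType) (alpha1 alpha : R) (halpha1 : 0 < alpha1)
    (halpha : 0 < alpha) (d : measurement R) (hd : admissible d) :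
  let Sinf := S_inf d alpha1 alpha in
  let S := S_ d alpha1 alpha in
  [/\ infBV (S j) @[j --> \oo] --> infBV Sinf,
      forall j, (0 < j)%N -> exists u, argminBV (S j) u,
      exists u, argminBV Sinf u,
      forall u_ : nat -> L1D R,
        (forall j, (0 < j)%N -> argminBV (S j) (u_ j)) ->
        exists (psi : nat -> nat) (w : L1D R),
          [/\ {homo psi : p q / (p < q)%N}, forall l, (0 < psi l)%N, BV w,
              weak_BV_cvg (u_ \o psi) w & intermediate_BV_cvg (u_ \o psi) w]
    & forall u_ : nat -> L1D R,
        (forall j, (0 < j)%N -> argminBV (S j) (u_ j)) ->
        forall (psi : nat -> nat) (w : L1D R),
          {homo psi : p q / (p < q)%N} -> (forall l, (0 < psi l)%N) -> BV w ->
          weak_BV_cvg (u_ \o psi) w -> intermediate_BV_cvg (u_ \o psi) w ->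
          argminBV Sinf w].
Proof.
move=> Sinf S.
pose E := energy alpha1 alpha d.
have [ui [bi mi]] := energy_minimizer halpha1 halpha hd.
have [m_ hm] := choice (range_minimizer halpha1 halpha hd).
have infi : infBV Sinf = (E ui)%:E by exact: infBV_S_inf hd _ bi mi.
have infj j : infBV (S j) = (E (m_ j))%:E.
  by have [bj rj mj] := hm j; exact: (infBV_S hd bj rj mj).
have cE : E (m_ j) @[j --> \oo] --> E ui.
  apply: (min_energy_cvg halpha1 halpha hd bi) => [j|j v bv rv].
    by have [bj _ _] := hm j; exact: mi.
  by have [_ _] := hm j; exact.
(* A minimizer of [S j] has finite energy, hence lies in the range. *)
have argj j u : argminBV (S j) u -> BV u /\ E u = E (m_ j).
  move=> [bu]; rewrite infj /S /S_; case: asboolP => // _.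
  by rewrite (S_infE _ _ hd bu) => -[].
have argi u : BV u -> E u <= E ui -> argminBV Sinf u.
  move=> bu le; split => //; rewrite infi /Sinf (S_infE _ _ hd bu).
  by congr (_%:E); apply/eqP; rewrite eq_le le mi.
(* Energies of minimizers along any subsequence tend to the minimal energy. *)
have sub (u_ : nat -> L1D R) (psi : nat -> nat) :
    (forall j, (0 < j)%N -> argminBV (S j) (u_ j)) ->
    {homo psi : p q / (p < q)%N} -> (forall l, (0 < psi l)%N) ->
    (forall n, BV (u_ (psi n))) /\ E (u_ (psi n)) @[n --> \oo] --> E ui.
  move=> hu hpsi psi0; split => [n|]; first by have [] := argj _ _ (hu _ (psi0 n)).
  have := cvg_subseq hpsi cE; apply: cvg_trans.
  rewrite (_ : (fun n => E (u_ (psi n))) = (fun n => E (m_ (psi n))))//.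
  by apply/funext => n; have [_ ->] := argj _ _ (hu _ (psi0 n)).
split.
- rewrite infi (_ : (fun j => _) = (fun j => (E (m_ j))%:E)); last exact/funext.
  exact: cvgn_EFin.
- move=> j _; have [bj rj mj] := hm j; exists (m_ j); split => //.
  by rewrite infj; exact: (S_E _ _ hd bj rj).
- by exists ui; exact: argi.
- move=> u_ hu.
  have [bu cu] := sub u_ succn hu (fun p q => id) (fun l => ltn0Sn l).
  have [C hC] : exists C, forall n, E (u_ n.+1) <= C.
    have /cvg_seq_bounded[C [_ hC]] : cvgn (fun n => E (u_ n.+1)) by apply/cvg_ex; exists (E ui).
    exists (C + 1) => n; apply: le_trans (ler_norm _) _.
    by apply: (hC (C + 1)) => //; rewrite ltrDl.
  have [K [_ lK vK]] := bounded_energy halpha1 halpha hd hC.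
  have [phi [w [hphi cw]]] := BV_compactness bu lK vK.
  have hphi' : {homo succn \o phi : p q / (p < q)%N} by move=> p q /hphi.
  have [bu' cu'] := sub u_ (succn \o phi) hu hphi' (fun l => ltn0Sn _).
  have [bw le weak] := energy_lsc halpha1 halpha hd bu' cw cu'.
  have [psi [hpsi w1 w2]] := weak (mi w bw).
  exists ((succn \o phi) \o psi), w; split => //.
  exact: homo_ltn_comp hphi' hpsi.
- move=> u_ hu psi w hpsi psi0 bw [cw _] _.
  have [bu cu] := sub u_ psi hu hpsi psi0.
  have [_ le _] := energy_lsc halpha1 halpha hd bu ((L1_cvgP _ _).1 cw) cu.
  exact: argi.
Qed.
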